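(* Let $k$ be a positive integer. Then \[ \zeta_{A(k)}(s)=\Gamma(1-s)I(s,k)+\zeta(s+1)-\frac{1}{k^{s}}\Big(\psi(s)\zeta(s)+\zeta'(s)-\zeta(s)\log k\Big), \] valid for $\operatorname{Re}(s)>1$ (with $\Gamma(1-s)I(s,k)$ interpreted by continuity at positive integers, where $I(n,k)=0$); the right-hand side thereby gives the meromorphic continuation of $\zeta_{A(k)}$ to the whole complex plane.
   Context: For a positive integer $k$, define $A_n(k)$ ($n\ge1$) by $-\frac{\log(1-x)}{1-x^k}=\sum_{n=1}^{\infty}A_n(k)x^n$, and $\zeta_{A(k)}(s)=\sum_{n=1}^{\infty}A_n(k)n^{-s}$ for $\operatorname{Re}(s)>1$. $\zeta$ is the Riemann zeta function, $\psi=\Gamma'/\Gamma$ the digamma function. Define \[ I(s,k)=\frac{1}{2\pi i}\int_{C}\frac{z^{s-1}e^{kz}}{e^{kz}-1}\log\left(\frac{e^{z}-1}{z}\right)dz, \] where $C$ is the Hankel contour: it starts at $-\infty$ along the lower side of the negative real axis, encircles the origin once counterclockwise along a small circle (of radius less than $2\pi/k$, so that no other singularity is enclosed), and returns to $-\infty$ along the upper side of the negative real axis; $z^{s-1}$ uses the branch with $\arg z\in(-\pi,\pi)$, i.e. $z=xe^{-\pi i}$ on the lower edge and $z=xe^{\pi i}$ on the upper edge, and $\log((e^z-1)/z)$ is the branch analytic near $0$ vanishing at $z=0$. *)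

(* Defs.v *)
From Stdlib Require Import Reals ZArith.
From Coquelicot Require Import Coquelicot.
Local Open Scope C_scope.

Definition Cexp (z : C) : C :=
  RtoC (exp (Re z)) * (RtoC (cos (Im z)) + Ci * RtoC (sin (Im z))).

(* x^s for a real x > 0. *)
Definition Rpowc (x : R) (s : C) : C := Cexp (s * RtoC (ln x)).

Definition polar (rho theta : R) : C :=
  RtoC rho * (RtoC (cos theta) + Ci * RtoC (sin theta)).

Definition CRInt_gen := @RInt_gen C_R_CompleteNormedModule.
Definition CRInt := @RInt C_R_CompleteNormedModule.

Definition CSeries (a : nat -> C) : C :=
  (Series (fun n => Re (a n)), Series (fun n => Im (a n))).

(* 1/(2 pi i) times the integral of z^(s-1) f(z) along the Hankel contour with
   circle of radius r.  A point of the contour is z = rho e^(i theta) with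
   theta in [-pi, pi], and there z^(s-1) = exp ((s-1) (ln rho + i theta)); the
   two edges are theta = -pi (run from rho = +oo to r) and theta = pi (run
   from rho = r to +oo), both lying over the negative real axis. *)
Definition hankel_integral (r : R) (s : C) (f : C -> C) : C :=
  let zpow (rho theta : R) := Cexp ((s - 1) * (ln rho, theta)) in
  let edge (theta rho : R) :=
    zpow rho theta * f (polar rho theta) * polar 1 theta in
  let circle (theta : R) :=
    zpow r theta * f (polar r theta) * (Ci * polar r theta) in
  / (RtoC (2 * PI) * Ci) *
  (CRInt_gen (edge (- PI)%R) (Rbar_locally p_infty) (at_point r)
   + CRInt circle (- PI)%R PI
   + CRInt_gen (edge PI) (at_point r) (Rbar_locally p_infty)).

(* Euler's integral, convergent for Re s > 0. *)
Definition Gamma_integral (s : C) : C :=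
  CRInt_gen (fun t : R => Rpowc t (s - 1) * RtoC (exp (- t)))
            (at_right 0) (Rbar_locally p_infty).

(* s (s+1) ... (s+n-1) *)
Fixpoint rising (s : C) (n : nat) : C :=
  match n with
  | O => 1
  | S m => rising s m * (s + RtoC (INR m))
  end.

(* Continuation of Euler's integral by the functional equation: the shift n is
   the least natural number with Re s + n > 0, so n = 0 when Re s > 0.  The
   values at the poles 0, -1, -2, ... are meaningless. *)
Definition Gamma (s : C) : C :=
  let n := Z.to_nat (up (- Re s)) in
  Gamma_integral (s + RtoC (INR n)) / rising s n.

Definition digamma (s : C) : C := C_derive Gamma s / Gamma s.

(* The Dirichlet series for Re s > 1, and its classical continuation
   Gamma(1-s)/(2 pi i) int_C z^(s-1) e^z/(1-e^z) dz elsewhere.  Any radius in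
   (0, 2 pi) gives the same value.  The value at the pole s = 1 is
   meaningless. *)
Definition zeta (s : C) : C :=
  if Rlt_dec 1 (Re s)
  then CSeries (fun n => Rpowc (INR (S n)) (- s))
  else Gamma (1 - s) *
       hankel_integral 1 s (fun z => Cexp z / (1 - Cexp z)).

(* A_n(k), the coefficient of x^n in the power series expansion at 0 of
   - log(1-x) / (1-x^k). *)
Definition A_coef (k n : nat) : R :=
  (Derive_n (fun x : R => - ln (1 - x) / (1 - x ^ k)) n 0 / INR (fact n))%R.

(* The branch of log ((e^z-1)/z) that is analytic near 0 and vanishes at 0,
   continued along the segment [0, z] as the integral of the logarithmic
   derivative e^w/(e^w-1) - 1/w of (e^w-1)/w.  No segment to a point with
   |z| < 2 pi or Re z < 0 meets a zero of (e^w-1)/w. *)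
Definition log_branch (z : C) : C :=
  CRInt (fun t : R =>
           let w := RtoC t * z in z * (Cexp w / (Cexp w - 1) - / w)) 0 1.

(* I(s,k), with r the radius of the circle of the contour. *)
Definition Icontour (r : R) (s : C) (k : nat) : C :=
  hankel_integral r s (fun z =>
    let ekz := Cexp (RtoC (INR k) * z) in
    ekz / (ekz - 1) * log_branch z).

(* As usual, the value at s0 itself is not constrained. *)
Definition meromorphic_at (F : C -> C) (s0 : C) : Prop :=
  exists (n : nat) (h : C -> C),
    locally s0 (fun s => ex_derive (K := C_AbsRing) (V := C_NormedModule) h s) /\
    locally' s0 (fun s => h s = Cpow (s - s0) n * F s).

Definition meromorphic (F : C -> C) : Prop := forall s0 : C, meromorphic_at F s0.

Definition positive_integer (s : C) : Prop :=
  exists n : nat, (1 <= n)%nat /\ s = RtoC (INR n).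

(* The right-hand side of the formula, with G(s) in the place of
   Gamma(1-s) I(s,k). *)
Definition rhs (k : nat) (G : C -> C) (s : C) : C :=
  G s + zeta (s + 1)
  - / Rpowc (INR k) s *
    (digamma s * zeta s + C_derive zeta s - zeta s * RtoC (ln (INR k))).

(* Main.v *)
(* For Re s > 1 the Mellin transform of
     S(x) = - log(1 - e^-x) / (1 - e^-kx) = sum_n A_n(k) e^-nx
   is Gamma(s) zeta_A(s).  Writing 1/(1 - e^-kx) = 1 + 1/(e^kx - 1) and
   log(1 - e^-x) = log((1 - e^-x)/x) + log x splits S into
     (a)  - log(1 - e^-x),  with transform Gamma(s) zeta(s+1);
     (b)  - log x / (e^kx - 1),  with transform minus the s-derivative of
          k^-s Gamma(s) zeta(s), the transform of 1/(e^kx - 1);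
     (c)  - log((1 - e^-x)/x) / (e^kx - 1),  with transform
          Gamma(s) Gamma(1-s) I(s,k).
   In (c), shrinking the circle of the Hankel contour turns I(s,k) into
   sin(pi s)/pi times the transform, and Gamma(s) Gamma(1-s) sin(pi s) = pi.
   The same collapse for e^z/(1 - e^z) reconciles the two definitions of zeta. *)

Require Import Defs.
From Stdlib Require Import Reals Lra Lia Psatz ZArith.
From Coquelicot Require Import Coquelicot.
Local Open Scope C_scope.

(** * Complex differentiation and continuity *)

(** Differentiation in s under an integral sign always rests on the second-order estimate for e^u -
    1 - u, dominated by a function with an explicit primitive. Holomorphy is carried as two complex
    derivatives, because zeta' and Gamma' occur in the formula and must themselves be
    differentiable. Cauchy's theorem enters as one statement on slit annuli in polar coordinates,
    where z^s is the single-valued e^(s (ln rho + i theta)); differentiating a radial integral in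
    the angle proves it. The main obstacle is Gamma(s) Gamma(1-s) sin(pi s) = pi, with Gamma known
    only as Euler's integral and its shifts. The beta integral is evaluated by the same polar Cauchy
    statement, after subtracting the case s = 1/2, which atan settles; continuity then reaches the
    line Re s = 1 and shifts do the rest. At a positive integer Gamma(1-s) has a pole where I(s,k)
    vanishes. Hence G is defined on Re s > 0 as the transform (c) divided by Gamma(s), which is
    holomorphic there, and is joined to the contour formula along an overlapping strip. *)

Definition cder (f : C -> C) (z l : C) : Prop :=
  is_derive (K := C_AbsRing) (V := C_NormedModule) f z l.

Definition rder (f : R -> C) (t : R) (l : C) : Prop :=
  is_derive (K := R_AbsRing) (V := C_R_NormedModule) f t l.

Lemma Rlt_Rmin (x a b : R) : (x < Rmin a b -> x < a /\ x < b)%R.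
Proof. intros H. split; eapply Rlt_le_trans; [exact H|apply Rmin_l|exact H|apply Rmin_r]. Qed.

Lemma ball_Rabs (x e y : R) : ball x e y <-> (Rabs (y - x) < e)%R.
Proof. reflexivity. Qed.

Lemma at_right_0_between (d : R) : (0 < d)%R -> at_right 0 (fun x => 0 < x < d)%R.
Proof.
  intros Hd. exists (mkposreal _ Hd). intros x Hb Hx.
  apply (proj1 (ball_Rabs 0 d x)), Rabs_def2 in Hb. lra.
Qed.

Lemma norm_C_R (z : C) : norm (V := C_R_NormedModule) z = Cmod z.
Proof.
  unfold norm; simpl. unfold prod_norm, Cmod, norm; simpl. unfold abs; simpl.
  f_equal. rewrite !Rmult_1_r, <- !Rabs_mult, !Rabs_pos_eq; nra.
Qed.

(** Neighbourhoods in [C] are built from product balls, that is squares, while the estimates below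
    produce discs. *)
Lemma locally_C_Cmod (z : C) (P : C -> Prop) :
  locally z P <-> exists d : posreal, forall y, (Cmod (y - z) < d)%R -> P y.
Proof.
  split.
  - intros H. destruct (locally_norm_le_locally (V := C_NormedModule) z P H) as [d Hd].
    exists d. intros y Hy. apply Hd. exact Hy.
  - intros [d Hd]. apply (locally_le_locally_norm (V := C_NormedModule) z P).
    exists d. intros y Hy. apply Hd. exact Hy.
Qed.

Lemma Cmod_minus_sym (x y : C) : Cmod (x - y) = Cmod (y - x).
Proof. rewrite <- Cmod_opp. f_equal. ring. Qed.

(** Derivatives under an integral sign arise as bounds on a remainder in [Cmod]; this form accepts
    them directly. *)
Lemma cder_eps (f : C -> C) (z l : C) :
  cder f z l <-> forall eps : posreal, exists d : posreal, forall y,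
    (Cmod (y - z) < d -> Cmod (f y - f z - (y - z) * l) <= eps * Cmod (y - z))%R.
Proof.
  split.
  - intros [_ H] eps. specialize (H z (fun P HP => HP) eps).
    destruct H as [d Hd]. exists d. intros y Hy.
    apply (Hd y Hy).
  - intros H. split; [apply is_linear_scal_l|].
    intros x Hx eps.
    assert (x = z).
    { symmetry. apply is_filter_lim_locally_unique. exact Hx. }
    subst x. destruct (H eps) as [d Hd].
    exists d. intros y Hy. apply (Hd y Hy).
Qed.

Lemma rder_eps (f : R -> C) (t : R) (l : C) :
  rder f t l <-> forall eps : posreal, exists d : posreal, forall y : R,
    (Rabs (y - t) < d -> Cmod (f y - f t - (y - t)%R * l) <= eps * Rabs (y - t))%R.
Proof.
  assert (E : forall y, norm (V := C_R_NormedModule)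
     (minus (minus (f y) (f t)) (scal (minus y t) l)) = Cmod (f y - f t - (y - t)%R * l)).
  { intros y. rewrite norm_C_R. f_equal. rewrite <- scal_R_Cmult. reflexivity. }
  split.
  - intros [_ H] eps. specialize (H t (fun P HP => HP) eps).
    destruct H as [d Hd]. exists d. intros y Hy. eapply Rle_trans; [apply Req_le, eq_sym, (E y)|].
    apply (Hd y Hy).
  - intros H. split; [apply is_linear_scal_l|].
    intros x Hx eps.
    assert (x = t).
    { symmetry. apply is_filter_lim_locally_unique. exact Hx. }
    subst x. destruct (H eps) as [d Hd].
    exists d. intros y Hy. eapply Rle_trans; [apply Req_le, (E y)|]. apply (Hd y Hy).
Qed.

Lemma rder_pair (f : R -> C) (t : R) (l : C) :
  rder f t l <->
  is_derive (fun x => Re (f x)) t (Re l) /\ is_derive (fun x => Im (f x)) t (Im l).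
Proof.
  split.
  - intros H. split.
    + apply (filterdiff_comp' f Re t _ Re H).
      apply filterdiff_linear. apply is_linear_fst.
    + apply (filterdiff_comp' f Im t _ Im H).
      apply filterdiff_linear. apply is_linear_snd.
  - intros [H1 H2]. apply rder_eps. intros eps.
    assert (He : (0 < eps / 2)%R) by (destruct eps; simpl; lra).
    destruct H1 as [_ H1], H2 as [_ H2].
    specialize (H1 t (fun P HP => HP) (mkposreal _ He)).
    specialize (H2 t (fun P HP => HP) (mkposreal _ He)).
    destruct (filter_and _ _ H1 H2) as [d Hd]. exists d. intros y Hy.
    destruct (Hd y Hy) as [A B].
    unfold norm, minus, plus, opp, scal in A, B; simpl in A, B.
    unfold abs, mult in A, B; simpl in A, B.
    eapply Rle_trans; [apply Cmod_2Rmax|].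
    (* The modulus is at most sqrt 2 times the larger component, so a bound of eps / 2 on each
       component is enough. *)
    assert (S : (sqrt 2 <= 2)%R).
    { rewrite <- (sqrt_square 2) at 2 by lra. apply sqrt_le_1; lra. }
    assert (M : (Rmax (Rabs (fst (f y - f t - (y - t)%R * l)%C))
                     (Rabs (snd (f y - f t - (y - t)%R * l)%C)) <= eps / 2 * Rabs (y - t))%R).
    { apply Rmax_lub.
      - eapply Rle_trans; [|exact A]. apply Req_le. f_equal. simpl. unfold Re. ring.
      - eapply Rle_trans; [|exact B]. apply Req_le. f_equal. simpl. unfold Im. ring. }
    assert (0 <= Rmax (Rabs (fst (f y - f t - (y - t)%R * l)%C))
                     (Rabs (snd (f y - f t - (y - t)%R * l)%C)))%R
      by (eapply Rle_trans; [apply Rabs_pos|apply Rmax_l]).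
    nra.
Qed.

Lemma continuous_C_pair {T : UniformSpace} (f : T -> C) (x : T) :
  continuous f x <->
  continuous (fun t => Re (f t)) x /\ continuous (fun t => Im (f t)) x.
Proof.
  split.
  - intros H. split.
    + apply (continuous_comp f Re); [exact H|]. apply continuous_fst.
    + apply (continuous_comp f Im); [exact H|]. apply continuous_snd.
  - intros [H1 H2]. apply filterlim_locally. intros eps.
    generalize (proj1 (filterlim_locally _ _) H1 eps).
    generalize (proj1 (filterlim_locally _ _) H2 eps).
    intros A B. generalize (filter_and _ _ A B). apply filter_imp.
    intros y [Y1 Y2]. split; assumption.
Qed.

Lemma continuous_Cmod_eps {T : UniformSpace} (f : T -> C) (x : T) :
  continuous f x <-> forall eps : posreal, locally x (fun y => (Cmod (f y - f x) < eps)%R).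
Proof.
  split.
  - intros H eps. apply (H (fun z => Cmod (z - f x) < eps)%R).
    apply (proj2 (locally_C_Cmod (f x) _)). exists eps. auto.
  - intros H P HP. destruct (proj1 (locally_C_Cmod (f x) _) HP) as [d Hd].
    unfold filtermap. generalize (H d). apply filter_imp. auto.
Qed.

Section Continuity.
Context {T : UniformSpace}.
Implicit Types (f g : T -> C) (x : T).

Lemma cont_plus f g x :
  continuous f x -> continuous g x -> continuous (fun t => f t + g t) x.
Proof. apply (continuous_plus (V := C_NormedModule)). Qed.

Lemma cont_opp f x : continuous f x -> continuous (fun t => - f t) x.
Proof. apply (continuous_opp (V := C_NormedModule)). Qed.

Lemma cont_minus f g x :
  continuous f x -> continuous g x -> continuous (fun t => f t - g t) x.
Proof. apply (continuous_minus (V := C_NormedModule)). Qed.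

Lemma cont_mult f g x :
  continuous f x -> continuous g x -> continuous (fun t => f t * g t) x.
Proof.
  intros Hf Hg. apply continuous_C_pair in Hf, Hg. destruct Hf, Hg.
  apply continuous_C_pair. unfold Re, Im in *. simpl. split.
  - apply (continuous_minus (V := R_NormedModule)); apply (continuous_mult (K := R_AbsRing)); assumption.
  - apply (continuous_plus (V := R_NormedModule)); apply (continuous_mult (K := R_AbsRing)); assumption.
Qed.

Lemma cont_RtoC (f : T -> R) x : continuous f x -> continuous (fun t => RtoC (f t)) x.
Proof.
  intros Hf. apply continuous_C_pair. split; [exact Hf|]. apply continuous_const.
Qed.

Lemma cont_pair (f g : T -> R) x :
  continuous f x -> continuous g x -> continuous (fun t => (f t, g t) : C) x.
Proof. intros Hf Hg. apply continuous_C_pair. split; assumption. Qed.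

Lemma cont_inv f x : continuous f x -> f x <> 0 -> continuous (fun t => / f t) x.
Proof.
  intros Hf H0. apply continuous_C_pair in Hf. destruct Hf as [H1 H2].
  assert (D : (fst (f x) ^ 2 + snd (f x) ^ 2 <> 0)%R).
  { intros E. apply H0. apply injective_projections; simpl; nra. }
  assert (Hd : continuous (fun t => / (Re (f t) * Re (f t) + Im (f t) * Im (f t)))%R x).
  { apply continuous_comp with (g := Rinv).
    - apply (continuous_plus (V := R_NormedModule)); apply (continuous_mult (K := R_AbsRing)); assumption.
    - apply continuous_Rinv. unfold Re, Im. nra. }
  apply continuous_C_pair. split.
  - apply continuous_ext with (fun t => Re (f t) * / (Re (f t) * Re (f t) + Im (f t) * Im (f t)))%R.
    { intros t. simpl. unfold Re, Im, Rdiv. rewrite !Rmult_1_r. reflexivity. }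
    apply (continuous_mult (K := R_AbsRing)); assumption.
  - apply continuous_ext with (fun t => - Im (f t) * / (Re (f t) * Re (f t) + Im (f t) * Im (f t)))%R.
    { intros t. simpl. unfold Re, Im, Rdiv. rewrite !Rmult_1_r. reflexivity. }
    apply (continuous_mult (K := R_AbsRing)); [|assumption].
    apply (continuous_opp (V := R_NormedModule)). assumption.
Qed.

Lemma cont_div f g x :
  continuous f x -> continuous g x -> g x <> 0 -> continuous (fun t => f t / g t) x.
Proof. intros. apply cont_mult; [|apply cont_inv]; assumption. Qed.

Lemma cont_const (c : C) x : continuous (fun _ : T => c) x.
Proof. apply continuous_const. Qed.

Lemma cont_Cmod f x : continuous f x -> continuous (fun t => Cmod (f t)) x.
Proof. intros Hf. apply (continuous_comp f Cmod); [assumption|].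
  apply (filterlim_norm (V := C_NormedModule)). Qed.

Lemma continuous_Rcomp (f : T -> R) (g : R -> R) x :
  continuous f x -> continuous g (f x) -> continuous (fun t => g (f t)) x.
Proof. apply continuous_comp. Qed.

Lemma cont_Cexp f x : continuous f x -> continuous (fun t => Cexp (f t)) x.
Proof.
  intros Hf. apply continuous_C_pair in Hf. destruct Hf as [H1 H2].
  unfold Cexp. apply cont_mult; [|apply cont_plus; [|apply cont_mult; [apply cont_const|]]];
    apply cont_RtoC; apply continuous_Rcomp; try assumption.
  - apply continuous_exp.
  - apply continuous_cos.
  - apply continuous_sin.
Qed.

End Continuity.

(** * The complex exponential and its Taylor estimates *)

Lemma Cexp_components (z : C) :
  Cexp z = ((exp (Re z) * cos (Im z))%R, (exp (Re z) * sin (Im z))%R).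
Proof. unfold Cexp. apply injective_projections; simpl; ring. Qed.

Lemma Cexp_plus (a b : C) : Cexp (a + b) = Cexp a * Cexp b.
Proof.
  rewrite !Cexp_components. unfold Re, Im. simpl.
  rewrite exp_plus, cos_plus, sin_plus. apply injective_projections; simpl; ring.
Qed.

Lemma Cexp_RtoC (x : R) : Cexp x = exp x.
Proof.
  rewrite Cexp_components. unfold Re, Im. simpl. rewrite cos_0, sin_0.
  apply injective_projections; simpl; ring.
Qed.

Lemma Cexp_0 : Cexp 0 = 1.
Proof. rewrite Cexp_RtoC, exp_0. reflexivity. Qed.

Lemma Cmod_Cexp (z : C) : Cmod (Cexp z) = exp (Re z).
Proof.
  rewrite Cexp_components. unfold Cmod. simpl.
  generalize (sin2_cos2 (Im z)). unfold Rsqr. intros H.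
  replace (_ + _)%R with ((exp (Re z)) * (exp (Re z)))%R by nra.
  apply sqrt_square. left. apply exp_pos.
Qed.

Lemma Cexp_neq_0 (z : C) : Cexp z <> 0.
Proof. apply Cmod_gt_0. rewrite Cmod_Cexp. apply exp_pos. Qed.

Lemma Cexp_opp (z : C) : Cexp (- z) = / Cexp z.
Proof.
  assert (Cexp (- z) * Cexp z = 1).
  { rewrite <- Cexp_plus. replace (- z + z) with (RtoC 0) by ring. apply Cexp_0. }
  rewrite <- (Cmult_1_l (/ Cexp z)), <- H. field. apply Cexp_neq_0.
Qed.

Lemma Cexp_minus (a b : C) : Cexp (a - b) = Cexp a / Cexp b.
Proof. unfold Cminus, Cdiv. rewrite Cexp_plus, Cexp_opp. reflexivity. Qed.

Lemma Im_le_Cmod (c : C) : (Rabs (Im c) <= Cmod c)%R.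
Proof. eapply Rle_trans; [apply Rmax_r|apply Rmax_Cmod]. Qed.

Lemma rder_Cexp_line (u : C) (t : R) : rder (fun t : R => Cexp (t * u)) t (u * Cexp (t * u)).
Proof.
  apply rder_pair. destruct u as [a b]. unfold Cexp, Re, Im. simpl. split.
  - auto_derive; [easy|unfold Rminus; ring].
  - auto_derive; [easy|unfold Rminus; ring].
Qed.

Definition crint (f : R -> C) (a b : R) (l : C) : Prop :=
  is_RInt (V := C_R_NormedModule) f a b l.

Lemma norm_crint_le (f : R -> C) (M a b : R) (l : C) :
  (a <= b)%R -> (forall t, a <= t <= b -> Cmod (f t) <= M)%R ->
  crint f a b l -> (Cmod l <= (b - a) * M)%R.
Proof.
  intros Hab Hf Hl. rewrite <- norm_C_R.
  eapply (norm_RInt_le f (fun _ => M) a b l _ Hab); [|exact Hl|].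
  - intros x Hx. rewrite norm_C_R. auto.
  - apply (is_RInt_const (V := R_NormedModule)).
Qed.

(** e^u - 1 is the integral of u e^(tu) over [0, 1], whose integrand is bounded pointwise. *)
Lemma Cmod_Cexp_minus_1 (u : C) : (Cmod (Cexp u - 1) <= Cmod u * exp (Cmod u))%R.
Proof.
  assert (H : crint (fun t : R => u * Cexp (t * u)) 0 1
                (minus (Cexp (1 * u)) (Cexp (0 * u)))).
  { apply (is_RInt_derive (V := C_R_CompleteNormedModule) (fun t : R => Cexp (t * u))).
    - intros. apply rder_Cexp_line.
    - intros x _. apply cont_mult; [apply cont_const|]. apply cont_Cexp.
      apply cont_mult; [|apply cont_const]. apply cont_RtoC. apply continuous_id. }
  apply (norm_crint_le _ (Cmod u * exp (Cmod u))) in H; [|lra|].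
  - replace (Cexp u - 1) with (minus (Cexp (1 * u)) (Cexp (0 * u)) : C).
    + eapply Rle_trans; [exact H|]. lra.
    + unfold minus, plus, opp; simpl. rewrite Cmult_1_l, Cmult_0_l, Cexp_0. ring.
  - intros t Ht. rewrite Cmod_mult, Cmod_Cexp.
    apply Rmult_le_compat_l; [apply Cmod_ge_0|].
    assert (Re (t * u) <= Cmod u)%R.
    { rewrite re_scal_l. generalize (re_le_Cmod u) (Rle_abs (Re u)) (Cmod_ge_0 u). nra. }
    destruct H0 as [H0|H0]; [left; apply exp_increasing; assumption|rewrite H0; lra].
Qed.

Lemma exp_le (x y : R) : (x <= y -> exp x <= exp y)%R.
Proof. intros [H|H]; [left; apply exp_increasing; assumption|rewrite H; lra]. Qed.

(** e^u - 1 - u is the integral of u (e^(tu) - 1) over [0, 1]; the first-order bound applies to tu.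
    This quadratic remainder is the source of every derivative with respect to s. *)
Lemma Cmod_Cexp_taylor (u : C) :
  (Cmod (Cexp u - 1 - u) <= Cmod u ^ 2 * exp (Cmod u))%R.
Proof.
  assert (H : crint (fun t : R => minus (u * Cexp (t * u)) u) 0 1
                (minus (minus (Cexp (1 * u)) (Cexp (0 * u))) (scal (1 - 0)%R u))).
  { apply (is_RInt_minus (V := C_R_NormedModule)); [|apply (is_RInt_const (V := C_R_NormedModule))].
    apply (is_RInt_derive (V := C_R_CompleteNormedModule) (fun t : R => Cexp (t * u))).
    - intros. apply rder_Cexp_line.
    - intros x _. apply cont_mult; [apply cont_const|]. apply cont_Cexp.
      apply cont_mult; [|apply cont_const]. apply cont_RtoC. apply continuous_id. }
  apply (norm_crint_le _ (Cmod u ^ 2 * exp (Cmod u))) in H; [|lra|].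
  - replace (Cexp u - 1 - u) with (minus (minus (Cexp (1 * u)) (Cexp (0 * u))) (scal (1 - 0)%R u) : C).
    + eapply Rle_trans; [exact H|]. lra.
    + rewrite scal_R_Cmult. unfold minus, plus, opp; simpl.
      rewrite Cmult_1_l, Cmult_0_l, Cexp_0. rewrite Rminus_0_r. ring.
  - intros t Ht. unfold minus, plus, opp; simpl.
    replace (u * Cexp (t * u) + - u) with (u * (Cexp (t * u) - 1)) by ring.
    rewrite Cmod_mult.
    assert (A := Cmod_Cexp_minus_1 (t * u)).
    assert (B : (Cmod (t * u) <= Cmod u)%R).
    { rewrite Cmod_mult, Cmod_R, Rabs_pos_eq by lra. generalize (Cmod_ge_0 u). nra. }
    assert (Cc := exp_le _ _ B).
    generalize (Cmod_ge_0 u) (Cmod_ge_0 (t * u)) (exp_pos (Cmod (t * u))).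
    intros. apply Rle_trans with (Cmod u * (Cmod u * exp (Cmod u)))%R; [|right; ring].
    apply Rmult_le_compat_l; [assumption|]. eapply Rle_trans; [exact A|].
    apply Rmult_le_compat; lra.
Qed.

Lemma cder_Cexp (z : C) : cder Cexp z (Cexp z).
Proof.
  apply cder_eps. intros eps.
  (* With h = y - z, the bound |h| < 1 replaces e^|h| by e, and the second entry makes |e^z| e |h|
     at most eps. *)
  assert (Hd : (0 < Rmin 1 (eps / (Cmod (Cexp z) * exp 1)))%R).
  { apply Rmin_pos; [lra|]. apply Rdiv_lt_0_compat; [apply eps|].
    rewrite Cmod_Cexp. apply Rmult_lt_0_compat; apply exp_pos. }
  exists (mkposreal _ Hd). simpl. intros y Hy.
  replace (Cexp y - Cexp z - (y - z) * Cexp z) with (Cexp z * (Cexp (y - z) - 1 - (y - z))).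
  2: { rewrite Cexp_minus. field. apply Cexp_neq_0. }
  rewrite Cmod_mult. set (h := y - z) in *.
  destruct (Rlt_Rmin _ _ _ Hy) as [H1 H2].
  assert (P : (0 < Cmod (Cexp z))%R) by (rewrite Cmod_Cexp; apply exp_pos).
  apply Rlt_div_r in H2; [|apply Rmult_lt_0_compat; [assumption|apply exp_pos]].
  eapply Rle_trans; [apply Rmult_le_compat_l; [lra|apply Cmod_Cexp_taylor]|].
  assert (E : (exp (Cmod h) <= exp 1)%R) by (apply exp_le; lra).
  assert (Q := Cmod_ge_0 h). assert (E1 := exp_pos (Cmod h)).
  apply Rle_trans with (Cmod (Cexp z) * (Cmod h ^ 2 * exp 1))%R.
  - apply Rmult_le_compat_l; [lra|]. apply Rmult_le_compat_l; [nra|assumption].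
  - replace (Cmod (Cexp z) * (Cmod h ^ 2 * exp 1))%R
      with (Cmod h * (Cmod (Cexp z) * exp 1) * Cmod h)%R by ring.
    apply Rmult_le_compat_r; lra.
Qed.

(** * Rules for complex and real derivatives *)

Lemma cder_eq (f : C -> C) (z l l' : C) : cder f z l -> l = l' -> cder f z l'.
Proof. intros H <-. exact H. Qed.

Lemma rder_eq (f : R -> C) (t : R) (l l' : C) : rder f t l -> l = l' -> rder f t l'.
Proof. intros H <-. exact H. Qed.

Lemma cder_const (c z : C) : cder (fun _ => c) z 0.
Proof. apply (is_derive_const (V := C_NormedModule)). Qed.

Lemma cder_id (z : C) : cder (fun w => w) z 1.
Proof.
  apply cder_eps. intros eps. exists eps. intros y _.
  replace (y - z - (y - z) * 1) with (RtoC 0) by ring. rewrite Cmod_0.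
  apply Rmult_le_pos; [left; apply eps|apply Cmod_ge_0].
Qed.

Lemma cder_plus (f g : C -> C) (z a b : C) :
  cder f z a -> cder g z b -> cder (fun w => f w + g w) z (a + b).
Proof. apply (is_derive_plus (V := C_NormedModule)). Qed.

Lemma cder_opp (f : C -> C) (z a : C) : cder f z a -> cder (fun w => - f w) z (- a).
Proof. apply (is_derive_opp (V := C_NormedModule)). Qed.

Lemma cder_minus (f g : C -> C) (z a b : C) :
  cder f z a -> cder g z b -> cder (fun w => f w - g w) z (a - b).
Proof. apply (is_derive_minus (V := C_NormedModule)). Qed.

(** The two normed-module structures on [C] share their norm, and the remainder condition on the
    values involves only the norm. The product and chain rules are stated for the ring as a module
    over itself. *)
Lemma cder_AbsRing (f : C -> C) (z l : C) :
  cder f z l <-> is_derive (K := C_AbsRing) (V := AbsRing_NormedModule C_AbsRing) f z l.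
Proof.
  split; intros [_ H]; (split; [apply is_linear_scal_l|exact H]).
Qed.

Lemma cder_mult (f g : C -> C) (z a b : C) :
  cder f z a -> cder g z b -> cder (fun w => f w * g w) z (a * g z + f z * b).
Proof.
  intros Hf Hg. apply cder_AbsRing. apply cder_AbsRing in Hf, Hg.
  apply (is_derive_mult (K := C_AbsRing) f g z a b Hf Hg). intros. apply Cmult_comm.
Qed.

Lemma cder_comp (f g : C -> C) (z a b : C) :
  cder f (g z) a -> cder g z b -> cder (fun w => f (g w)) z (b * a).
Proof.
  intros Hf Hg. apply cder_AbsRing in Hg.
  apply (is_derive_comp (K := C_AbsRing) (V := C_NormedModule) f g z a b Hf Hg).
Qed.

Lemma cder_continuous (f : C -> C) (z l : C) : cder f z l -> continuous (T := C_UniformSpace) f z.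
Proof.
  intros H. apply continuous_Cmod_eps. intros eps.
  destruct (proj1 (cder_eps f z l) H (mkposreal 1 Rlt_0_1)) as [d Hd]. simpl in Hd.
  assert (M : (0 < 1 + Cmod l)%R) by (generalize (Cmod_ge_0 l); lra).
  assert (Hp : (0 < Rmin d (eps / (1 + Cmod l)))%R).
  { apply Rmin_pos; [apply d|]. apply Rdiv_lt_0_compat; [apply eps|exact M]. }
  apply (proj2 (locally_C_Cmod z _)). exists (mkposreal _ Hp). simpl. intros y Hy.
  destruct (Rlt_Rmin _ _ _ Hy) as [H1 H2].
  apply Rlt_div_r in H2; [|exact M].
  replace (f y - f z) with ((f y - f z - (y - z) * l) + (y - z) * l) by ring.
  eapply Rle_lt_trans; [apply Cmod_triangle|]. rewrite Cmod_mult.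
  generalize (Hd y H1). lra.
Qed.

Lemma Cmod_neq_0_pos (z : C) : z <> 0 -> (0 < Cmod z)%R.
Proof. apply Cmod_gt_0. Qed.

Lemma cder_Cinv (z : C) : z <> 0 -> cder Cinv z (- / (z * z)).
Proof.
  intros Hz. assert (P := Cmod_neq_0_pos z Hz). apply cder_eps. intros eps.
  (* The remainder is exactly (y - z)^2 / (y z^2). The first entry keeps |y| > |z| / 2, the second
     then gives the factor eps. *)
  assert (Hp : (0 < Rmin (Cmod z / 2) (eps * Cmod z ^ 3 / 2))%R).
  { apply Rmin_pos; [lra|]. generalize (cond_pos eps) (pow_lt _ 3 P). nra. }
  exists (mkposreal _ Hp). simpl. intros y Hy.
  destruct (Rlt_Rmin _ _ _ Hy) as [H1 H2].
  assert (H3 : (Cmod z / 2 < Cmod y)%R).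
  { assert (T := Cmod_triangle y (- (y - z))). rewrite Cmod_opp in T.
    replace (y + - (y - z)) with z in T by ring. lra. }
  assert (Hy0 : y <> 0).
  { intros ->. rewrite Cmod_0 in H3. lra. }
  replace (/ y - / z - (y - z) * - / (z * z)) with ((y - z) * (y - z) * / (y * (z * z))) by (field; auto).
  rewrite !Cmod_mult, Cmod_inv, !Cmod_mult by (repeat apply Cmult_neq_0; assumption).
  set (h := Cmod (y - z)) in *. assert (0 <= h)%R by apply Cmod_ge_0.
  apply Rle_trans with (h * (h * / (Cmod z / 2 * (Cmod z * Cmod z))))%R.
  - rewrite Rmult_assoc. apply Rmult_le_compat_l; [assumption|].
    apply Rmult_le_compat_l; [assumption|].
    assert (Q : (0 < Cmod z * Cmod z)%R) by (apply Rmult_lt_0_compat; lra).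
    apply Rinv_le_contravar; [apply Rmult_lt_0_compat; lra|]. apply Rmult_le_compat_r; lra.
  - rewrite (Rmult_comm (pos eps)). apply Rmult_le_compat_l; [assumption|].
    apply Rle_div_l; [repeat apply Rmult_lt_0_compat; lra|]. simpl in H2.
    replace (eps * (Cmod z / 2 * (Cmod z * Cmod z)))%R
      with (eps * (Cmod z * (Cmod z * (Cmod z * 1))) / 2)%R by field. lra.
Qed.

Lemma cder_inv (f : C -> C) (z l : C) :
  cder f z l -> f z <> 0 -> cder (fun w => / f w) z (- l / (f z * f z)).
Proof.
  intros H H0.
  eapply cder_eq; [apply (cder_comp Cinv f z (- / (f z * f z)) l); [apply cder_Cinv|]; assumption|].
  field. exact H0.
Qed.

Lemma cder_ext_loc (f g : C -> C) (z l : C) :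
  locally z (fun w => f w = g w) -> cder f z l -> cder g z l.
Proof.
  intros H Hf. destruct (proj1 (locally_C_Cmod z _) H) as [d Hd].
  apply (is_derive_ext_loc (K := C_AbsRing) (V := C_NormedModule) f g z l); [|exact Hf].
  exists d. intros y Hy. apply Hd. exact Hy.
Qed.

Lemma cder_unique (f : C -> C) (z a b : C) : cder f z a -> cder f z b -> a = b.
Proof.
  intros Ha Hb. rewrite <- (is_C_derive_unique f z a Ha). apply is_C_derive_unique, Hb.
Qed.

Lemma cder_scal (f : C -> C) (c z l : C) : cder f z l -> cder (fun w => c * f w) z (c * l).
Proof.
  intros H. eapply cder_eq; [apply (cder_mult (fun _ => c) f); [apply cder_const|exact H]|]. ring.
Qed.

Lemma rder_comp_cder (f : C -> C) (g : R -> C) (t : R) (a b : C) :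
  cder f (g t) a -> rder g t b -> rder (fun x => f (g x)) t (b * a).
Proof.
  intros Hf Hg. apply rder_eps. intros eps.
  (* The error is the remainder of f at g t, charged eps / 2 through [e1], plus a times the
     remainder of g, charged eps / 2 through [e2]. That [e2] is at most 1 gives |g y - g t| <= (1 +
     |b|) |y - t|, which converts the estimate for f. *)
  set (e1 := (eps / (2 * (1 + Cmod b)))%R).
  assert (B := Cmod_ge_0 b). assert (A := Cmod_ge_0 a).
  assert (He1 : (0 < e1)%R) by (apply Rdiv_lt_0_compat; [apply eps|lra]).
  set (e2 := Rmin 1 (eps / (2 * (1 + Cmod a)))).
  assert (He2 : (0 < e2)%R).
  { apply Rmin_pos; [lra|]. apply Rdiv_lt_0_compat; [apply eps|lra]. }
  destruct (proj1 (cder_eps _ _ _) Hf (mkposreal _ He1)) as [d1 D1].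
  destruct (proj1 (rder_eps _ _ _) Hg (mkposreal _ He2)) as [d2 D2].
  simpl in D1, D2.
  assert (Hp : (0 < Rmin d2 (d1 / (1 + Cmod b)))%R).
  { apply Rmin_pos; [apply d2|]. apply Rdiv_lt_0_compat; [apply d1|lra]. }
  exists (mkposreal _ Hp). simpl. intros y Hy.
  destruct (Rlt_Rmin _ _ _ Hy) as [Y1 Y2].
  apply Rlt_div_r in Y2; [|lra].
  specialize (D2 y Y1). set (h := Rabs (y - t)) in *. assert (Hh : (0 <= h)%R) by apply Rabs_pos.
  assert (E1 : (e2 <= 1)%R) by apply Rmin_l.
  assert (E2 : (e2 * (1 + Cmod a) <= eps / 2)%R).
  { apply Rle_trans with (eps / (2 * (1 + Cmod a)) * (1 + Cmod a))%R.
    - apply Rmult_le_compat_r; [lra|apply Rmin_r].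
    - right. field. lra. }
  assert (Gy : (Cmod (g y - g t) <= (1 + Cmod b) * h)%R).
  { replace (g y - g t) with ((g y - g t - (y - t)%R * b) + (y - t)%R * b) by ring.
    eapply Rle_trans; [apply Cmod_triangle|]. rewrite Cmod_mult, Cmod_R. fold h. nra. }
  assert (Gd : (Cmod (g y - g t) < d1)%R) by lra.
  specialize (D1 _ Gd).
  replace (f (g y) - f (g t) - (y - t)%R * (b * a)) with
    ((f (g y) - f (g t) - (g y - g t) * a) + (g y - g t - (y - t)%R * b) * a) by ring.
  eapply Rle_trans; [apply Cmod_triangle|]. rewrite Cmod_mult.
  assert (E3 : (e1 * ((1 + Cmod b) * h) = eps / 2 * h)%R) by (unfold e1; field; lra).
  assert (e1 * Cmod (g y - g t) <= eps / 2 * h)%R.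
  { rewrite <- E3. apply Rmult_le_compat_l; lra. }
  assert (Cmod (g y - g t - (y - t)%R * b) * Cmod a <= eps / 2 * h)%R.
  { apply Rle_trans with (e2 * h * (1 + Cmod a))%R.
    - apply Rmult_le_compat; try lra. apply Cmod_ge_0.
    - nra. }
  lra.
Qed.

Lemma rder_const (c : C) (t : R) : rder (fun _ => c) t 0.
Proof. apply (is_derive_const (V := C_R_NormedModule)). Qed.

Lemma rder_mult (f g : R -> C) (t : R) (a b : C) :
  rder f t a -> rder g t b -> rder (fun w => f w * g w) t (a * g t + f t * b).
Proof.
  intros Hf Hg. apply rder_pair in Hf, Hg. destruct Hf as [F1 F2], Hg as [G1 G2].
  apply rder_pair. unfold Re, Im in *. simpl. split.
  - eapply is_derive_ext; [intros; reflexivity|].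
    evar_last.
    { apply @is_derive_minus; apply (is_derive_mult (K := R_AbsRing)); try eassumption; intros; apply Rmult_comm.
      }
    unfold minus, plus, opp, mult; simpl. ring.
  - evar_last.
    { apply @is_derive_plus; apply (is_derive_mult (K := R_AbsRing)); try eassumption; intros; apply Rmult_comm.
      }
    unfold minus, plus, opp, mult; simpl. ring.
Qed.

Lemma rder_RtoC (f : R -> R) (t l : R) : is_derive f t l -> rder (fun x => RtoC (f x)) t l.
Proof.
  intros H. apply rder_pair. split; [exact H|].
  unfold Im. simpl. apply (is_derive_const (V := R_NormedModule)).
Qed.

Lemma rder_scal (f : R -> C) (c : C) (t : R) (l : C) :
  rder f t l -> rder (fun x => c * f x) t (c * l).
Proof.
  intros H. eapply rder_eq; [apply (rder_mult (fun _ => c) f); [apply rder_const|exact H]|]. ring.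
Qed.

Lemma rder_ext_loc (f g : R -> C) (t : R) (l : C) :
  locally t (fun x => f x = g x) -> rder f t l -> rder g t l.
Proof. apply (is_derive_ext_loc (K := R_AbsRing) (V := C_R_NormedModule)). Qed.

Lemma rder_ext (f g : R -> C) (t : R) (l : C) :
  (forall x, f x = g x) -> rder f t l -> rder g t l.
Proof. apply (is_derive_ext (K := R_AbsRing) (V := C_R_NormedModule)). Qed.

Lemma rder_continuous (f : R -> C) (t : R) (l : C) : rder f t l -> continuous f t.
Proof. intros H. apply (ex_derive_continuous (V := C_R_NormedModule)). exists l. exact H. Qed.

(** * Complex differentiability on a neighbourhood *)

Definition hol1 (f : C -> C) (z : C) : Prop :=
  locally z (fun y => ex_derive (K := C_AbsRing) (V := C_NormedModule) f y).

(** The formula contains [C_derive zeta] and [C_derive Gamma]. A second derivative is therefore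
    carried through every construction, so that these are differentiable near a regular point. *)
Definition hol2 (f : C -> C) (z : C) : Prop :=
  exists f' : C -> C,
    locally z (fun y => cder f y (f' y) /\ ex_derive (K := C_AbsRing) (V := C_NormedModule) f' y).

Lemma hol2_hol1 f z : hol2 f z -> hol1 f z.
Proof.
  intros [f' H]. unfold hol1. revert H. apply filter_imp. intros y [H _]. exists (f' y). exact H.
Qed.

Lemma locally_C_eq (z : C) (P : C -> Prop) : locally z P -> P z.
Proof. apply locally_singleton. Qed.

Lemma hol1_cder f z : hol1 f z -> cder f z (C_derive f z).
Proof. intros H. apply locally_C_eq in H. apply C_derive_correct; [exact 0|exact H]. Qed.

Lemma hol1_continuous f z : hol1 f z -> continuous (T := C_UniformSpace) f z.
Proof. intros H. apply cder_continuous with (C_derive f z), hol1_cder, H. Qed.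

Lemma hol1_ext_loc f g z : locally z (fun w => f w = g w) -> hol1 f z -> hol1 g z.
Proof.
  intros E H. unfold hol1 in *. apply locally_locally in E.
  generalize (filter_and _ _ E H). apply filter_imp. intros y [A [l B]].
  exists l. eapply cder_ext_loc; eassumption.
Qed.

Lemma hol2_ext_loc f g z : locally z (fun w => f w = g w) -> hol2 f z -> hol2 g z.
Proof.
  intros E [f' H]. exists f'. apply locally_locally in E.
  generalize (filter_and _ _ E H). apply filter_imp. intros y [A [B D]].
  split; [eapply cder_ext_loc; eassumption|exact D].
Qed.

Lemma hol2_C_derive f z : hol2 f z -> hol1 (C_derive f) z.
Proof.
  intros [f' H].
  apply hol1_ext_loc with f'.
  - revert H. apply filter_imp. intros y [A _]. symmetry. apply is_C_derive_unique, A.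
  - unfold hol1. revert H. apply filter_imp. intros y [_ A]. exact A.
Qed.

Lemma hol1_plus f g z : hol1 f z -> hol1 g z -> hol1 (fun w => f w + g w) z.
Proof.
  unfold hol1. intros F G. generalize (filter_and _ _ F G). apply filter_imp.
  intros y [[a A] [b B]]. exists (a + b). apply cder_plus; assumption.
Qed.

Lemma hol1_mult f g z : hol1 f z -> hol1 g z -> hol1 (fun w => f w * g w) z.
Proof.
  unfold hol1. intros F G. generalize (filter_and _ _ F G). apply filter_imp.
  intros y [[a A] [b B]]. eexists. apply cder_mult; eassumption.
Qed.

Lemma hol1_neq_0 f z : hol1 f z -> f z <> 0 -> locally z (fun y => f y <> 0).
Proof.
  intros F H0. apply hol1_continuous in F. apply (F (fun w : C => w <> 0)).
  apply (proj2 (locally_C_Cmod (f z) (fun w : C => w <> 0))).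
  exists (mkposreal _ (Cmod_neq_0_pos _ H0)). simpl. intros y Hy ->.
  replace (0 - f z) with (- f z) in Hy by ring. rewrite Cmod_opp in Hy. lra.
Qed.

Lemma hol1_inv f z : hol1 f z -> f z <> 0 -> hol1 (fun w => / f w) z.
Proof.
  intros F H0. unfold hol1 in *. generalize (filter_and _ _ F (hol1_neq_0 f z F H0)).
  apply filter_imp.
  intros y [[a A] B]. eexists. apply cder_inv; eassumption.
Qed.

Lemma hol2_plus f g z : hol2 f z -> hol2 g z -> hol2 (fun w => f w + g w) z.
Proof.
  intros [f' F] [g' G]. exists (fun w => f' w + g' w). generalize (filter_and _ _ F G).
  apply filter_imp.
  intros y [[A [a A']] [B [b B']]]. split; [apply cder_plus; assumption|].
  eexists. apply cder_plus; eassumption.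
Qed.

Lemma hol2_opp f z : hol2 f z -> hol2 (fun w => - f w) z.
Proof.
  intros [f' F]. exists (fun w => - f' w). revert F. apply filter_imp.
  intros y [A [a A']]. split; [apply cder_opp; assumption|]. eexists. apply cder_opp; eassumption.
Qed.

Lemma hol2_mult f g z : hol2 f z -> hol2 g z -> hol2 (fun w => f w * g w) z.
Proof.
  intros [f' F] [g' G]. exists (fun w => f' w * g w + f w * g' w).
  generalize (filter_and _ _ F G). apply filter_imp.
  intros y [[A [a A']] [B [b B']]]. split; [apply cder_mult; assumption|].
  eexists. apply cder_plus; apply cder_mult; eassumption.
Qed.

Lemma hol2_inv f z : hol2 f z -> f z <> 0 -> hol2 (fun w => / f w) z.
Proof.
  intros F H0. assert (N := hol1_neq_0 f z (hol2_hol1 f z F) H0). destruct F as [f' F].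
  exists (fun w => - f' w / (f w * f w)).
  generalize (filter_and _ _ F N). apply filter_imp.
  intros y [[A [a A']] B]. split; [apply cder_inv; assumption|].
  eexists. apply cder_mult.
  - apply cder_opp. eassumption.
  - apply cder_inv; [apply cder_mult; eassumption|]. apply Cmult_neq_0; assumption.
Qed.

Lemma hol2_comp f g z : hol2 g z -> hol2 f (g z) -> hol2 (fun w => f (g w)) z.
Proof.
  intros G F. assert (K := hol1_continuous _ _ (hol2_hol1 _ _ G)).
  destruct F as [f' F], G as [g' G]. exists (fun w => g' w * f' (g w)).
  apply (K (fun y => cder f y (f' y) /\ ex_derive (K := C_AbsRing) (V := C_NormedModule) f' y)) in F.
  unfold filtermap in F. generalize (filter_and _ _ F G). apply filter_imp.
  intros y [[A [a A']] [B [b B']]]. split; [apply cder_comp; assumption|].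
  eexists. apply cder_mult; [eassumption|]. apply (cder_comp f' g); eassumption.
Qed.

Lemma hol2_const c z : hol2 (fun _ => c) z.
Proof.
  exists (fun _ => 0). apply filter_forall. intros y. split; [apply cder_const|].
  exists (RtoC 0). apply cder_const.
Qed.

Lemma hol2_id z : hol2 (fun w => w) z.
Proof.
  exists (fun _ => 1). apply filter_forall. intros y. split; [apply cder_id|].
  exists (RtoC 0). apply cder_const.
Qed.

Lemma hol2_minus f g z : hol2 f z -> hol2 g z -> hol2 (fun w => f w - g w) z.
Proof. intros F G. apply hol2_plus; [exact F|apply hol2_opp, G]. Qed.

Lemma hol2_Cexp z : hol2 Cexp z.
Proof.
  exists Cexp. apply filter_forall. intros y. split; [apply cder_Cexp|].
  exists (Cexp y). apply cder_Cexp.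
Qed.

Lemma hol2_div f g z : hol2 f z -> hol2 g z -> g z <> 0 -> hol2 (fun w => f w / g w) z.
Proof. intros F G H. apply hol2_mult; [exact F|apply hol2_inv; assumption]. Qed.

(** * Improper integrals *)

(* A half-line, with the filter of its left end point. *)
Inductive left_end : (R -> Prop) -> ((R -> Prop) -> Prop) -> Prop :=
| left_zero : left_end (fun x => 0 < x)%R (at_right 0)
| left_point (r : R) : (0 < r)%R -> left_end (fun x => r <= x)%R (at_point r).

Notation infty := (Rbar_locally p_infty).

Lemma left_end_proper D Fa : left_end D Fa -> ProperFilter Fa.
Proof. intros []; [apply at_right_proper_filter|apply at_point_filter]. Qed.

Lemma left_end_pos D Fa : left_end D Fa -> forall x, D x -> (0 < x)%R.
Proof. intros [|r Hr] x Hx; lra. Qed.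

Lemma left_end_up D Fa : left_end D Fa -> forall x y, D x -> (x <= y)%R -> D y.
Proof. intros [|r Hr] x y Hx Hy; lra. Qed.

Lemma left_end_prod D Fa : left_end D Fa ->
  filter_prod Fa infty (fun ab => (fst ab <= snd ab)%R /\
    forall x, (fst ab <= x <= snd ab)%R -> D x).
Proof.
  intros [|r Hr].
  - apply (Filter_prod _ _ _ (fun a => 0 < a < 1)%R (fun b => 1 < b)%R).
    + apply at_right_0_between, Rlt_0_1.
    + exists 1%R. auto.
    + simpl. intros x y Hx Hy. split; [lra|]. intros; lra.
  - apply (Filter_prod _ _ _ (fun a => a = r)%R (fun b => r < b)%R).
    + reflexivity.
    + exists r. auto.
    + simpl. intros x y -> Hy. split; [lra|]. intros; lra.
Qed.

Lemma is_RInt_gen_lin {V W : NormedModule R_AbsRing} (T : V -> W) (f : R -> V)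
    (Fa Fb : (R -> Prop) -> Prop) (FFa : Filter Fa) (FFb : Filter Fb) (l : V) :
  continuous T l ->
  (forall a b y, is_RInt f a b y -> is_RInt (fun x => T (f x)) a b (T y)) ->
  is_RInt_gen f Fa Fb l -> is_RInt_gen (fun x => T (f x)) Fa Fb (T l).
Proof.
  intros HT HI H P HP. apply HT in HP. apply H in HP. unfold filtermapi in *.
  revert HP. apply filter_imp. intros ab [y [Hy Py]]. exists (T y). split; auto.
Qed.

Definition irint (f : R -> C) (Fa Fb : (R -> Prop) -> Prop) (l : C) : Prop :=
  is_RInt_gen (V := C_R_NormedModule) f Fa Fb l.

Lemma crint_pair (f : R -> C) (a b : R) (l : C) :
  crint f a b l <->
  is_RInt (fun x => Re (f x)) a b (Re l) /\ is_RInt (fun x => Im (f x)) a b (Im l).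
Proof.
  split.
  - intros H. split.
    + apply (is_RInt_fct_extend_fst (U := R_NormedModule) (V := R_NormedModule) f a b l H).
    + apply (is_RInt_fct_extend_snd (U := R_NormedModule) (V := R_NormedModule) f a b l H).
  - intros [H1 H2]. destruct l as [u v].
    apply (is_RInt_fct_extend_pair (U := R_NormedModule) (V := R_NormedModule) f a b u v H1 H2).
Qed.

Lemma crint_scal (c : C) (f : R -> C) (a b : R) (l : C) :
  crint f a b l -> crint (fun x => c * f x) a b (c * l).
Proof.
  intros H. apply crint_pair in H. destruct H as [H1 H2]. destruct c as [u v].
  apply crint_pair. unfold Re, Im in *. simpl. split.
  - apply (is_RInt_minus (V := R_NormedModule)); apply (is_RInt_scal (V := R_NormedModule)); assumption.
  - apply (is_RInt_plus (V := R_NormedModule)); apply (is_RInt_scal (V := R_NormedModule)); assumption.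
Qed.

Section Gen.
Context (Fa Fb : (R -> Prop) -> Prop) {FFa : ProperFilter Fa} {FFb : ProperFilter Fb}.

Lemma irint_scal (c : C) (f : R -> C) (l : C) :
  irint f Fa Fb l -> irint (fun x => c * f x) Fa Fb (c * l).
Proof.
  apply (is_RInt_gen_lin (V := C_R_NormedModule) (W := C_R_NormedModule) (fun z => c * z)).
  - apply FFa.
  - apply FFb.
  - apply (cont_mult (T := C_UniformSpace)); [apply cont_const|apply continuous_id].
  - intros. apply crint_scal. assumption.
Qed.

Lemma irint_plus (f g : R -> C) (a b : C) :
  irint f Fa Fb a -> irint g Fa Fb b -> irint (fun x => f x + g x) Fa Fb (a + b).
Proof. apply (is_RInt_gen_plus (V := C_R_NormedModule)). Qed.

Lemma irint_minus (f g : R -> C) (a b : C) :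
  irint f Fa Fb a -> irint g Fa Fb b -> irint (fun x => f x - g x) Fa Fb (a - b).
Proof. apply (is_RInt_gen_minus (V := C_R_NormedModule)). Qed.

Lemma irint_unique (f : R -> C) (a b : C) : irint f Fa Fb a -> irint f Fa Fb b -> a = b.
Proof.
  intros Ha Hb.
  rewrite <- (is_RInt_gen_unique (V := C_R_CompleteNormedModule) f a Ha).
  apply (is_RInt_gen_unique (V := C_R_CompleteNormedModule) f b Hb).
Qed.

Lemma CRInt_gen_unique (f : R -> C) (a : C) : irint f Fa Fb a -> CRInt_gen f Fa Fb = a.
Proof. intros Ha. apply (is_RInt_gen_unique (V := C_R_CompleteNormedModule) f a Ha). Qed.

End Gen.

Lemma CRInt_unique (f : R -> C) (a b : R) (l : C) : crint f a b l -> CRInt f a b = l.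
Proof. apply (is_RInt_unique (V := C_R_CompleteNormedModule)). Qed.

Lemma crint_CRInt (f : R -> C) (a b : R) :
  (forall x, (Rmin a b <= x <= Rmax a b)%R -> continuous f x) -> crint f a b (CRInt f a b).
Proof.
  intros H. apply (RInt_correct (V := C_R_CompleteNormedModule)).
  apply (ex_RInt_continuous (V := C_R_CompleteNormedModule)). exact H.
Qed.

Lemma irint_ext (D : R -> Prop) (Fa : (R -> Prop) -> Prop) (f g : R -> C) (l : C) :
  left_end D Fa -> (forall x, D x -> f x = g x) -> irint f Fa infty l -> irint g Fa infty l.
Proof.
  intros HL E. assert (PF := left_end_proper _ _ HL).
  apply (is_RInt_gen_ext (V := C_R_NormedModule)).
  generalize (left_end_prod _ _ HL). apply filter_imp.
  intros [a b] [Hab HD] x Hx. simpl in *. apply E, HD.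
  rewrite Rmin_left, Rmax_right in Hx by lra. lra.
Qed.

(* [dom_prim a c] is a bounded primitive of [dom a c], which dominates
   x^(a-1) near 0 and x^(-c-1) near infinity. *)
Definition dom_prim (a c x : R) : R :=
  (Rpower (x / (1 + x)) a / a - Rpower (/ (1 + x)) c / c)%R.

Definition dom (a c x : R) : R :=
  (Rpower x (a - 1) * Rpower (1 + x) (- a - 1) + Rpower (1 + x) (- c - 1))%R.

Lemma Rpower_pos (x y : R) : (0 < Rpower x y)%R.
Proof. apply exp_pos. Qed.

(** Since x / (1 + x) has derivative (1 + x)^(-2), the power (x / (1 + x))^a / a differentiates to
    x^(a-1) (1 + x)^(-a-1); this is where the exponents of [dom] come from. *)
Lemma is_derive_dom_prim (a c x : R) :
  (0 < a)%R -> (0 < c)%R -> (0 < x)%R -> is_derive (dom_prim a c) x (dom a c x).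
Proof.
  intros Ha Hc Hx. unfold dom_prim, dom.
  assert (E1 : Rpower (x / (1 + x)) a = (Rpower x (a - 1) * Rpower (1 + x) (- a - 1) * (x * (1 + x)))%R).
  { unfold Rpower. rewrite ln_div by lra.
    replace (a * (ln x - ln (1 + x)))%R with ((a - 1) * ln x + (- a - 1) * ln (1 + x) + (ln x + ln (1 + x)))%R by ring.
    rewrite !exp_plus, !exp_ln by lra. reflexivity. }
  assert (E2 : Rpower (/ (1 + x)) c = (Rpower (1 + x) (- c - 1) * (1 + x))%R).
  { unfold Rpower. rewrite ln_Rinv by lra.
    replace (c * - ln (1 + x))%R with ((- c - 1) * ln (1 + x) + ln (1 + x))%R by ring.
    rewrite exp_plus, exp_ln by lra. reflexivity. }
  unfold Rpower in *. auto_derive.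
  - assert (0 < x * / (1 + x))%R by (apply Rmult_lt_0_compat; [lra|apply Rinv_0_lt_compat; lra]).
    assert (0 < / (1 + x))%R by (apply Rinv_0_lt_compat; lra).
    repeat split; lra.
  - fold (x / (1 + x))%R. rewrite E1, E2. field. lra.
Qed.

Lemma continuous_Rpower (a x : R) : (0 < x)%R -> continuous (fun y => Rpower y a) x.
Proof.
  intros Hx. apply (ex_derive_continuous (K := R_AbsRing) (V := R_NormedModule)). unfold Rpower.
  auto_derive. exact Hx.
Qed.

Lemma continuous_dom (a c x : R) : (0 < x)%R -> continuous (dom a c) x.
Proof.
  intros Hx. apply (ex_derive_continuous (K := R_AbsRing) (V := R_NormedModule)).
  unfold dom, Rpower.
  auto_derive. repeat split; lra.
Qed.

Lemma Rpower_lt_eps (a eps y : R) : (0 < a)%R -> (0 < eps)%R -> (0 < y < Rpower eps (/ a))%R -> (Rpower y a < eps)%R.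
Proof.
  intros Ha He Hy. apply Rlt_le_trans with (Rpower (Rpower eps (/ a)) a).
  - apply Rlt_Rpower_l; [exact Ha|lra].
  - rewrite Rpower_mult, Rinv_l, Rpower_1 by lra. lra.
Qed.

Lemma filterlim_Rscal {T : Type} (F : (T -> Prop) -> Prop) (f : T -> R) (l k : R) :
  filterlim f F (locally l) -> filterlim (fun x => f x * k)%R F (locally (l * k)%R).
Proof.
  intros H. apply (filterlim_comp _ _ _ f (fun u => u * k)%R F (locally l)); [exact H|].
  apply (continuous_mult (K := R_AbsRing) (fun u : R => u) (fun _ => k));
    [apply continuous_id|apply continuous_const].
Qed.

Lemma dom_prim_infty (a c : R) : (0 < a)%R -> (0 < c)%R ->
  filterlim (dom_prim a c) infty (locally (/ a)%R).
Proof.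
  intros Ha Hc. unfold dom_prim.
  assert (L1 : filterlim (fun x => / (1 + x))%R infty (locally 0%R)).
  { apply filterlim_locally. intros eps. exists (/ eps)%R. intros x Hx.
    assert (0 < / eps)%R by (apply Rinv_0_lt_compat, eps).
    apply ball_Rabs. rewrite Rminus_0_r, Rabs_pos_eq by (left; apply Rinv_0_lt_compat; lra).
    rewrite <- (Rinv_inv eps). apply Rinv_lt_contravar; [apply Rmult_lt_0_compat|]; lra. }
  replace (/ a)%R with (Rpower 1 a * / a - 0 * / c)%R.
  2: { unfold Rpower. rewrite ln_1, Rmult_0_r, exp_0. ring. }
  unfold Rdiv, Rminus.
  apply (filterlim_comp_2 (G := locally (Rpower 1 a * / a)%R) (H := locally (- (0 * / c))%R));
    [apply filterlim_Rscal|apply (filterlim_comp _ _ _ (fun x => Rpower (/ (1 + x)) c * / c)%R Ropp infty (locally (0 * / c)%R));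
      [apply filterlim_Rscal|apply (filterlim_opp (V := R_NormedModule))]
    |apply (filterlim_plus (V := R_NormedModule))].
  - apply filterlim_comp with (G := locally 1%R) (f := fun x => (x * / (1 + x))%R) (g := fun y => Rpower y a).
    + apply filterlim_ext_loc with (fun x => 1 + - / (1 + x))%R.
      { exists 0%R. intros x Hx. field. lra. }
      replace (locally 1%R) with (locally (1 + - 0)%R) by (f_equal; ring).
      apply (filterlim_comp_2 (G := locally 1%R) (H := locally (- 0)%R)).
      * apply filterlim_const.
      * eapply filterlim_comp; [exact L1|]. apply (filterlim_opp (V := R_NormedModule)).
      * apply (filterlim_plus (V := R_NormedModule)).
    + apply continuous_Rpower. lra.
  - apply filterlim_locally. intros eps.
    assert (Hp := Rpower_pos eps (/ c)). set (e := mkposreal _ Hp).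
    generalize (proj1 (filterlim_locally _ _) L1 e). intros [M HM]. exists (Rmax M 0). intros x Hx.
    specialize (HM x (Rle_lt_trans _ _ _ (Rmax_l _ _) Hx)).
    assert (0 < x)%R by (eapply Rle_lt_trans; [apply (Rmax_r M)|exact Hx]).
    unfold ball in *; simpl in *. unfold AbsRing_ball, abs, minus, plus, opp in *; simpl in *.
    assert (0 < / (1 + x))%R by (apply Rinv_0_lt_compat; lra).
    rewrite Ropp_0, Rplus_0_r, Rabs_pos_eq in * by (left; auto using Rpower_pos).
    apply Rpower_lt_eps; [assumption|apply eps|]. simpl. lra.
Qed.

Lemma dom_prim_0 (a c : R) : (0 < a)%R -> (0 < c)%R ->
  filterlim (dom_prim a c) (at_right 0) (locally (- / c)%R).
Proof.
  intros Ha Hc. unfold dom_prim.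
  replace (- / c)%R with (0 * / a + - (Rpower (/ (1 + 0)) c * / c))%R.
  2: { unfold Rpower. rewrite Rplus_0_r, Rinv_1, ln_1, Rmult_0_r, exp_0. ring. }
  unfold Rdiv, Rminus.
  apply (filterlim_comp_2 (G := locally (0 * / a)%R) (H := locally (- (Rpower (/ (1 + 0)) c * / c))%R)).
  - apply filterlim_locally. intros eps.
    assert (Hp := Rpower_pos (eps * a) (/ a)). exists (mkposreal _ Hp). intros x Hb Hx.
    unfold ball in *; simpl in *. unfold AbsRing_ball, abs, minus, plus, opp in *; simpl in *.
    rewrite Ropp_0, Rplus_0_r, Rabs_pos_eq in Hb by lra.
    rewrite Rmult_0_l, Ropp_0, Rplus_0_r.
    rewrite Rabs_pos_eq by (left; apply Rmult_lt_0_compat; [apply Rpower_pos|apply Rinv_0_lt_compat; lra]).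
    apply Rlt_div_l; [exact Ha|]. apply Rpower_lt_eps; [exact Ha| |].
    + apply Rmult_lt_0_compat; [apply eps|exact Ha].
    + assert (0 < / (1 + x))%R by (apply Rinv_0_lt_compat; lra). split.
      * apply Rmult_lt_0_compat; lra.
      * apply Rle_lt_trans with (2 := Hb). apply Rle_trans with (x * 1)%R; [|lra].
        apply Rmult_le_compat_l; [lra|]. rewrite <- Rinv_1. apply Rinv_le_contravar; lra.
  - apply (filterlim_filter_le_1 (F := locally 0%R)).
    { intros P HP. unfold at_right, within. revert HP. apply filter_imp. auto. }
    apply (ex_derive_continuous (K := R_AbsRing) (V := R_NormedModule) (fun x => - (Rpower (/ (1 + x)) c * / c))%R).
    unfold Rpower. auto_derive. rewrite Rplus_0_r, Rinv_1. repeat split; lra.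
  - apply (filterlim_plus (V := R_NormedModule)).
Qed.

Lemma is_RInt_dom (a c x y : R) : (0 < a)%R -> (0 < c)%R -> (0 < x <= y)%R ->
  is_RInt (dom a c) x y (dom_prim a c y - dom_prim a c x)%R.
Proof.
  intros Ha Hc Hxy.
  apply (is_RInt_derive (V := R_CompleteNormedModule)); rewrite Rmin_left, Rmax_right by lra.
  - intros z Hz. apply is_derive_dom_prim; lra.
  - intros z Hz. apply continuous_dom; lra.
Qed.

(** The bound 1/a + 1/c is the integral over the whole of (0, oo). A half-line starting at r loses
    mass, because [dom_prim] is nowhere below -1/c; one constant thus serves both kinds of end
    point. *)
Lemma dom_integrable (D : R -> Prop) Fa (a c : R) :
  left_end D Fa -> (0 < a)%R -> (0 < c)%R ->
  exists la, filterlim (dom_prim a c) Fa (locally la) /\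
    is_RInt_gen (dom a c) Fa infty (/ a - la)%R /\ (/ a - la <= / a + / c)%R.
Proof.
  intros HL Ha Hc. assert (PF := left_end_proper _ _ HL).
  assert (K : exists la, filterlim (dom_prim a c) Fa (locally la) /\ (- / c <= la)%R).
  { destruct HL as [|r Hr].
    - exists (- / c)%R. split; [apply dom_prim_0; assumption|lra].
    - exists (dom_prim a c r). split.
      + intros P HP. unfold filtermap, at_point. apply locally_singleton. exact HP.
      + unfold dom_prim.
        generalize (Rpower_pos (r / (1 + r)) a) (Rinv_0_lt_compat a Ha) (Rinv_0_lt_compat c Hc).
        intros. assert (Rpower (/ (1 + r)) c <= 1)%R.
        { apply Rle_trans with (exp 0); [|rewrite exp_0; lra]. unfold Rpower. apply exp_le.
          rewrite ln_Rinv by lra.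
          assert (P : (0 <= ln (1 + r))%R) by (rewrite <- ln_1; apply ln_le; lra).
          assert (0 <= c * ln (1 + r))%R by (apply Rmult_le_pos; lra). lra. }
        unfold Rdiv.
        assert (0 < Rpower (r / (1 + r)) a * / a)%R by (apply Rmult_lt_0_compat; assumption).
        assert (Rpower (/ (1 + r)) c * / c <= 1 * / c)%R by (apply Rmult_le_compat_r; lra).
        unfold Rdiv in *. lra. }
  destruct K as [la [L1 L2]]. exists la. split; [exact L1|]. split; [|lra].
  assert (LL : filterlim (fun ab : R * R => dom_prim a c (snd ab) - dom_prim a c (fst ab))%R
      (filter_prod Fa infty) (locally (/ a - la)%R)).
  { unfold Rminus. apply (filterlim_comp_2 (G := locally (/ a)%R) (H := locally (- la)%R)).
    - refine (filterlim_comp _ _ _ snd (dom_prim a c) _ infty _ _ _);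
        [apply filterlim_snd|apply dom_prim_infty; assumption].
    - refine (filterlim_comp _ _ _ (fun ab : R * R => dom_prim a c (fst ab)) Ropp _ (locally la) _ _ _);
        [|apply (filterlim_opp (V := R_NormedModule))].
      refine (filterlim_comp _ _ _ fst (dom_prim a c) _ Fa _ _ L1); apply filterlim_fst.
    - apply (filterlim_plus (V := R_NormedModule)). }
  intros P HP. apply LL in HP. unfold filtermap, filtermapi in *.
  generalize (filter_and _ _ HP (left_end_prod _ _ HL)). apply filter_imp.
  intros [x y] [Hp [Hxy HD]]. simpl in *. eexists. split; [|exact Hp].
  apply is_RInt_dom; try assumption. split; [|exact Hxy]. apply (left_end_pos _ _ HL), HD. lra.
Qed.

Lemma irint_norm (D : R -> Prop) Fa (a c K : R) (f : R -> C) (l : C) :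
  left_end D Fa -> (0 < a)%R -> (0 < c)%R -> (0 <= K)%R ->
  (forall x, D x -> Cmod (f x) <= K * dom a c x)%R ->
  irint f Fa infty l -> (Cmod l <= K * (/ a + / c))%R.
Proof.
  intros HL Ha Hc HK Hf Hl. assert (PF := left_end_proper _ _ HL).
  destruct (dom_integrable D Fa a c HL Ha Hc) as [la [_ [I B]]].
  apply Rle_trans with (K * (/ a - la))%R; [|apply Rmult_le_compat_l; assumption].
  rewrite <- norm_C_R.
  apply (RInt_gen_norm (V := C_R_CompleteNormedModule) (Fa := Fa) (Fb := infty) f (fun x => K * dom a c x)%R l (K * (/ a - la))%R).
  - generalize (left_end_prod _ _ HL). apply filter_imp. intros ab [H _]; exact H.
  - generalize (left_end_prod _ _ HL). apply filter_imp. intros ab [_ H] x Hx.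
    rewrite norm_C_R. apply Hf, H, Hx.
  - exact Hl.
  - apply (is_RInt_gen_scal (V := R_NormedModule)). exact I.
Qed.

(** Cauchy's criterion for pairs of end points: two truncated integrals differ by an integral near
    each end, and both are at most K times an increment of the convergent primitive [dom_prim]. *)
Lemma irint_dominated (D : R -> Prop) Fa (a c K : R) (f : R -> C) :
  left_end D Fa -> (0 < a)%R -> (0 < c)%R -> (0 <= K)%R ->
  (forall x, D x -> continuous f x) ->
  (forall x, D x -> Cmod (f x) <= K * dom a c x)%R ->
  exists l, irint f Fa infty l.
Proof.
  intros HL Ha Hc HK Hcont Hf. assert (PF := left_end_proper _ _ HL).
  destruct (dom_integrable D Fa a c HL Ha Hc) as [la [La _]].
  assert (Lb := dom_prim_infty a c Ha Hc).
  assert (I : forall x y, D x -> (x <= y)%R -> crint f x y (CRInt f x y)).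
  { intros x y Hx Hxy. apply crint_CRInt. rewrite Rmin_left, Rmax_right by exact Hxy.
    intros z Hz. apply Hcont. apply (left_end_up _ _ HL x); [exact Hx|lra]. }
  assert (B : forall x y, D x -> (x <= y)%R ->
      (Cmod (CRInt f x y) <= K * (dom_prim a c y - dom_prim a c x))%R).
  { intros x y Hx Hxy. rewrite <- norm_C_R.
    apply (norm_RInt_le (V := C_R_NormedModule) f (fun z => K * dom a c z)%R x y); [exact Hxy| | |].
    - intros z Hz. rewrite norm_C_R. apply Hf. apply (left_end_up _ _ HL x); [exact Hx|lra].
    - apply I; assumption.
    - apply (is_RInt_scal (V := R_NormedModule)). apply is_RInt_dom; [assumption|assumption|].
      split; [apply (left_end_pos _ _ HL), Hx|exact Hxy]. }
  assert (E : exists l : C, filterlim (fun ab : R * R => CRInt f (fst ab) (snd ab))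
       (filter_prod Fa infty) (locally l)).
  { apply (filterlim_locally_cauchy (U := C_R_CompleteNormedModule) (F := filter_prod Fa infty)).
    (* Near either end two values of [dom_prim] are each within e of the limit, so each increment is
       at most 2e and the total at most 4 K e, which is below eps. *)
    intros eps. set (e := (eps / (4 * (K + 1)))%R).
    assert (He : (0 < e)%R) by (apply Rdiv_lt_0_compat; [apply eps|lra]).
    generalize (proj1 (filterlim_locally _ _) La (mkposreal _ He)).
    generalize (proj1 (filterlim_locally _ _) Lb (mkposreal _ He)). intros Nb Na.
    destruct (left_end_prod _ _ HL) as [Q1 R1 HQ1 HR1 HH].
    exists (fun ab => (Q1 (fst ab) /\ ball la (mkposreal _ He) (dom_prim a c (fst ab))) /\
               (R1 (snd ab) /\ ball (/ a)%R (mkposreal _ He) (dom_prim a c (snd ab)))). split.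
    - econstructor; [apply (filter_and _ _ HQ1 Na)|apply (filter_and _ _ HR1 Nb)|].
      simpl. intros; split; assumption.
    - intros [x y] [x' y'] [[Qx Bx] [Qy By]] [[Qx' Bx'] [Qy' By']]. simpl in *.
      apply C_NormedModule_mixin_compat1.
      assert (Hxy := HH x y Qx Qy). assert (Hxy' := HH x' y' Qx' Qy').
      assert (Hxy1 := HH x y' Qx Qy'). simpl in *.
      assert (Dx : D x) by (apply Hxy; lra). assert (Dx' : D x') by (apply Hxy'; lra).
      assert (Dy : D y) by (apply Hxy; lra). assert (Dy' : D y') by (apply Hxy'; lra).
      unfold ball in Bx, By, Bx', By'; simpl in *.
      unfold AbsRing_ball, abs, minus, plus, opp in *; simpl in *.
      apply Rabs_def2 in Bx, By, Bx', By'.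
      (* The order of the two left (or right) end points is unknown, hence the bound by the absolute
         increment. *)
      assert (T : forall u v, D u -> D v -> exists J, crint f u v J /\
         (Cmod J <= K * Rabs (dom_prim a c v - dom_prim a c u))%R).
      { intros u v Du Dv. destruct (Rle_lt_dec u v) as [Huv|Huv].
        - exists (CRInt f u v). split; [apply I; assumption|].
          eapply Rle_trans; [apply B; assumption|].
          apply Rmult_le_compat_l; [assumption|apply Rle_abs].
        - exists (- CRInt f v u). split.
          + apply (is_RInt_swap (V := C_R_NormedModule)). apply I; [assumption|lra].
          + rewrite Cmod_opp, Rabs_minus_sym. eapply Rle_trans; [apply B; [assumption|lra]|].
            apply Rmult_le_compat_l; [assumption|apply Rle_abs]. }
      destruct (T x' x Dx' Dx) as [J1 [I1 N1]]. destruct (T y y' Dy Dy') as [J2 [I2 N2]].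
      assert (S : CRInt f x' y' = J1 + CRInt f x y + J2).
      { apply CRInt_unique.
        eapply (is_RInt_Chasles (V := C_R_NormedModule)); [|exact I2].
        eapply (is_RInt_Chasles (V := C_R_NormedModule)); [exact I1|].
        apply I; [assumption|apply Hxy]. }
      rewrite S. unfold minus, plus, opp; simpl.
      replace (J1 + CRInt f x y + J2 + - CRInt f x y) with (J1 + J2) by ring.
      eapply Rle_lt_trans; [apply Cmod_triangle|].
      assert (A1 : (Rabs (dom_prim a c x - dom_prim a c x') <= 2 * e)%R) by (apply Rabs_le; lra).
      assert (A2 : (Rabs (dom_prim a c y' - dom_prim a c y) <= 2 * e)%R) by (apply Rabs_le; lra).
      assert (K * Rabs (dom_prim a c x - dom_prim a c x') <= K * (2 * e))%R by (apply Rmult_le_compat_l; assumption).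
      assert (K * Rabs (dom_prim a c y' - dom_prim a c y) <= K * (2 * e))%R by (apply Rmult_le_compat_l; assumption).
      assert (E : (4 * (K * e) + 4 * e = eps)%R) by (unfold e; field; lra). lra. }
  destruct E as [l Hl]. exists l. intros P HP. apply Hl in HP. unfold filtermap, filtermapi in *.
  generalize (filter_and _ _ HP (left_end_prod _ _ HL)). apply filter_imp.
  intros [x y] [Hp [Hxy HD]]. simpl in *. eexists. split; [|exact Hp].
  apply I; [apply HD; lra|exact Hxy].
Qed.

(** Differentiation under the integral sign from a pointwise quadratic remainder: integrated against
    [dom] it is at most M |s - s0|^2, which is below eps |s - s0| once |s - s0| < eps / (M + 1). *)
Lemma cder_irint (D : R -> Prop) Fa (a c K d : R) (f : C -> R -> C) (f' : R -> C) (F : C -> C) (s0 l : C) :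
  left_end D Fa -> (0 < a)%R -> (0 < c)%R -> (0 <= K)%R -> (0 < d)%R ->
  (forall s, (Cmod (s - s0) < d)%R -> irint (f s) Fa infty (F s)) ->
  irint f' Fa infty l ->
  (forall s x, (Cmod (s - s0) < d)%R -> D x ->
    (Cmod (f s x - f s0 x - (s - s0) * f' x) <= Cmod (s - s0) ^ 2 * K * dom a c x)%R) ->
  cder F s0 l.
Proof.
  intros HL Ha Hc HK Hd HF Hl Hb. assert (PF := left_end_proper _ _ HL).
  apply cder_eps. intros eps. set (M := (K * (/ a + / c))%R).
  assert (HM : (0 <= M)%R).
  { apply Rmult_le_pos; [exact HK|]. generalize (Rinv_0_lt_compat a Ha) (Rinv_0_lt_compat c Hc).
    lra. }
  assert (Hp : (0 < Rmin d (eps / (M + 1)))%R).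
  { apply Rmin_pos; [exact Hd|]. apply Rdiv_lt_0_compat; [apply eps|lra]. }
  exists (mkposreal _ Hp). simpl. intros s Hs.
  destruct (Rlt_Rmin _ _ _ Hs) as [H1 H2].
  apply Rlt_div_r in H2; [|lra].
  assert (H0 : (Cmod (s0 - s0) < d)%R) by (replace (s0 - s0) with (RtoC 0) by ring; rewrite Cmod_0; exact Hd).
  assert (Q := Cmod_ge_0 (s - s0)).
  eapply Rle_trans.
  - apply (irint_norm D Fa a c (Cmod (s - s0) ^ 2 * K) (fun x => f s x - f s0 x - (s - s0) * f' x)); try assumption.
    + apply Rmult_le_pos; [apply pow2_ge_0|exact HK].
    + intros x Hx. apply Hb; assumption.
    + apply irint_minus; try typeclasses eauto; [apply irint_minus; try typeclasses eauto; apply HF; assumption|].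
      apply irint_scal; try typeclasses eauto. exact Hl.
  - replace (Cmod (s - s0) ^ 2 * K * (/ a + / c))%R with (Cmod (s - s0) * M * Cmod (s - s0))%R by (unfold M; ring).
    apply Rmult_le_compat_r; [exact Q|]. nra.
Qed.

Lemma irint_dilate (f : R -> C) (c : R) (l : C) : (0 < c)%R ->
  irint f (at_right 0) infty l -> irint (fun x => f (c * x)%R) (at_right 0) infty (/ c * l).
Proof.
  intros Hc H.
  assert (H2 : irint (fun x => c * f (c * x)%R) (at_right 0) infty l).
  { intros P HP. apply H in HP. unfold filtermapi in *. destruct HP as [Q R1 HQ HR HH].
    apply (Filter_prod _ _ _ (fun a => Q (c * a)%R) (fun b => R1 (c * b)%R)).
    - destruct HQ as [d Hd].
      assert (Hp : (0 < d / c)%R) by (apply Rdiv_lt_0_compat; [apply d|exact Hc]).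
      exists (mkposreal _ Hp). intros y Hy Hy0. apply Hd; [|apply Rmult_lt_0_compat; assumption].
      unfold ball in *; simpl in *. unfold AbsRing_ball, abs, minus, plus, opp in *; simpl in *.
      rewrite Ropp_0, Rplus_0_r in *. rewrite Rabs_mult, (Rabs_pos_eq c) by lra.
      apply Rlt_div_r in Hy; lra.
    - destruct HR as [M HM]. exists (M / c)%R. intros y Hy. apply HM. apply Rlt_div_l in Hy; lra.
    - intros x y Hx Hy. destruct (HH _ _ Hx Hy) as [z [Hz Pz]]. exists z. split; [|exact Pz].
      simpl in *.
      assert (K := is_RInt_comp_lin (V := C_R_NormedModule) f c 0 x y z).
      rewrite !Rplus_0_r in K. specialize (K Hz). revert K.
      apply (is_RInt_ext (V := C_R_NormedModule)). intros t _. rewrite scal_R_Cmult, Rplus_0_r.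
      reflexivity. }
  apply (irint_scal _ _ (/ c)) in H2.
  revert H2. apply (irint_ext (fun x => 0 < x)%R); [constructor|].
  intros x _. field. intros E. apply RtoC_inj in E. lra.
Qed.

(** * Mellin transforms *)

Lemma Cmod_Rpowc (x : R) (s : C) : Cmod (Rpowc x s) = Rpower x (Re s).
Proof. unfold Rpowc, Rpower. rewrite Cmod_Cexp, re_scal_r. reflexivity. Qed.

Lemma Rpowc_plus (x : R) (a b : C) : Rpowc x (a + b) = Rpowc x a * Rpowc x b.
Proof. unfold Rpowc. rewrite <- Cexp_plus. f_equal. ring. Qed.

Lemma Rpowc_opp (x : R) (a : C) : Rpowc x (- a) = / Rpowc x a.
Proof. unfold Rpowc. rewrite <- Cexp_opp. f_equal. ring. Qed.

Lemma Rpowc_minus (x : R) (a b : C) : Rpowc x (a - b) = Rpowc x a / Rpowc x b.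
Proof. unfold Cminus. rewrite Rpowc_plus, Rpowc_opp. reflexivity. Qed.

Lemma Rpowc_neq_0 (x : R) (a : C) : Rpowc x a <> 0.
Proof. apply Cexp_neq_0. Qed.

Lemma Rpowc_1 (x : R) : (0 < x)%R -> Rpowc x 1 = x.
Proof. intros Hx. unfold Rpowc. rewrite Cmult_1_l, Cexp_RtoC, exp_ln by exact Hx. reflexivity. Qed.

Lemma Rpowc_mult_base (x y : R) (a : C) : (0 < x)%R -> (0 < y)%R -> Rpowc (x * y) a = Rpowc x a * Rpowc y a.
Proof.
  intros Hx Hy. unfold Rpowc. rewrite <- Cexp_plus, ln_mult, RtoC_plus by assumption.
  f_equal. ring.
Qed.

Lemma Rpowc_RtoC (x a : R) : Rpowc x a = Rpower x a.
Proof. unfold Rpowc, Rpower. rewrite <- RtoC_mult, Cexp_RtoC. reflexivity. Qed.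

Lemma continuous_Rpowc (s : C) (x : R) : (0 < x)%R -> continuous (fun t : R => Rpowc t s) x.
Proof.
  intros Hx. unfold Rpowc. apply cont_Cexp. apply cont_mult; [apply cont_const|].
  apply cont_RtoC. apply continuous_ln. exact Hx.
Qed.

Lemma rder_Rpowc (s : C) (x : R) : (0 < x)%R -> rder (fun t : R => Rpowc t s) x (s * Rpowc x (s - 1)).
Proof.
  intros Hx. unfold Rpowc.
  eapply rder_eq.
  - apply (rder_comp_cder Cexp (fun t : R => s * ln t) x (Cexp (s * ln x)) (s * RtoC (/ x)%R)).
    + apply cder_Cexp.
    + apply rder_scal, rder_RtoC. auto_derive; [exact Hx|]. field. lra.
  - replace ((s - 1) * ln x) with (s * ln x - ln x) by ring.
    rewrite Cexp_minus, (Cexp_RtoC (ln x)), exp_ln, RtoC_inv by lra. unfold Cdiv. ring.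
Qed.

Lemma exp_decay_poly (p c : R) : (0 < c)%R ->
  exists K, (0 < K)%R /\ forall x, (0 < x)%R -> (Rpower (1 + x) p * exp (- (c * x)) <= K)%R.
Proof.
  (* [q] is a positive majorant of p. From ln v <= v with v = c (1 + x) / q one gets q ln (1 + x) <=
     c (1 + x) + q ln (q / c); subtracting c x leaves the exponent of the witness. *)
  intros Hc. set (q := (Rabs p + 1)%R).
  assert (Hq : (0 < q)%R) by (unfold q; generalize (Rabs_pos p); lra).
  exists (exp (c + q * ln (q / c))). split; [apply exp_pos|]. intros x Hx.
  unfold Rpower. rewrite <- exp_plus. apply exp_le.
  assert (L0 : (0 <= ln (1 + x))%R) by (rewrite <- ln_1; apply ln_le; lra).
  assert (L1 : (p * ln (1 + x) <= q * ln (1 + x))%R).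
  { apply Rmult_le_compat_r; [exact L0|]. unfold q. generalize (Rle_abs p). lra. }
  assert (Hqc : (0 < c / q)%R) by (apply Rdiv_lt_0_compat; assumption).
  assert (L2 : (ln (1 + x) <= c / q * (1 + x) + ln (q / c))%R).
  { replace (1 + x)%R with ((c / q * (1 + x)) * (q / c))%R at 1 by (field; lra).
    assert (0 < c / q * (1 + x))%R by (apply Rmult_lt_0_compat; lra).
    rewrite ln_mult; [|assumption|apply Rdiv_lt_0_compat; assumption].
    apply Rplus_le_compat_r. rewrite <- (ln_exp (c / q * (1 + x))) at 2.
    apply ln_le; [assumption|]. left. eapply Rlt_trans; [|apply exp_ineq1; lra]. lra. }
  assert (L3 : (q * ln (1 + x) <= c * (1 + x) + q * ln (q / c))%R).
  { replace (c * (1 + x) + q * ln (q / c))%R with (q * (c / q * (1 + x) + ln (q / c)))%R by (field; lra).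
    apply Rmult_le_compat_l; lra. }
  lra.
Qed.

Lemma exp_decay_dom (a p c : R) : (0 < a)%R -> (0 < c)%R ->
  exists K, (0 < K)%R /\ forall x, (0 < x)%R ->
    (Rpower x (a - 1) * (Rpower (1 + x) p * exp (- (c * x))) <= K * dom a 1 x)%R.
Proof.
  (* The exponent p + a + 1 pays in advance for the factor (1 + x)^(-a-1) of [dom]. *)
  intros Ha Hc. destruct (exp_decay_poly (p + a + 1) c Hc) as [K [HK HB]].
  exists K. split; [exact HK|]. intros x Hx. specialize (HB x Hx). unfold dom.
  assert (E : Rpower (1 + x) p = (Rpower (1 + x) (p + a + 1) * Rpower (1 + x) (- a - 1))%R).
  { rewrite <- Rpower_plus. f_equal. ring. }
  rewrite E. assert (P1 := Rpower_pos x (a - 1)). assert (P2 := Rpower_pos (1 + x) (- a - 1)).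
  assert (P3 := Rpower_pos (1 + x) (- (1) - 1)).
  assert (0 < Rpower x (a - 1) * Rpower (1 + x) (- a - 1))%R by (apply Rmult_lt_0_compat; assumption).
  assert (0 < K * Rpower (1 + x) (- (1) - 1))%R by (apply Rmult_lt_0_compat; assumption).
  apply Rle_trans with ((Rpower x (a - 1) * Rpower (1 + x) (- a - 1)) * K)%R; [|lra].
  replace (Rpower x (a - 1) * (Rpower (1 + x) (p + a + 1) * Rpower (1 + x) (- a - 1) * exp (- (c * x))))%R
    with ((Rpower x (a - 1) * Rpower (1 + x) (- a - 1)) * (Rpower (1 + x) (p + a + 1) * exp (- (c * x))))%R by ring.
  apply Rmult_le_compat_l; lra.
Qed.

Definition exp_bound (b c x : R) : R := (Rpower x (- b) * exp (- (c * x)))%R.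

(** The continuous functions whose Mellin integral converges for Re s > b. The rate c is existential
    because raising b or multiplying by ln x consumes part of it. *)
Definition exp_decay (D : R -> Prop) (b : R) (g : R -> C) : Prop :=
  (forall x, D x -> continuous g x) /\
  exists c K, (0 < c)%R /\ (0 <= K)%R /\ forall x, D x -> (Cmod (g x) <= K * exp_bound b c x)%R.

Lemma exp_bound_pos b c x : (0 < exp_bound b c x)%R.
Proof. apply Rmult_lt_0_compat; [apply Rpower_pos|apply exp_pos]. Qed.

(** A larger exponent is a weaker bound near 0 but a stronger one at infinity; there the factor
    x^(b'-b) is paid for by the lost rate c - c'. *)
Lemma exp_bound_weaken (b b' c c' : R) : (b <= b')%R -> (0 < c' < c)%R ->
  exists K, (0 < K)%R /\ forall x, (0 < x)%R -> (exp_bound b c x <= K * exp_bound b' c' x)%R.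
Proof.
  intros Hb Hc. destruct (exp_decay_poly (b' - b) (c - c')) as [K [HK HB]]; [lra|].
  exists K. split; [exact HK|]. intros x Hx. specialize (HB x Hx). unfold exp_bound.
  replace (- b)%R with ((b' - b) + - b')%R by ring. rewrite Rpower_plus.
  replace (- (c * x))%R with (- ((c - c') * x) + - (c' * x))%R by ring. rewrite exp_plus.
  assert (P := exp_bound_pos b' c' x). unfold exp_bound in P.
  assert (Q : (Rpower x (b' - b) <= Rpower (1 + x) (b' - b))%R) by (apply Rle_Rpower_l; lra).
  assert (E := exp_pos (- ((c - c') * x))).
  replace (Rpower x (b' - b) * Rpower x (- b') * (exp (- ((c - c') * x)) * exp (- (c' * x))))%R with
    ((Rpower x (b' - b) * exp (- ((c - c') * x))) * (Rpower x (- b') * exp (- (c' * x))))%R by ring.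
  apply Rmult_le_compat_r; [lra|]. eapply Rle_trans; [|exact HB]. apply Rmult_le_compat_r; lra.
Qed.

Lemma exp_decay_weaken (D : R -> Prop) (b b' : R) (g : R -> C) :
  (forall x, D x -> 0 < x)%R -> (b <= b')%R -> exp_decay D b g -> exp_decay D b' g.
Proof.
  intros HD Hb [Hg [c [K [Hc [HK HB]]]]]. split; [exact Hg|].
  destruct (exp_bound_weaken b b' c (c / 2) Hb) as [K' [HK' HB']]; [lra|].
  exists (c / 2)%R, (K * K')%R. split; [lra|]. split; [apply Rmult_le_pos; lra|].
  intros x Hx. eapply Rle_trans; [apply HB, Hx|]. rewrite Rmult_assoc.
  apply Rmult_le_compat_l; [exact HK|]. apply HB', HD, Hx.
Qed.

Lemma exp_decay_plus (D : R -> Prop) (b : R) (f g : R -> C) :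
  (forall x, D x -> 0 < x)%R ->
  exp_decay D b f -> exp_decay D b g -> exp_decay D b (fun x => f x + g x).
Proof.
  intros HD [Hf [c1 [K1 [Hc1 [HK1 HB1]]]]] [Hg [c2 [K2 [Hc2 [HK2 HB2]]]]]. split.
  { intros x Hx. apply cont_plus; auto. }
  exists (Rmin c1 c2), (K1 + K2)%R. split; [apply Rmin_pos; assumption|]. split; [lra|].
  intros x Hx. eapply Rle_trans; [apply Cmod_triangle|]. rewrite Rmult_plus_distr_r.
  assert (M : forall c, (Rmin c1 c2 <= c -> exp_bound b c x <= exp_bound b (Rmin c1 c2) x)%R).
  { intros c Hc. apply Rmult_le_compat_l; [left; apply Rpower_pos|]. apply exp_le.
    apply Ropp_le_contravar, Rmult_le_compat_r; [left; apply HD, Hx|exact Hc]. }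
  apply Rplus_le_compat; (eapply Rle_trans; [eauto|]); apply Rmult_le_compat_l; try assumption; apply M.
  - apply Rmin_l.
  - apply Rmin_r.
Qed.

Lemma exp_decay_mult (D : R -> Prop) (b M : R) (f g : R -> C) :
  (forall x, D x -> continuous f x) -> (0 <= M)%R -> (forall x, D x -> Cmod (f x) <= M)%R ->
  exp_decay D b g -> exp_decay D b (fun x => f x * g x).
Proof.
  intros Hf HM HfM [Hg [c [K [Hc [HK HB]]]]]. split.
  { intros x Hx. apply cont_mult; auto. }
  exists c, (M * K)%R. split; [lra|]. split; [apply Rmult_le_pos; lra|].
  intros x Hx. rewrite Cmod_mult, Rmult_assoc.
  apply Rmult_le_compat; try apply Cmod_ge_0; auto.
Qed.

Lemma exp_decay_ext (D : R -> Prop) (b : R) (f g : R -> C) :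
  (forall x, D x -> locally x (fun y => f y = g y)) -> exp_decay D b f -> exp_decay D b g.
Proof.
  intros E [Hf [c [K [Hc [HK HB]]]]]. split.
  - intros x Hx. apply continuous_ext_loc with f; auto.
  - exists c, K. repeat split; auto. intros x Hx. rewrite <- (locally_singleton _ _ (E x Hx)). auto.
Qed.

Lemma Rle_exp (u : R) : (u <= exp u)%R.
Proof.
  destruct (Req_dec u 0) as [->|H]; [rewrite exp_0; lra|]. generalize (exp_ineq1 u H). lra.
Qed.

Lemma exp_Rabs_ln (d x : R) : (0 <= d)%R -> (0 < x)%R ->
  (exp (d * Rabs (ln x)) <= Rpower x d + Rpower x (- d))%R.
Proof.
  intros Hd Hx. unfold Rpower. generalize (exp_pos (d * ln x)) (exp_pos (- d * ln x)).
  destruct (Rcase_abs (ln x)) as [H|H].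
  - rewrite Rabs_left by exact H. replace (d * - ln x)%R with (- d * ln x)%R by ring. lra.
  - rewrite Rabs_right by exact H. lra.
Qed.

(** Apply u <= e^u to u = d |ln x|. *)
Lemma Rabs_ln_le (d x : R) : (0 < d)%R -> (0 < x)%R ->
  (Rabs (ln x) <= / d * (Rpower x d + Rpower x (- d)))%R.
Proof.
  intros Hd Hx. apply Rle_trans with (/ d * exp (d * Rabs (ln x)))%R.
  - apply Rmult_le_reg_l with d; [exact Hd|]. rewrite <- Rmult_assoc, Rinv_r, Rmult_1_l by lra.
    apply Rle_exp.
  - apply Rmult_le_compat_l; [left; apply Rinv_0_lt_compat, Hd|]. apply exp_Rabs_ln; lra.
Qed.

Lemma exp_decay_ln (D : R -> Prop) (b b' : R) (g : R -> C) :
  (forall x, D x -> 0 < x)%R -> (b < b')%R ->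
  exp_decay D b g -> exp_decay D b' (fun x => ln x * g x).
Proof.
  intros HD Hb [Hg [c [K [Hc [HK HB]]]]]. split.
  { intros x Hx. apply cont_mult; [|auto]. apply cont_RtoC, continuous_ln, HD, Hx. }
  (* Bounding |ln x| by x^d + x^(-d) moves the exponent to b - d and to b + d = b'; both are
     absorbed into b' at half the rate. *)
  set (d := (b' - b)%R). assert (Hd : (0 < d)%R) by (unfold d; lra).
  destruct (exp_bound_weaken (b - d) b' c (c / 2)) as [K1 [HK1 HB1]]; [unfold d; lra|lra|].
  destruct (exp_bound_weaken (b + d) b' c (c / 2)) as [K2 [HK2 HB2]]; [unfold d; lra|lra|].
  exists (c / 2)%R, (/ d * K * (K1 + K2))%R. split; [lra|].
  assert (Hid := Rinv_0_lt_compat d Hd).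
  split; [apply Rmult_le_pos; [apply Rmult_le_pos|]; lra|]. intros x Hx.
  assert (Hx0 : (0 < x)%R) by (apply HD, Hx).
  rewrite Cmod_mult, Cmod_R.
  apply Rle_trans with (/ d * (Rpower x d + Rpower x (- d)) * (K * exp_bound b c x))%R.
  - apply Rmult_le_compat; [apply Rabs_pos|apply Cmod_ge_0|apply Rabs_ln_le; assumption|apply HB, Hx].
  - replace (/ d * (Rpower x d + Rpower x (- d)) * (K * exp_bound b c x))%R with
      (/ d * K * (exp_bound (b - d) c x + exp_bound (b + d) c x))%R.
    + rewrite (Rmult_assoc (/ d * K)%R). apply Rmult_le_compat_l; [apply Rmult_le_pos; lra|].
      specialize (HB1 x Hx0). specialize (HB2 x Hx0). lra.
    + unfold exp_bound. replace (- (b - d))%R with (d + - b)%R by ring.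
      replace (- (b + d))%R with (- d + - b)%R by ring. rewrite !Rpower_plus. ring.
Qed.

(** The left end is a parameter: [at_right 0] gives the Mellin transform, and [at_point r] the
    truncated one that the edges of the Hankel contour produce. *)
Definition mellin (Fa : (R -> Prop) -> Prop) (g : R -> C) (s : C) : C :=
  CRInt_gen (fun x => Rpowc x (s - 1) * g x) Fa infty.

Lemma mellin_bound (b c : R) (s : C) : (0 < c)%R -> (b < Re s)%R ->
  exists K, (0 < K)%R /\ forall x, (0 < x)%R ->
    (Cmod (Rpowc x (s - 1)) * exp_bound b c x <= K * dom (Re s - b) 1 x)%R.
Proof.
  intros Hc Hs. destruct (exp_decay_dom (Re s - b) 0 c) as [K [HK HB]]; [lra|lra|].
  exists K. split; [exact HK|]. intros x Hx. eapply Rle_trans; [|apply HB, Hx].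
  rewrite Cmod_Rpowc. unfold exp_bound. rewrite <- Rmult_assoc, <- Rpower_plus.
  rewrite Rpower_O by lra. rewrite Rmult_1_l. right. f_equal. f_equal. unfold Re; simpl; ring.
Qed.

Lemma mellin_irint (D : R -> Prop) Fa (b : R) (g : R -> C) (s : C) :
  left_end D Fa -> exp_decay D b g -> (b < Re s)%R ->
  irint (fun x => Rpowc x (s - 1) * g x) Fa infty (mellin Fa g s).
Proof.
  intros HL [Hg [c [K [Hc [HK HB]]]]] Hs. assert (PF := left_end_proper _ _ HL).
  destruct (mellin_bound b c s Hc Hs) as [M [HM HMB]].
  destruct (irint_dominated D Fa (Re s - b) 1 (K * M) (fun x => Rpowc x (s - 1) * g x)) as [l Hl]; try assumption; try lra.
  - apply Rmult_le_pos; lra.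
  - intros x Hx. apply cont_mult; [|auto]. apply continuous_Rpowc, (left_end_pos _ _ HL), Hx.
  - intros x Hx. rewrite Cmod_mult. assert (Hx0 := left_end_pos _ _ HL x Hx).
    eapply Rle_trans; [apply Rmult_le_compat_l; [apply Cmod_ge_0|apply HB, Hx]|].
    rewrite <- Rmult_assoc, (Rmult_comm _ K), !Rmult_assoc. apply Rmult_le_compat_l; [exact HK|].
    apply HMB, Hx0.
  - unfold mellin. rewrite (CRInt_gen_unique Fa infty _ _ Hl). exact Hl.
Qed.

(** The constant M is chosen before g. This uniformity is what lets the transform of the tail of a
    series tend to 0. *)
Lemma mellin_norm (D : R -> Prop) Fa (b c : R) (s : C) :
  left_end D Fa -> (0 < c)%R -> (b < Re s)%R ->
  exists M, (0 < M)%R /\ forall (g : R -> C) (K : R) (l : C), (0 <= K)%R ->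
    (forall x, D x -> Cmod (g x) <= K * exp_bound b c x)%R ->
    irint (fun x => Rpowc x (s - 1) * g x) Fa infty l -> (Cmod l <= K * M)%R.
Proof.
  intros HL Hc Hs. destruct (mellin_bound b c s Hc Hs) as [M [HM HMB]].
  assert (P : (0 < / (Re s - b))%R) by (apply Rinv_0_lt_compat; lra).
  exists (M * (/ (Re s - b) + / 1))%R. split; [apply Rmult_lt_0_compat; lra|].
  intros g K l HK HB Hl. rewrite <- Rmult_assoc.
  apply (irint_norm D Fa (Re s - b) 1 (K * M) (fun x => Rpowc x (s - 1) * g x)); try assumption; try lra.
  - apply Rmult_le_pos; lra.
  - intros x Hx. rewrite Cmod_mult. assert (Hx0 := left_end_pos _ _ HL x Hx).
    eapply Rle_trans; [apply Rmult_le_compat_l; [apply Cmod_ge_0|apply HB, Hx]|].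
    rewrite <- Rmult_assoc, (Rmult_comm _ K), !Rmult_assoc. apply Rmult_le_compat_l; [exact HK|].
    apply HMB, Hx0.
Qed.

(** Differentiating x^(s-1) in s brings down ln x. The remainder e^(h ln x) - 1 - h ln x is bounded
    by powers of x, with exponents small enough to stay within the half-plane of convergence. *)
Lemma cder_mellin (D : R -> Prop) Fa (b : R) (g : R -> C) (s : C) :
  left_end D Fa -> exp_decay D b g -> (b < Re s)%R ->
  cder (mellin Fa g) s (mellin Fa (fun x => ln x * g x) s).
Proof.
  intros HL Hdec Hs. assert (HD := left_end_pos _ _ HL).
  (* For |h| < d the factor |ln x|^2 costs e^(2 d |ln x|) / d^2 and e^(|h ln x|) costs another e^(d
     |ln x|), hence x^(3d) + x^(-3d). One sixth of the gap leaves Re s - b - 3d positive. *)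
  set (d := ((Re s - b) / 6)%R). assert (Hd : (0 < d)%R) by (unfold d; lra).
  assert (Hdec' : exp_decay D (b + d) (fun x => ln x * g x)) by (apply exp_decay_ln with b; [assumption|lra|assumption]).
  assert (Hg := Hdec). destruct Hg as [Hg [c [K [Hc [HK HB]]]]].
  destruct (exp_decay_dom (Re s - b - 3 * d) (6 * d) c) as [M [HM HMB]]; [unfold d; lra|exact Hc|].
  apply (cder_irint D Fa (Re s - b - 3 * d) 1 (/ (d * d) * K * (2 * M)) d
           (fun s x => Rpowc x (s - 1) * g x) (fun x => Rpowc x (s - 1) * (ln x * g x))); try assumption; try lra.
  - unfold d; lra.
  - assert (0 < / (d * d))%R by (apply Rinv_0_lt_compat, Rmult_lt_0_compat; lra).
    apply Rmult_le_pos; [apply Rmult_le_pos|]; lra.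
  - intros s' Hs'. apply mellin_irint with D b; try assumption.
    assert (T := re_le_Cmod (s' - s)). simpl in T. apply Rabs_le_between in T.
    unfold d, Re in *. lra.
  - apply mellin_irint with D (b + d)%R; try assumption. unfold d; lra.
  - intros s' x Hs' Hx. assert (Hx0 := HD x Hx). set (h := s' - s) in *.
    replace (Rpowc x (s' - 1) * g x - Rpowc x (s - 1) * g x - h * (Rpowc x (s - 1) * (ln x * g x)))
      with (Rpowc x (s - 1) * (Cexp (h * ln x) - 1 - h * ln x) * g x).
    2: { replace (s' - 1) with ((s - 1) + h) by (unfold h; ring). rewrite Rpowc_plus.
         unfold Rpowc at 3. ring. }
    rewrite !Cmod_mult.
    assert (L : (Cmod (Cexp (h * ln x) - 1 - h * ln x)
       <= Cmod h ^ 2 * / (d * d) * (Rpower x (3 * d) + Rpower x (- (3 * d))))%R).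
    { eapply Rle_trans; [apply Cmod_Cexp_taylor|]. rewrite Cmod_mult, Cmod_R.
      set (u := Rabs (ln x)). assert (Hu : (0 <= u)%R) by apply Rabs_pos.
      assert (Hh := Cmod_ge_0 h).
      assert (E1 : (exp (Cmod h * u) <= exp (d * u))%R) by (apply exp_le, Rmult_le_compat_r; lra).
      assert (E2 : (u ^ 2 <= / (d * d) * (exp (d * u) * exp (d * u)))%R).
      { assert (Q := Rle_exp (d * u)). assert (0 <= d * u)%R by (apply Rmult_le_pos; lra).
        apply Rmult_le_reg_l with (d * d)%R; [apply Rmult_lt_0_compat; lra|].
        rewrite <- Rmult_assoc, Rinv_r, Rmult_1_l by (apply Rgt_not_eq, Rmult_lt_0_compat; lra).
        replace (d * d * u ^ 2)%R with ((d * u) * (d * u))%R by ring. apply Rmult_le_compat; lra. }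
      assert (E3 := exp_Rabs_ln (3 * d) x). fold u in E3.
      replace (3 * d * u)%R with (d * u + d * u + d * u)%R in E3 by ring. rewrite !exp_plus in E3.
      rewrite Rpow_mult_distr.
      apply Rle_trans with (Cmod h ^ 2 * (/ (d * d) * (exp (d * u) * exp (d * u))) * exp (d * u))%R.
      - apply Rmult_le_compat; [apply Rmult_le_pos; apply pow2_ge_0|left; apply exp_pos| |exact E1].
        apply Rmult_le_compat_l; [apply pow2_ge_0|exact E2].
      - rewrite !Rmult_assoc. apply Rmult_le_compat_l; [apply pow2_ge_0|].
        apply Rmult_le_compat_l; [left; apply Rinv_0_lt_compat, Rmult_lt_0_compat; lra|].
        rewrite <- Rmult_assoc. apply E3; lra. }
    eapply Rle_trans.
    { apply Rmult_le_compat; [apply Rmult_le_pos; apply Cmod_ge_0|apply Cmod_ge_0| |apply HB, Hx].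
      apply Rmult_le_compat_l; [apply Cmod_ge_0|exact L]. }
    rewrite Cmod_Rpowc. unfold exp_bound.
    (* After taking out x^(Re s - b - 3d - 1), what remains is (x^(6d) + 1) e^(-cx), and x^(6d) + 1
       is at most 2 (1 + x)^(6d). *)
    set (R0 := Rpower x (Re s - b - 3 * d - 1)).
    replace (Re (s - 1)) with ((Re s - b - 3 * d - 1) + 3 * d + b)%R by (unfold Re; simpl; ring).
    rewrite !Rpower_plus. fold R0.
    assert (Eb : (Rpower x b * Rpower x (- b) = 1)%R).
    { rewrite <- Rpower_plus, Rplus_opp_r, Rpower_O by exact Hx0. reflexivity. }
    assert (Ed : (Rpower x (3 * d) * Rpower x (- (3 * d)) = 1)%R).
    { rewrite <- Rpower_plus, Rplus_opp_r, Rpower_O by exact Hx0. reflexivity. }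
    replace (R0 * Rpower x (3 * d) * Rpower x b * (Cmod h ^ 2 * / (d * d) * (Rpower x (3 * d) + Rpower x (- (3 * d)))) *
       (K * (Rpower x (- b) * exp (- (c * x)))))%R with
      (Cmod h ^ 2 * (/ (d * d) * K) * (R0 * ((Rpower x (3 * d) * Rpower x (3 * d) + Rpower x (3 * d) * Rpower x (- (3 * d))) *
        (Rpower x b * Rpower x (- b)) * exp (- (c * x)))))%R by ring.
    rewrite Eb, Ed, Rmult_1_r, <- Rpower_plus.
    replace (Cmod h ^ 2 * (/ (d * d) * K * (2 * M)) * dom (Re s - b - 3 * d) 1 x)%R with
      (Cmod h ^ 2 * (/ (d * d) * K) * (2 * (M * dom (Re s - b - 3 * d) 1 x)))%R by ring.
    apply Rmult_le_compat_l.
    { apply Rmult_le_pos; [apply pow2_ge_0|]. apply Rmult_le_pos; [|exact HK].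
      left; apply Rinv_0_lt_compat, Rmult_lt_0_compat; lra. }
    eapply Rle_trans; [|apply Rmult_le_compat_l; [lra|apply HMB, Hx0]]. fold R0.
    assert (P0 : (0 < R0)%R) by apply Rpower_pos. assert (P1 := exp_pos (- (c * x))).
    assert (Q1 : (Rpower x (3 * d + 3 * d) <= Rpower (1 + x) (6 * d))%R).
    { replace (3 * d + 3 * d)%R with (6 * d)%R by ring. apply Rle_Rpower_l; lra. }
    assert (Q2 : (1 <= Rpower (1 + x) (6 * d))%R).
    { apply Rle_trans with (Rpower (1 + x) 0); [right; symmetry; apply Rpower_O; lra|apply Rle_Rpower; lra].
      }
    replace (2 * (R0 * (Rpower (1 + x) (6 * d) * exp (- (c * x)))))%R with
      (R0 * ((2 * Rpower (1 + x) (6 * d)) * exp (- (c * x))))%R by ring.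
    apply Rmult_le_compat_l; [lra|]. apply Rmult_le_compat_r; lra.
Qed.

Lemma locally_Re_gt (b : R) (s : C) : (b < Re s)%R -> locally s (fun z => b < Re z)%R.
Proof.
  intros Hs. apply (proj2 (locally_C_Cmod s _)). assert (Hp : (0 < Re s - b)%R) by lra.
  exists (mkposreal _ Hp). simpl. intros y Hy.
  assert (T := re_le_Cmod (y - s)). simpl in T. apply Rabs_le_between in T. unfold Re in *. lra.
Qed.

Lemma locally_Re_lt (b : R) (s : C) : (Re s < b)%R -> locally s (fun z => Re z < b)%R.
Proof.
  intros Hs. apply (proj2 (locally_C_Cmod s _)). assert (Hp : (0 < b - Re s)%R) by lra.
  exists (mkposreal _ Hp). simpl. intros y Hy.
  assert (T := re_le_Cmod (y - s)). simpl in T. apply Rabs_le_between in T. unfold Re in *. lra.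
Qed.

Lemma hol2_mellin (D : R -> Prop) Fa (b : R) (g : R -> C) (s : C) :
  left_end D Fa -> exp_decay D b g -> (b < Re s)%R -> hol2 (mellin Fa g) s.
Proof.
  intros HL Hdec Hs. assert (HD := left_end_pos _ _ HL).
  exists (mellin Fa (fun x => ln x * g x)).
  (* The derivative is the transform of ln x g, whose decay exponent is only known to be some b' >
     b. The midpoint still lies to the left of all points near s, so a second differentiation is
     possible. *)
  set (b' := ((b + Re s) / 2)%R).
  generalize (locally_Re_gt b' s). unfold b' at 1. intros L. specialize (L ltac:(lra)).
  revert L. apply filter_imp. intros y Hy. fold b' in Hy.
  split.
  - apply cder_mellin with D b; try assumption. unfold b' in Hy. lra.
  - eexists. apply cder_mellin with D b'; try assumption.
    apply exp_decay_ln with b; try assumption. unfold b'. lra.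
Qed.

Lemma mellin_dilate (g : R -> C) (b c : R) (s : C) : (0 < c)%R ->
  exp_decay (fun x => 0 < x)%R b g -> (b < Re s)%R ->
  irint (fun x => Rpowc x (s - 1) * g (c * x)%R) (at_right 0) infty (Rpowc c (- s) * mellin (at_right 0) g s).
Proof.
  intros Hc Hg Hs.
  assert (H := mellin_irint _ _ b g s left_zero Hg Hs).
  apply (irint_dilate _ c) in H; [|exact Hc].
  apply (irint_scal _ _ (Rpowc c (- (s - 1)))) in H.
  replace (Rpowc c (- s) * mellin (at_right 0) g s) with
    (Rpowc c (- (s - 1)) * (/ c * mellin (at_right 0) g s)).
  - revert H. apply (irint_ext (fun x => 0 < x)%R); [constructor|].
    intros x Hx. rewrite Rpowc_mult_base, Rpowc_opp by assumption. field. apply Rpowc_neq_0.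
  - replace (- (s - 1)) with (- s + 1) by ring. rewrite Rpowc_plus, Rpowc_1 by exact Hc.
    field. intros E. apply RtoC_inj in E. lra.
Qed.

(** * The Gamma function *)

Lemma irint_primitive (D : R -> Prop) Fa (F f : R -> C) (la lb : C) :
  left_end D Fa -> (forall x, D x -> rder F x (f x)) -> (forall x, D x -> continuous f x) ->
  filterlim F Fa (locally la) -> filterlim F infty (locally lb) -> irint f Fa infty (lb - la).
Proof.
  intros HL HF Hf La Lb. assert (PF := left_end_proper _ _ HL).
  assert (LL : filterlim (fun ab : R * R => F (snd ab) + - F (fst ab))
      (filter_prod Fa infty) (locally (lb + - la))).
  { apply (filterlim_comp_2 (G := locally lb) (H := locally (- la))).
    - refine (filterlim_comp _ _ _ snd F _ infty _ _ Lb). apply filterlim_snd.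
    - refine (filterlim_comp _ _ _ (fun ab : R * R => F (fst ab)) Copp _ (locally la) _ _ _);
        [|apply (filterlim_opp (V := C_NormedModule))].
      refine (filterlim_comp _ _ _ fst F _ Fa _ _ La). apply filterlim_fst.
    - apply (filterlim_plus (V := C_NormedModule)). }
  intros P HP. apply LL in HP. unfold filtermap, filtermapi in *.
  generalize (filter_and _ _ HP (left_end_prod _ _ HL)). apply filter_imp.
  intros [x y] [Hp [Hxy HD]]. simpl in *. eexists. split; [|exact Hp].
  apply (is_RInt_derive (V := C_R_CompleteNormedModule) F f);
    rewrite Rmin_left, Rmax_right by exact Hxy; intros; [apply HF|apply Hf]; auto.
Qed.

Lemma filterlim_C_0 {T : Type} (F : (T -> Prop) -> Prop) {FF : Filter F} (f : T -> C) :
  (forall eps : posreal, F (fun x => Cmod (f x) < eps)%R) -> filterlim f F (locally (RtoC 0)).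
Proof.
  intros H P HP. destruct (proj1 (locally_C_Cmod 0 P) HP) as [d Hd].
  unfold filtermap. generalize (H d). apply filter_imp. intros x Hx. apply Hd.
  replace (f x - 0) with (f x) by ring. exact Hx.
Qed.

Lemma Rpower_small_at_right (a : R) (eps : posreal) : (0 < a)%R ->
  at_right 0 (fun x => Rpower x a < eps)%R.
Proof.
  intros Ha. assert (Hp := Rpower_pos eps (/ a)). generalize (at_right_0_between _ Hp).
  apply filter_imp. intros x Hx. apply Rpower_lt_eps; [exact Ha|apply eps|exact Hx].
Qed.

Lemma exp_small_infty (c : R) (eps : posreal) : (0 < c)%R -> infty (fun x => exp (- (c * x)) < eps)%R.
Proof.
  intros Hc. exists (- ln eps / c)%R. intros x Hx. rewrite <- (exp_ln eps) by apply eps.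
  apply exp_increasing. apply Rlt_div_l in Hx; [|exact Hc]. lra.
Qed.

Definition exp_neg (t : R) : C := RtoC (exp (- t)).

Lemma exp_decay_exp_neg (D : R -> Prop) : (forall x, D x -> 0 < x)%R -> exp_decay D 0 exp_neg.
Proof.
  intros HD. split.
  - intros x _. apply cont_RtoC. apply continuous_Rcomp; [|apply continuous_exp].
    apply (continuous_opp (V := R_NormedModule)), continuous_id.
  - exists 1%R, 1%R. split; [lra|]. split; [lra|]. intros x Hx. unfold exp_neg.
    rewrite Cmod_R, Rabs_pos_eq by (left; apply exp_pos). unfold exp_bound.
    rewrite Ropp_0, Rpower_O by auto. rewrite !Rmult_1_l. lra.
Qed.

Lemma Gamma_integral_irint (s : C) : (0 < Re s)%R ->
  irint (fun t => Rpowc t (s - 1) * exp_neg t) (at_right 0) infty (Gamma_integral s).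
Proof.
  intros Hs. apply (mellin_irint (fun x => 0 < x)%R _ 0); [constructor| |exact Hs].
  apply exp_decay_exp_neg. auto.
Qed.

Lemma rder_exp_neg (t : R) : rder exp_neg t (- exp_neg t).
Proof.
  eapply rder_eq; [apply (rder_RtoC (fun t => exp (- t)) t (- exp (- t))%R)|].
  - auto_derive; [easy|ring].
  - unfold exp_neg. rewrite RtoC_opp. reflexivity.
Qed.

Lemma Gamma_integral_1 : Gamma_integral 1 = 1.
Proof.
  assert (H : irint exp_neg (at_right 0) infty (0 - - (1))).
  { apply (irint_primitive (fun x => 0 < x)%R _ (fun t => - exp_neg t)).
    - constructor.
    - intros x _. eapply rder_eq; [|instantiate (1 := - - exp_neg x); ring].
      apply (is_derive_opp (V := C_R_NormedModule)). apply rder_exp_neg.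
    - intros x Hx. apply (exp_decay_exp_neg (fun x => 0 < x)%R); auto.
    - apply (filterlim_filter_le_1 (F := locally 0%R)).
      { intros P HP. unfold at_right, within. revert HP. apply filter_imp. auto. }
      replace (- (1)) with (- exp_neg 0) by (unfold exp_neg; rewrite Ropp_0, exp_0; reflexivity).
      apply cont_opp. apply (rder_continuous _ _ _ (rder_exp_neg 0)).
    - apply filterlim_C_0; [typeclasses eauto|]. intros eps.
      generalize (exp_small_infty 1 eps Rlt_0_1).
      apply filter_imp. intros x Hx. rewrite Cmod_opp. unfold exp_neg.
      rewrite Cmod_R, Rabs_pos_eq by (left; apply exp_pos). rewrite Rmult_1_l in Hx. exact Hx. }
  assert (PF := at_right_proper_filter 0).
  eapply (irint_unique (at_right 0) infty); [apply Gamma_integral_irint; simpl; lra|].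
  replace (0 - - (1)) with (RtoC 1) in H by ring. revert H.
  apply (irint_ext (fun x => 0 < x)%R); [constructor|].
  intros x Hx. replace (1 - 1) with (RtoC 0) by ring.
  unfold Rpowc. rewrite Cmult_0_l, Cexp_0. ring.
Qed.

(** Integration by parts in one stroke: s t^(s-1) e^(-t) - t^s e^(-t) has the primitive t^s e^(-t),
    which vanishes at both ends. *)
Lemma Gamma_integral_succ (s : C) : (0 < Re s)%R -> Gamma_integral (s + 1) = s * Gamma_integral s.
Proof.
  intros Hs. assert (PF := at_right_proper_filter 0).
  assert (H0 := Gamma_integral_irint s Hs).
  assert (H1 : irint (fun t => Rpowc t (s + 1 - 1) * exp_neg t) (at_right 0) infty (Gamma_integral (s + 1))).
  { apply Gamma_integral_irint. unfold Re in *. simpl. lra. }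
  assert (H2 : irint (fun t => s * (Rpowc t (s - 1) * exp_neg t) - Rpowc t (s + 1 - 1) * exp_neg t)
             (at_right 0) infty (0 - 0)).
  { apply (irint_primitive (fun x => 0 < x)%R _ (fun t => Rpowc t s * exp_neg t)).
    - constructor.
    - intros x Hx. eapply rder_eq.
      + apply rder_mult; [apply rder_Rpowc, Hx|apply rder_exp_neg].
      + simpl. replace (s + 1 - 1) with s by ring. ring.
    - intros x Hx. apply cont_minus; [apply cont_mult; [apply cont_const|]|];
        (apply cont_mult; [apply continuous_Rpowc, Hx|apply (exp_decay_exp_neg (fun x => 0 < x)%R); auto]).
    - apply filterlim_C_0; [typeclasses eauto|]. intros eps.
      generalize (Rpower_small_at_right (Re s) eps Hs). unfold at_right, within. apply filter_imp.
      intros x Hx Hx0. rewrite Cmod_mult, Cmod_Rpowc. unfold exp_neg.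
      rewrite Cmod_R, Rabs_pos_eq by (left; apply exp_pos).
      eapply Rle_lt_trans; [|apply Hx, Hx0]. assert (exp (- x) <= exp 0)%R by (apply exp_le; lra).
      rewrite exp_0 in H. assert (P := Rpower_pos x (Re s)).
      rewrite <- (Rmult_1_r (Rpower x (Re s))) at 2. apply Rmult_le_compat_l; lra.
    - apply filterlim_C_0; [typeclasses eauto|]. intros eps.
      destruct (exp_decay_poly (Re s) (1 / 2)) as [K [HK HB]]; [lra|].
      assert (He : (0 < eps / K)%R) by (apply Rdiv_lt_0_compat; [apply eps|exact HK]).
      destruct (exp_small_infty (1 / 2) (mkposreal _ He)) as [M HM]; [lra|]. simpl in HM.
      exists (Rmax M 0). intros x Hx.
      assert (Hx1 : (M < x)%R) by (eapply Rle_lt_trans; [apply Rmax_l|exact Hx]).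
      assert (Hx0 : (0 < x)%R) by (eapply Rle_lt_trans; [apply (Rmax_r M)|exact Hx]).
      specialize (HM x Hx1). specialize (HB x Hx0). rewrite Cmod_mult, Cmod_Rpowc. unfold exp_neg.
      rewrite Cmod_R, Rabs_pos_eq by (left; apply exp_pos).
      apply Rlt_div_r in HM; [|exact HK].
      replace (- x)%R with (- (1 / 2 * x) + - (1 / 2 * x))%R by field. rewrite exp_plus.
      assert (Q : (Rpower x (Re s) <= Rpower (1 + x) (Re s))%R) by (apply Rle_Rpower_l; lra).
      assert (P := exp_pos (- (1 / 2 * x))).
      rewrite <- Rmult_assoc. eapply Rle_lt_trans; [|exact HM].
      rewrite Rmult_comm. apply Rmult_le_compat_l; [lra|].
      eapply Rle_trans; [|exact HB]. apply Rmult_le_compat_r; lra. }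
  assert (H3 := irint_minus _ _ _ _ _ _ (irint_scal _ _ s _ _ H0) H1).
  assert (E := irint_unique _ _ _ _ _ H2 H3).
  replace (Gamma_integral (s + 1)) with (s * Gamma_integral s - (s * Gamma_integral s - Gamma_integral (s + 1))) by ring.
  rewrite <- E. ring.
Qed.

Lemma up_neg_spec (x : R) : (0 < x + INR (Z.to_nat (up (- x))))%R.
Proof.
  destruct (archimed (- x)) as [A _].
  destruct (Z_le_gt_dec 0 (up (- x))) as [H|H].
  - rewrite INR_IZR_INZ, Z2Nat.id by exact H. lra.
  - assert (IZR (up (- x)) <= 0)%R by (apply IZR_le; lia).
    generalize (pos_INR (Z.to_nat (up (- x)))). lra.
Qed.

Lemma up_neg_le (x : R) (n : nat) : (0 < x + INR n)%R -> (Z.to_nat (up (- x)) <= n)%nat.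
Proof.
  intros H. destruct (archimed (- x)) as [_ A].
  assert (IZR (up (- x)) < IZR (Z.of_nat n + 1))%R.
  { rewrite plus_IZR, <- INR_IZR_INZ. lra. }
  apply lt_IZR in H0. lia.
Qed.

Lemma Cinv_0 : / RtoC 0 = 0.
Proof. apply injective_projections; simpl; unfold Rdiv; ring. Qed.

(** Unconditional because / 0 = 0; the shift formula for [Gamma] can then be stated at every s,
    poles included. *)
Lemma Cinv_mult (a b : C) : / (a * b) = / a * / b.
Proof.
  destruct (Ceq_dec a 0) as [->|Ha]; [rewrite Cmult_0_l, Cinv_0; ring|].
  destruct (Ceq_dec b 0) as [->|Hb]; [rewrite Cmult_0_r, Cinv_0; ring|].
  field. auto.
Qed.

Lemma RtoC_INR_S (n : nat) : RtoC (INR (S n)) = RtoC (INR n) + 1.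
Proof. rewrite S_INR, RtoC_plus. reflexivity. Qed.

(** Every admissible shift gives the same value: from n to n + 1 both the Euler integral and
    [rising] gain the factor s + n, which is nonzero because its real part is positive. *)
Lemma Gamma_shift (s : C) (n : nat) : (0 < Re s + INR n)%R ->
  Gamma s = Gamma_integral (s + INR n) / rising s n.
Proof.
  intros Hn. unfold Gamma. assert (Hle := up_neg_le _ _ Hn). assert (Hm := up_neg_spec (Re s)).
  set (m := Z.to_nat (up (- Re s))) in *. clearbody m.
  induction Hle as [|n Hle IH]; [reflexivity|].
  assert (Hn' : (0 < Re s + INR n)%R).
  { apply le_INR in Hle. lra. }
  rewrite IH by exact Hn'. rewrite RtoC_INR_S. simpl rising.
  replace (s + (INR n + 1)) with ((s + INR n) + 1) by ring.
  assert (P : (0 < Re (s + INR n))%R) by (unfold Re in *; simpl; exact Hn').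
  rewrite Gamma_integral_succ by exact P.
  unfold Cdiv. rewrite Cinv_mult.
  assert (Q : s + INR n <> 0) by (intros E; rewrite E in P; simpl in P; lra).
  rewrite (Cmult_comm (s + INR n)), <- Cmult_assoc. f_equal.
  rewrite (Cmult_comm (/ rising s n)), Cmult_assoc, Cinv_r by exact Q. ring.
Qed.

Lemma Gamma_pos (s : C) : (0 < Re s)%R -> Gamma s = Gamma_integral s.
Proof.
  intros Hs. rewrite (Gamma_shift s 0) by (simpl; lra). simpl. rewrite Cplus_0_r. field.
Qed.

Lemma rising_succ (s : C) (n : nat) : rising s (S n) = s * rising (s + 1) n.
Proof.
  induction n as [|n IH]; [simpl; ring|].
  change (rising s (S (S n))) with (rising s (S n) * (s + INR (S n))).
  change (rising (s + 1) (S n)) with (rising (s + 1) n * (s + 1 + INR n)).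
  rewrite IH, RtoC_INR_S. ring.
Qed.

Lemma Gamma_succ (s : C) : s <> 0 -> Gamma (s + 1) = s * Gamma s.
Proof.
  intros Hs. set (n := Z.to_nat (up (- Re s))).
  assert (Hn : (0 < Re s + INR n)%R) by apply up_neg_spec.
  (* Shift n for s + 1 and shift n + 1 for s lead to the same Euler integral. *)
  rewrite (Gamma_shift (s + 1) n) by (unfold Re in *; simpl; lra).
  rewrite (Gamma_shift s (S n)) by (rewrite S_INR; lra).
  rewrite rising_succ, RtoC_INR_S. unfold Cdiv. rewrite Cinv_mult.
  replace (s + 1 + INR n) with (s + (INR n + 1)) by ring.
  replace (s * (Gamma_integral (s + (INR n + 1)) * (/ s * / rising (s + 1) n))) with
    ((s * / s) * (Gamma_integral (s + (INR n + 1)) * / rising (s + 1) n)) by ring.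
  rewrite Cinv_r by exact Hs. ring.
Qed.

Definition nonpole (s : C) : Prop := forall n : nat, s <> - RtoC (INR n).

Lemma nonpole_succ s : nonpole s -> nonpole (s + 1).
Proof.
  intros H n E. apply (H (S n)). rewrite RtoC_INR_S.
  replace s with (s + 1 - 1) by ring. rewrite E. ring.
Qed.

Lemma nonpole_neq_0 s : nonpole s -> s <> 0.
Proof. intros H E. apply (H 0%nat). rewrite E. simpl. ring. Qed.

Lemma hol2_Gamma_pos (s : C) : (0 < Re s)%R -> hol2 Gamma s.
Proof.
  intros Hs. apply hol2_ext_loc with (mellin (at_right 0) exp_neg).
  - generalize (locally_Re_gt 0 s Hs). apply filter_imp. intros y Hy. symmetry. apply Gamma_pos, Hy.
  - apply (hol2_mellin (fun x => 0 < x)%R _ 0); [constructor| |exact Hs].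
    apply exp_decay_exp_neg; auto.
Qed.

Lemma locally_neq (a s : C) : s <> a -> locally s (fun z => z <> a).
Proof.
  intros H. apply (proj2 (locally_C_Cmod s _)).
  assert (Hp : (0 < Cmod (a - s))%R) by (apply Cmod_gt_0; intros E; apply H; symmetry; apply Ceq_minus; exact E).
  exists (mkposreal _ Hp). simpl. intros y Hy ->. lra.
Qed.

(** Gamma z = Gamma (z + 1) / z carries differentiability one unit to the left; n counts the units
    to the half-plane Re s > 0. *)
Lemma hol2_Gamma (s : C) : nonpole s -> hol2 Gamma s.
Proof.
  assert (K : forall n s, (0 < Re s + INR n)%R -> nonpole s -> hol2 Gamma s).
  { clear s. induction n as [|n IH]; intros s Hn Hs.
    - apply hol2_Gamma_pos. simpl in Hn. lra.
    - assert (S1 : hol2 Gamma (s + 1)).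
      { apply IH; [|apply nonpole_succ, Hs]. rewrite S_INR in Hn. unfold Re in *; simpl. lra. }
      assert (H0 := nonpole_neq_0 s Hs).
      apply hol2_ext_loc with (fun z => Gamma (z + 1) / z).
      + generalize (locally_neq 0 s H0). apply filter_imp. intros z Hz.
        rewrite Gamma_succ by exact Hz. field. exact Hz.
      + apply hol2_div; [|apply hol2_id|exact H0].
        apply (hol2_comp Gamma (fun z => z + 1)); [|exact S1].
        apply hol2_plus; [apply hol2_id|apply hol2_const]. }
  intros Hs. apply (K (Z.to_nat (up (- Re s)))); [apply up_neg_spec|exact Hs].
Qed.

(** * Closed forms in polar coordinates *)

Lemma locally_between (a b x : R) : (a < x < b)%R -> locally x (fun y => a < y < b)%R.
Proof.
  intros H. assert (Hp : (0 < Rmin (x - a) (b - x))%R) by (apply Rmin_pos; lra).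
  exists (mkposreal _ Hp). intros y Hy. unfold ball in Hy; simpl in Hy.
  unfold AbsRing_ball, abs, minus, plus, opp in Hy; simpl in Hy. apply Rabs_def2 in Hy.
  generalize (Rmin_l (x - a) (b - x)) (Rmin_r (x - a) (b - x)). lra.
Qed.

Lemma locally_rectangle (A B T1 T2 u t : R) : (A < u < B)%R -> (T1 < t < T2)%R ->
  locally (u, t) (fun z : R * R => (A < fst z < B)%R /\ (T1 < snd z < T2)%R).
Proof.
  intros Hu Ht. apply filter_and.
  - apply (continuous_fst (U := R_UniformSpace) (V := R_UniformSpace) u t (fun y => A < y < B)%R).
    apply locally_between, Hu.
  - apply (continuous_snd (U := R_UniformSpace) (V := R_UniformSpace) u t (fun y => T1 < y < T2)%R).
    apply locally_between, Ht.
Qed.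

(** The common value W of the t-derivative of P and the u-derivative of Q says that P du + Q dt is a
    closed form. Differentiating under the integral gives the integral of the u-derivative of Q, a
    difference of boundary values. *)
Lemma is_derive_RInt_closed (P Q W : R -> R -> R) (A B T1 T2 a b t : R) :
  (A < a <= b)%R -> (b < B)%R -> (T1 < t < T2)%R ->
  (forall u t, A < u < B -> T1 < t < T2 -> is_derive (fun t => P u t) t (W u t))%R ->
  (forall u t, A < u < B -> T1 < t < T2 -> is_derive (fun u => Q u t) u (W u t))%R ->
  (forall u t, A < u < B -> T1 < t < T2 -> continuous (fun z => W (fst z) (snd z)) (u, t))%R ->
  (forall u t, A < u < B -> T1 < t < T2 -> continuous (fun u => P u t) u)%R ->
  is_derive (fun t => RInt (fun u => P u t) a b) t (Q b t - Q a t)%R.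
Proof.
  intros Hab Hb Ht HP HQ HW HPc.
  assert (S : RInt (fun u => Derive (fun t => P u t) t) a b = (Q b t - Q a t)%R).
  { apply is_RInt_unique. apply (is_RInt_ext (fun u => W u t)).
    { rewrite Rmin_left, Rmax_right by lra. intros u Hu. symmetry. apply is_derive_unique, HP; lra.
      }
    apply (is_RInt_derive (V := R_CompleteNormedModule) (fun u => Q u t));
      rewrite Rmin_left, Rmax_right by lra; intros u Hu; [apply HQ; lra|].
    apply (continuous_comp (fun u => (u, t)) (fun z : R * R => W (fst z) (snd z))).
    - apply filterlim_locally. intros eps. exists eps. intros y Hy.
      split; [exact Hy|apply ball_center].
    - apply HW; lra. }
  rewrite <- S.
  apply (is_derive_RInt_param (fun t u => P u t) a b t).
  - generalize (locally_between _ _ _ Ht). intros [d Hd]. exists d. intros y Hy u Hu.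
    rewrite Rmin_left, Rmax_right in Hu by lra. eexists. apply HP; [lra|]. apply Hd, Hy.
  - intros u Hu. rewrite Rmin_left, Rmax_right in Hu by lra.
    apply continuity_2d_pt_ext_loc with (fun t u => W u t).
    + assert (Hu' : (A < u < B)%R) by lra.
      assert (L := locally_rectangle A B T1 T2 u t Hu' Ht). destruct L as [d Hd].
      exists d. intros x y Hx Hy. symmetry. apply is_derive_unique.
      assert (Z := Hd (y, x)). simpl in Z. apply HP; apply Z; (split; [exact Hy|exact Hx]).
    + apply continuity_2d_pt_filterlim.
      apply (continuous_comp (fun z : R * R => (snd z, fst z)) (fun z : R * R => W (fst z) (snd z)) (t, u)).
      * apply filterlim_locally. intros eps. exists eps. intros y [Hy1 Hy2]. split; assumption.
      * apply (HW u t); lra.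
  - generalize (locally_between _ _ _ Ht). intros [d Hd]. exists d. intros y Hy.
    apply (ex_RInt_continuous (V := R_CompleteNormedModule)). intros u Hu.
    rewrite Rmin_left, Rmax_right in Hu by lra. apply HPc; [lra|apply Hd, Hy].
Qed.

Lemma CRInt_components (f : R -> C) (a b : R) :
  (forall x, (Rmin a b <= x <= Rmax a b)%R -> continuous f x) ->
  CRInt f a b = (RInt (fun x => Re (f x)) a b, RInt (fun x => Im (f x)) a b).
Proof.
  intros H. assert (K := proj1 (crint_pair _ _ _ _) (crint_CRInt f a b H)). destruct K as [K1 K2].
  apply injective_projections; simpl; symmetry; apply is_RInt_unique; assumption.
Qed.

Lemma rder_CRInt_closed (P Q W : R -> R -> C) (A B T1 T2 a b t : R) :
  (A < a <= b)%R -> (b < B)%R -> (T1 < t < T2)%R ->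
  (forall u t, A < u < B -> T1 < t < T2 -> rder (fun t => P u t) t (W u t))%R ->
  (forall u t, A < u < B -> T1 < t < T2 -> rder (fun u => Q u t) u (W u t))%R ->
  (forall u t, A < u < B -> T1 < t < T2 -> continuous (fun z => W (fst z) (snd z)) (u, t))%R ->
  (forall u t, A < u < B -> T1 < t < T2 -> continuous (fun u => P u t) u)%R ->
  rder (fun t => CRInt (fun u => P u t) a b) t (Q b t - Q a t).
Proof.
  intros Hab Hb Ht HP HQ HW HPc.
  apply rder_ext_loc with (fun t => (RInt (fun u => Re (P u t)) a b, RInt (fun u => Im (P u t)) a b)).
  { generalize (locally_between _ _ _ Ht). apply filter_imp. intros y Hy. symmetry.
    apply CRInt_components. rewrite Rmin_left, Rmax_right by lra. intros x Hx.
    apply HPc; [lra|exact Hy]. }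
  apply rder_pair. split; simpl.
  - apply (is_derive_RInt_closed (fun u t => Re (P u t)) (fun u t => Re (Q u t)) (fun u t => Re (W u t)) A B T1 T2 a b t); try assumption.
    + intros. apply rder_pair, HP; assumption.
    + intros. apply (rder_pair (fun u => Q u t0)), HQ; assumption.
    + intros. apply (continuous_C_pair (fun z : R * R => W (fst z) (snd z))), HW; assumption.
    + intros. apply (continuous_C_pair (fun u => P u t0)), HPc; assumption.
  - apply (is_derive_RInt_closed (fun u t => Im (P u t)) (fun u t => Im (Q u t)) (fun u t => Im (W u t)) A B T1 T2 a b t); try assumption.
    + intros. apply rder_pair, HP; assumption.
    + intros. apply (rder_pair (fun u => Q u t0)), HQ; assumption.
    + intros. apply (continuous_C_pair (fun z : R * R => W (fst z) (snd z))), HW; assumption.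
    + intros. apply (continuous_C_pair (fun u => P u t0)), HPc; assumption.
Qed.

(* [F rho theta] is a holomorphic function written in polar coordinates of
   (the universal cover of) C minus 0, with radial derivative [F']. *)
Definition polar_hol (F F' : R -> R -> C) (rho theta : R) : Prop :=
  rder (fun x => F x theta) rho (F' rho theta) /\
  rder (fun y => F rho y) theta (Ci * rho * F' rho theta) /\
  continuous (fun z : R * R => F (fst z) (snd z)) (rho, theta) /\
  continuous (fun z : R * R => F' (fst z) (snd z)) (rho, theta).

Lemma polar_cauchy (F F' : R -> R -> C) (A B a b T : R) :
  (0 <= A < a)%R -> (a <= b < B)%R -> (PI < T)%R ->
  (forall rho theta, A < rho < B -> - T < theta < T -> polar_hol F F' rho theta)%R ->
  CRInt (fun rho => F rho PI / rho) a b - CRInt (fun rho => F rho (- PI)%R / rho) a b =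
  Ci * (CRInt (F b) (- PI)%R PI - CRInt (F a) (- PI)%R PI).
Proof.
  intros HA Hb HT H. assert (HPI := PI_RGT_0).
  assert (N : forall u, (A < u)%R -> RtoC u <> 0) by (intros u Hu E; apply RtoC_inj in E; lra).
  assert (K : forall t, (- PI <= t <= PI)%R ->
     rder (fun t => CRInt (fun u => F u t / u) a b) t (Ci * F b t - Ci * F a t)).
  { intros t Ht.
    apply (rder_CRInt_closed (fun u t => F u t / u) (fun u t => Ci * F u t) (fun u t => Ci * F' u t) A B (- T) T); try lra.
    - intros u t' Hu Ht'. destruct (H u t' Hu Ht') as [_ [H2 _]].
      apply (rder_mult _ (fun _ => / RtoC u) _ _ 0) in H2; [|apply rder_const].
      eapply rder_eq; [exact H2|]. field. apply N; lra.
    - intros u t' Hu Ht'. apply rder_scal, H; assumption.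
    - intros u t' Hu Ht'. apply cont_mult; [apply cont_const|]. apply H; assumption.
    - intros u t' Hu Ht'. apply cont_div; [|apply cont_RtoC, continuous_id|apply N; lra].
      destruct (H u t' Hu Ht') as [H1 _]. apply (rder_continuous _ _ _ H1). }
  assert (C1 : forall u t, (A < u < B)%R -> (- T < t < T)%R -> continuous (F u) t).
  { intros u t Hu Ht. destruct (H u t Hu Ht) as [_ [H2 _]]. apply (rder_continuous _ _ _ H2). }
  assert (I1 : crint (fun t => Ci * F b t - Ci * F a t) (- PI) PI
     (CRInt (fun u => F u PI / u) a b - CRInt (fun u => F u (- PI)%R / u) a b)).
  { apply (is_RInt_derive (V := C_R_CompleteNormedModule) (fun t => CRInt (fun u => F u t / u) a b));
      rewrite Rmin_left, Rmax_right by lra; intros t Ht; [apply K, Ht|].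
    apply cont_minus; (apply cont_mult; [apply cont_const|]); apply C1; lra. }
  assert (I2 : crint (fun t => Ci * F b t - Ci * F a t) (- PI) PI
     (Ci * CRInt (F b) (- PI)%R PI - Ci * CRInt (F a) (- PI)%R PI)).
  { apply (is_RInt_minus (V := C_R_NormedModule)); apply crint_scal, crint_CRInt;
      rewrite Rmin_left, Rmax_right by lra; intros t Ht; apply C1; lra. }
  rewrite <- (CRInt_unique _ _ _ _ I1), (CRInt_unique _ _ _ _ I2). ring.
Qed.

Lemma continuous_fst_RR (x y : R) : continuous (fun z : R * R => fst z) (x, y).
Proof. apply (continuous_fst (U := R_UniformSpace) (V := R_UniformSpace)). Qed.

Lemma continuous_snd_RR (x y : R) : continuous (fun z : R * R => snd z) (x, y).
Proof. apply (continuous_snd (U := R_UniformSpace) (V := R_UniformSpace)). Qed.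

Lemma polar_hol_mult (F F' G G' : R -> R -> C) (rho theta : R) :
  polar_hol F F' rho theta -> polar_hol G G' rho theta ->
  polar_hol (fun x y => F x y * G x y) (fun x y => F' x y * G x y + F x y * G' x y) rho theta.
Proof.
  intros [A1 [A2 [A3 A4]]] [B1 [B2 [B3 B4]]]. split; [|split; [|split]]; cbv beta.
  - apply (rder_mult (fun x => F x theta) (fun x => G x theta)); assumption.
  - eapply rder_eq; [apply (rder_mult (F rho) (G rho)); eassumption|]. ring.
  - apply cont_mult; assumption.
  - apply cont_plus; apply cont_mult; assumption.
Qed.

Lemma polar_Cexp (rho theta : R) : polar rho theta = rho * Cexp (Ci * theta).
Proof.
  unfold polar. rewrite Cexp_components. unfold Re, Im. simpl.
  replace (0 * theta - 1 * 0)%R with 0%R by ring. replace (0 * 0 + 1 * theta)%R with theta by ring.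
  rewrite exp_0. apply injective_projections; simpl; ring.
Qed.

Lemma polar_pi (rho : R) : polar rho PI = - rho.
Proof. unfold polar. rewrite cos_PI, sin_PI. apply injective_projections; simpl; ring. Qed.

Lemma polar_opp_pi (rho : R) : polar rho (- PI) = - rho.
Proof. unfold polar. rewrite cos_neg, sin_neg, cos_PI, sin_PI.
apply injective_projections; simpl; ring. Qed.

Lemma Cmod_polar (rho theta : R) : (0 <= rho)%R -> Cmod (polar rho theta) = rho.
Proof.
  intros H. rewrite polar_Cexp, Cmod_mult, Cmod_Cexp, Cmod_R, Rabs_pos_eq by exact H.
  replace (Re (Ci * theta)) with 0%R by (unfold Re; simpl; ring). rewrite exp_0. ring.
Qed.

Lemma polar_hol_polar (rho theta : R) :
  polar_hol polar (fun _ y => Cexp (Ci * y)) rho theta.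
Proof.
  assert (E : forall y : R, rder (fun y : R => Cexp (Ci * y)) y (Ci * Cexp (Ci * y))).
  { intros y. apply (rder_comp_cder Cexp (fun y : R => Ci * y) y _ Ci); [apply cder_Cexp|].
    eapply rder_eq; [apply rder_scal, rder_RtoC, (is_derive_id (K := R_AbsRing))|].
    unfold one; simpl. ring. }
  split; [|split; [|split]]; cbv beta.
  - apply rder_ext with (fun x : R => x * Cexp (Ci * theta)).
    { intros x. symmetry. apply polar_Cexp. }
    eapply rder_eq; [apply rder_mult; [apply rder_RtoC, (is_derive_id (K := R_AbsRing))|apply rder_const]|].
    unfold one; simpl. ring.
  - apply rder_ext with (fun y : R => rho * Cexp (Ci * y)).
    { intros x. symmetry. apply polar_Cexp. }
    eapply rder_eq; [apply rder_scal, E|]. ring.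
  - apply continuous_ext with (fun z : R * R => fst z * Cexp (Ci * snd z)).
    { intros z. symmetry. apply polar_Cexp. }
    apply cont_mult; [apply cont_RtoC, continuous_fst_RR|].
    apply cont_Cexp, cont_mult; [apply cont_const|apply cont_RtoC, continuous_snd_RR].
  - apply cont_Cexp, cont_mult; [apply cont_const|apply cont_RtoC, continuous_snd_RR].
Qed.

Lemma polar_hol_comp (g g' : C -> C) (F F' : R -> R -> C) (rho theta : R) :
  cder g (F rho theta) (g' (F rho theta)) -> continuous (T := C_UniformSpace) g' (F rho theta) ->
  polar_hol F F' rho theta ->
  polar_hol (fun x y => g (F x y)) (fun x y => F' x y * g' (F x y)) rho theta.
Proof.
  intros Hg Hg' [H1 [H2 [H3 H4]]]. split; [|split; [|split]]; cbv beta.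
  - apply (rder_comp_cder g (fun x => F x theta)); assumption.
  - eapply rder_eq; [apply (rder_comp_cder g (F rho)); eassumption|]. ring.
  - apply (continuous_comp (fun z : R * R => F (fst z) (snd z)) g); [exact H3|].
    apply (cder_continuous _ _ _ Hg).
  - apply cont_mult; [exact H4|].
    apply (continuous_comp (fun z : R * R => F (fst z) (snd z)) g'); assumption.
Qed.

Lemma polar_hol_log (rho theta : R) : (0 < rho)%R ->
  polar_hol (fun x y => (ln x, y)) (fun x _ => RtoC (/ x)) rho theta.
Proof.
  intros Hr. split; [|split; [|split]]; cbv beta.
  - apply rder_pair. split; simpl.
    + auto_derive; [exact Hr|]. field. lra.
    + apply (is_derive_const (V := R_NormedModule)).
  - apply rder_pair. split; simpl.
    + evar_last; [apply (is_derive_const (V := R_NormedModule))|]. unfold zero; simpl. ring.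
    + evar_last; [apply (is_derive_id (K := R_AbsRing))|]. unfold one; simpl. field. lra.
  - apply cont_pair; [|apply continuous_snd_RR].
    apply (continuous_Rcomp (fun z : R * R => fst z) ln); [apply continuous_fst_RR|apply continuous_ln, Hr].
  - apply cont_RtoC.
    apply (continuous_Rcomp (fun z : R * R => fst z) Rinv); [apply continuous_fst_RR|].
    apply continuous_Rinv. simpl. lra.
Qed.

Lemma polar_hol_power (s : C) (rho theta : R) : (0 < rho)%R ->
  polar_hol (fun x y => Cexp (s * (ln x, y)))
    (fun x _y => RtoC (/ x) * (s * Cexp (s * (ln x, _y)))) rho theta.
Proof.
  intros Hr.
  apply (polar_hol_comp (fun w => Cexp (s * w)) (fun w => s * Cexp (s * w)) (fun x y => (ln x, y)) (fun x _ => RtoC (/ x))).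
  - eapply cder_eq; [apply (cder_comp Cexp (fun w => s * w) (ln rho, theta)); [apply cder_Cexp|]|].
    + apply cder_scal, cder_id.
    + ring.
  - apply (cont_mult (T := C_UniformSpace)); [apply cont_const|apply cont_Cexp].
    apply (cont_mult (T := C_UniformSpace)); [apply cont_const|apply continuous_id].
  - apply polar_hol_log, Hr.
Qed.

Lemma continuous_Cmod_bounded (f : R -> C) (a b : R) : (a <= b)%R ->
  (forall x, a <= x <= b -> continuous f x)%R ->
  exists M, (0 <= M)%R /\ forall x, (a <= x <= b)%R -> (Cmod (f x) <= M)%R.
Proof.
  intros Hab Hf.
  destruct (continuity_ab_maj (fun x => Cmod (f x)) a b Hab) as [m [Hm _]].
  { intros c Hc. apply continuity_pt_filterlim. apply cont_Cmod, Hf, Hc. }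
  exists (Cmod (f m)). split; [apply Cmod_ge_0|exact Hm].
Qed.

Lemma crint_minus (f g : R -> C) (a b : R) (u v : C) :
  crint f a b u -> crint g a b v -> crint (fun x => f x - g x) a b (u - v).
Proof. apply (is_RInt_minus (V := C_R_NormedModule)). Qed.

(** For continuous phi and g an entire function of s. It covers both the circle of the Hankel
    contour, with phi the logarithm of the point, and (e^w - 1) / w, with phi the identity. *)
Definition exp_int (phi g : R -> C) (a b : R) (s : C) : C :=
  CRInt (fun t => Cexp (s * phi t) * g t) a b.

Section ExpInt.
Variables (phi g : R -> C) (a b : R).
Hypothesis Hab : (a <= b)%R.
Hypothesis Hphi : forall x, (a <= x <= b)%R -> continuous phi x.

Lemma exp_int_crint (h : R -> C) (s : C) : (forall x, (a <= x <= b)%R -> continuous h x) ->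
  crint (fun t => Cexp (s * phi t) * h t) a b (exp_int phi h a b s).
Proof.
  intros Hh. apply crint_CRInt. rewrite Rmin_left, Rmax_right by exact Hab. intros x Hx.
  apply cont_mult; [|auto]. apply cont_Cexp, cont_mult; [apply cont_const|auto].
Qed.

Lemma cder_exp_int (h : R -> C) (s : C) : (forall x, (a <= x <= b)%R -> continuous h x) ->
  cder (exp_int phi h a b) s (exp_int phi (fun t => phi t * h t) a b s).
Proof.
  intros Hh.
  destruct (continuous_Cmod_bounded phi a b Hab Hphi) as [M1 [HM1 B1]].
  destruct (continuous_Cmod_bounded (fun t => Cexp (s * phi t) * h t) a b Hab) as [M2 [HM2 B2]].
  { intros x Hx. apply cont_mult; [|auto]. apply cont_Cexp, cont_mult; [apply cont_const|auto]. }
  apply cder_eps. intros eps. set (K := ((b - a) * (M1 ^ 2 * exp M1 * M2))%R).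
  assert (HK : (0 <= K)%R).
  { apply Rmult_le_pos; [lra|]. apply Rmult_le_pos; [|exact HM2].
    apply Rmult_le_pos; [apply pow2_ge_0|left; apply exp_pos]. }
  assert (Hp : (0 < Rmin 1 (eps / (K + 1)))%R).
  { apply Rmin_pos; [lra|]. apply Rdiv_lt_0_compat; [apply eps|lra]. }
  exists (mkposreal _ Hp). simpl. intros s' Hs. set (d := s' - s) in *.
  destruct (Rlt_Rmin _ _ _ Hs) as [H1 H2].
  apply Rlt_div_r in H2; [|lra]. assert (Hd := Cmod_ge_0 d).
  apply Rle_trans with ((b - a) * (Cmod d ^ 2 * (M1 ^ 2 * exp M1 * M2)))%R.
  - apply (norm_crint_le (fun t => Cexp (s' * phi t) * h t - Cexp (s * phi t) * h t
              - d * (Cexp (s * phi t) * (phi t * h t))) _ a b); [exact Hab| |].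
    + intros t Ht.
      replace (Cexp (s' * phi t) * h t - Cexp (s * phi t) * h t - d * (Cexp (s * phi t) * (phi t * h t)))
        with ((Cexp (d * phi t) - 1 - d * phi t) * (Cexp (s * phi t) * h t)).
      2: { replace (s' * phi t) with (s * phi t + d * phi t) by (unfold d; ring).
           rewrite Cexp_plus. ring. }
      rewrite Cmod_mult. rewrite <- (Rmult_assoc (Cmod d ^ 2)%R).
      apply Rmult_le_compat; try apply Cmod_ge_0; [|apply B2, Ht].
      eapply Rle_trans; [apply Cmod_Cexp_taylor|]. rewrite Cmod_mult, Rpow_mult_distr, Rmult_assoc.
      apply Rmult_le_compat_l; [apply pow2_ge_0|]. specialize (B1 t Ht).
      assert (Q := Cmod_ge_0 (phi t)).
      apply Rmult_le_compat; [apply pow2_ge_0|left; apply exp_pos|apply pow_incr; lra|apply exp_le; nra].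
    + apply crint_minus; [apply crint_minus|apply crint_scal]; apply exp_int_crint; auto.
      intros x Hx. apply cont_mult; auto.
  - replace ((b - a) * (Cmod d ^ 2 * (M1 ^ 2 * exp M1 * M2)))%R with (Cmod d * K * Cmod d)%R by (unfold K; ring).
    apply Rmult_le_compat_r; [exact Hd|]. lra.
Qed.

Lemma hol2_exp_int (h : R -> C) (s : C) : (forall x, (a <= x <= b)%R -> continuous h x) ->
  hol2 (exp_int phi h a b) s.
Proof.
  intros Hh. exists (exp_int phi (fun t => phi t * h t) a b). apply filter_forall. intros y. split.
  - apply cder_exp_int, Hh.
  - eexists. apply cder_exp_int. intros x Hx. apply cont_mult; auto.
Qed.

End ExpInt.

(* (e^w - 1) / w, extended by 1 at w = 0 *)
Definition expm1_quot (w : C) : C := exp_int (fun t => RtoC t) (fun _ => 1) 0 1 w.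

Lemma hol2_expm1_quot w : hol2 expm1_quot w.
Proof.
  apply hol2_exp_int; [lra| |]; intros; [apply cont_RtoC, continuous_id|apply cont_const].
Qed.

Lemma expm1_quot_mult (w : C) : w * expm1_quot w = Cexp w - 1.
Proof.
  assert (H : crint (fun t : R => w * Cexp (t * w)) 0 1 (Cexp (1 * w) - Cexp (0 * w))).
  { apply (is_RInt_derive (V := C_R_CompleteNormedModule) (fun t : R => Cexp (t * w))).
    - intros. apply rder_Cexp_line.
    - intros x _. apply cont_mult; [apply cont_const|]. apply cont_Cexp.
      apply cont_mult; [|apply cont_const]. apply cont_RtoC. apply continuous_id. }
  rewrite Cmult_1_l, Cmult_0_l, Cexp_0 in H. rewrite <- (CRInt_unique _ _ _ _ H).
  symmetry. apply CRInt_unique.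
  apply (is_RInt_ext (V := C_R_NormedModule) (fun t : R => w * (Cexp (w * t) * 1))).
  { intros x _. rewrite Cmult_1_r, (Cmult_comm w (RtoC x)). reflexivity. }
  apply crint_scal.
  apply exp_int_crint; [lra| |]; intros; [apply cont_RtoC, continuous_id|apply cont_const].
Qed.

Lemma expm1_quot_0 : expm1_quot 0 = 1.
Proof.
  apply CRInt_unique. apply (is_RInt_ext (V := C_R_NormedModule) (fun t : R => RtoC 1)).
  { intros x _. rewrite Cmult_0_l, Cexp_0, Cmult_1_r. reflexivity. }
  evar_last; [apply (is_RInt_const (V := C_R_NormedModule))|].
  rewrite scal_R_Cmult. rewrite Rminus_0_r. ring.
Qed.

(** The modulus gives Re w = 0; with y = Im w, cos y = 1 then forces sin (y / 2) = 0 with |y / 2| <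
    pi. *)
Lemma Cexp_eq_1 (w : C) : (Rabs (Im w) < 2 * PI)%R -> Cexp w = 1 -> w = 0.
Proof.
  intros Hw E. assert (M := f_equal Cmod E). rewrite Cmod_Cexp, Cmod_1 in M.
  assert (R0 : Re w = 0%R) by (apply exp_inv; rewrite exp_0; exact M).
  rewrite Cexp_components, R0, exp_0 in E. injection E as E1 _. rewrite Rmult_1_l in E1.
  destruct w as [x y]. simpl in *. unfold Re, Im in *; simpl in *. subst x.
  assert (S : sin (y / 2) = 0%R).
  { assert (C2 := cos_2a_sin (y / 2)). replace (2 * (y / 2))%R with y in C2 by field. nra. }
  apply Rabs_def2 in Hw. assert (y = 0)%R; [|subst; reflexivity].
  destruct (Rtotal_order y 0) as [H|[H|H]]; [|exact H|].
  - assert (0 < sin (- (y / 2)))%R by (apply sin_gt_0; lra). rewrite sin_neg in H0. lra.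
  - assert (0 < sin (y / 2))%R by (apply sin_gt_0; lra). lra.
Qed.

Lemma expm1_quot_neq_0 (w : C) : (Rabs (Im w) < 2 * PI)%R -> expm1_quot w <> 0.
Proof.
  intros Hw E. assert (K := expm1_quot_mult w). rewrite E, Cmult_0_r in K.
  assert (w = 0).
  { apply Cexp_eq_1; [exact Hw|]. apply Ceq_minus. symmetry. exact K. }
  subst w. rewrite expm1_quot_0 in E. apply C1_nz, E.
Qed.

Lemma expm1_quot_eq (w : C) : w <> 0 -> expm1_quot w = (Cexp w - 1) / w.
Proof. intros H. rewrite <- expm1_quot_mult. field. exact H. Qed.

Lemma polar_hol_hol2 (g : C -> C) (F F' : R -> R -> C) (rho theta : R) :
  hol2 g (F rho theta) -> polar_hol F F' rho theta ->
  polar_hol (fun x y => g (F x y)) (fun x y => F' x y * C_derive g (F x y)) rho theta.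
Proof.
  intros Hg. apply polar_hol_comp.
  - apply hol1_cder, hol2_hol1, Hg.
  - apply hol1_continuous, hol2_C_derive, Hg.
Qed.

Lemma Cmod_polar_power (s : C) (x y : R) : (Rabs y <= PI)%R ->
  (Cmod (Cexp (s * (ln x, y))) <= Rpower x (Re s) * exp (Rabs (Im s) * PI))%R.
Proof.
  intros Hy. rewrite Cmod_Cexp. unfold Rpower. rewrite <- exp_plus. apply exp_le.
  unfold Re, Im. simpl. assert (- (snd s * y) <= Rabs (snd s) * PI)%R; [|lra].
  eapply Rle_trans; [apply Rle_abs|]. rewrite Rabs_Ropp, Rabs_mult.
  apply Rmult_le_compat_l; [apply Rabs_pos|exact Hy].
Qed.

Lemma irint_filterlim (D : R -> Prop) Fa (f : R -> C) (l : C) : left_end D Fa ->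
  irint f Fa infty l ->
  filterlim (fun ab => CRInt f (fst ab) (snd ab)) (filter_prod Fa infty) (locally l).
Proof.
  intros HL H P HP. assert (PF := left_end_proper _ _ HL). apply H in HP.
  unfold filtermap, filtermapi in *. revert HP. apply filter_imp.
  intros ab [y [Hy Py]]. rewrite (CRInt_unique _ _ _ _ Hy). exact Py.
Qed.

Lemma irint_eq_0 (D : R -> Prop) Fa (f : R -> C) (l : C) : left_end D Fa ->
  irint f Fa infty l ->
  (forall eps : posreal, filter_prod Fa infty (fun ab => (Cmod (CRInt f (fst ab) (snd ab)) < eps)%R)) ->
  l = 0.
Proof.
  intros HL H E. assert (PF := left_end_proper _ _ HL).
  assert (L := irint_filterlim _ _ _ _ HL H).
  apply (filterlim_locally_unique (V := C_NormedModule) (F := filter_prod Fa infty)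
    (fun ab => CRInt f (fst ab) (snd ab))); [exact L|].
  apply filterlim_C_0; [typeclasses eauto|exact E].
Qed.

(** * The beta integral *)

Definition beta_kernel (s : C) (x : R) : C := Rpowc x (s - 1) / RtoC (1 + x).

(** For x <= 1 the first term of [dom] suffices, since (1 + x)^(a+e) <= 2; for x > 1 the second
    does, since x / (1 + x) >= 1/2. The slack e is spent later on 1 - e^(-u) <= u^e with u = (1 + x)
    y. *)
Lemma beta_dom (a e x : R) : (0 < a)%R -> (0 <= e)%R -> (a + e < 1)%R -> (0 < x)%R ->
  (Rpower x (a - 1) * Rpower (1 + x) (e - 1) <= 2 * dom a (1 - a - e) x)%R.
Proof.
  intros Ha He Hae Hx. unfold dom.
  assert (P1 := Rpower_pos x (a - 1)). assert (P2 := Rpower_pos (1 + x) (- a - 1)).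
  assert (P3 := Rpower_pos (1 + x) (- (1 - a - e) - 1)).
  assert (P4 := Rpower_pos (1 + x) (e - 1)).
  assert (Q : (0 < Rpower x (a - 1) * Rpower (1 + x) (- a - 1))%R) by (apply Rmult_lt_0_compat; assumption).
  destruct (Rle_lt_dec x 1) as [H|H].
  - assert (E : (Rpower (1 + x) (e - 1) <= 2 * Rpower (1 + x) (- a - 1))%R).
    { replace (e - 1)%R with ((a + e) + (- a - 1))%R by ring. rewrite Rpower_plus.
      apply Rmult_le_compat_r; [lra|].
      apply Rle_trans with (Rpower (1 + x) 1); [apply Rle_Rpower; lra|]. rewrite Rpower_1 by lra.
      lra. }
    apply Rle_trans with (Rpower x (a - 1) * (2 * Rpower (1 + x) (- a - 1)))%R; [|lra].
    apply Rmult_le_compat_l; lra.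
  - assert (E : (Rpower x (a - 1) <= 2 * Rpower (1 + x) (a - 1))%R).
    { replace x with ((1 + x) * (x / (1 + x)))%R at 1 by (field; lra).
      assert (Hq : (/ 2 <= x / (1 + x) <= 1)%R).
      { split; [apply Rle_div_r; lra|apply Rle_div_l; lra]. }
      rewrite <- Rpower_mult_distr by lra. rewrite Rmult_comm.
      apply Rmult_le_compat_r; [left; apply Rpower_pos|].
      replace (a - 1)%R with (- (1 - a))%R by ring. rewrite Rpower_Ropp.
      assert (L : (/ 2 <= Rpower (x / (1 + x)) (1 - a))%R).
      { apply Rle_trans with (Rpower (/ 2) (1 - a)).
        - apply Rle_trans with (Rpower (/ 2) 1); [rewrite Rpower_1; lra|].
          unfold Rpower. apply exp_le. rewrite ln_Rinv by lra.
          assert (0 < ln 2)%R by (rewrite <- ln_1; apply ln_increasing; lra). nra.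
        - apply Rle_Rpower_l; lra. }
      rewrite <- (Rinv_inv 2). apply Rinv_le_contravar; lra. }
    apply Rle_trans with (2 * Rpower (1 + x) (a - 1) * Rpower (1 + x) (e - 1))%R; [apply Rmult_le_compat_r; lra|].
    rewrite Rmult_assoc, <- Rpower_plus.
    replace (a - 1 + (e - 1))%R with (- (1 - a - e) - 1)%R by ring. lra.
Qed.

Lemma Cmod_RtoC_pos (x : R) : (0 <= x)%R -> Cmod x = x.
Proof. intros. rewrite Cmod_R. apply Rabs_pos_eq. assumption. Qed.

Lemma RtoC_neq_0 (x : R) : x <> 0%R -> RtoC x <> 0.
Proof. intros H E. apply H, RtoC_inj, E. Qed.

Lemma Cmod_beta_kernel (s : C) (x : R) : (0 < x)%R ->
  Cmod (beta_kernel s x) = (Rpower x (Re s - 1) * Rpower (1 + x) (0 - 1))%R.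
Proof.
  intros Hx. unfold beta_kernel. rewrite Cmod_div by (apply RtoC_neq_0; lra).
  rewrite Cmod_Rpowc, Cmod_RtoC_pos by lra. rewrite Rminus_0_l, Rpower_Ropp, Rpower_1 by lra.
  reflexivity.
Qed.

Lemma continuous_beta_kernel (s : C) (x : R) : (0 < x)%R -> continuous (beta_kernel s) x.
Proof.
  intros Hx. apply cont_div; [apply continuous_Rpowc, Hx| |apply RtoC_neq_0; lra].
  apply cont_RtoC.
  apply (continuous_plus (V := R_NormedModule)); [apply continuous_const|apply continuous_id].
Qed.

Lemma beta_irint (s : C) : (0 < Re s < 1)%R ->
  exists l, irint (beta_kernel s) (at_right 0) infty l.
Proof.
  intros Hs.
  apply (irint_dominated (fun x => 0 < x)%R _ (Re s) (1 - Re s - 0) 2); try lra; [constructor| |].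
  - intros x Hx. apply continuous_beta_kernel, Hx.
  - intros x Hx. rewrite Cmod_beta_kernel by exact Hx. apply beta_dom; lra.
Qed.

(** The substitution x = t^2 turns the integrand into 2 / (1 + t^2), whence the primitive 2 atan
    (sqrt x). This is the reference value that the subtraction in the keyhole argument relies on. *)
Lemma beta_half : irint (beta_kernel (RtoC (/ 2))) (at_right 0) infty PI.
Proof.
  replace (RtoC PI) with (PI - 0) by ring.
  apply (irint_primitive (fun x => 0 < x)%R _ (fun x => RtoC (2 * atan (sqrt x)))).
  - constructor.
  - intros x Hx. eapply rder_eq.
    + apply rder_RtoC. auto_derive; [exact Hx|reflexivity].
    + unfold beta_kernel. rewrite <- RtoC_minus, Rpowc_RtoC, <- RtoC_div by lra. f_equal.
      replace (/ 2 - 1)%R with (- (/ 2))%R by field.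
      rewrite Rpower_Ropp, Rpower_sqrt by exact Hx.
      assert (S := sqrt_lt_R0 x Hx). assert (S2 := sqrt_sqrt x (Rlt_le _ _ Hx)).
      replace (sqrt x * (sqrt x * 1))%R with x by lra. unfold Rsqr in *. rewrite ?S2.
      field_simplify; [reflexivity| |]; lra.
  - intros x Hx. apply continuous_beta_kernel, Hx.
  - apply (filterlim_filter_le_1 (F := locally 0%R)).
    { intros P HP. unfold at_right, within. revert HP. apply filter_imp. auto. }
    replace (RtoC 0) with (RtoC (2 * atan (sqrt 0))) by (rewrite sqrt_0, atan_0; f_equal; ring).
    change (continuous (fun x => RtoC (2 * atan (sqrt x))) 0%R). apply cont_RtoC.
    apply (continuous_mult (K := R_AbsRing) (fun _ => 2%R)); [apply continuous_const|].
    apply continuous_Rcomp; [apply continuous_sqrt|].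
    apply continuity_pt_filterlim, derivable_continuous_pt, derivable_pt_atan.
  - apply filterlim_ext_loc with (fun x => RtoC (2 * (PI / 2 - atan (/ sqrt x)))).
    { exists 0%R. intros x Hx. rewrite atan_inv by (apply sqrt_lt_R0, Hx). f_equal. ring. }
    apply filterlim_locally. intros eps.
    assert (Cc : continuous (fun u => RtoC (2 * (PI / 2 - atan u))) 0).
    { apply cont_RtoC.
      apply (continuous_mult (K := R_AbsRing) (fun _ => 2%R)); [apply continuous_const|].
      apply (continuous_minus (V := R_NormedModule)); [apply continuous_const|].
      apply continuity_pt_filterlim, derivable_continuous_pt, derivable_pt_atan. }
    destruct (proj1 (filterlim_locally _ _) Cc eps) as [d Hd].
    exists ((/ d) * (/ d))%R. intros x Hx.
    replace (RtoC PI) with (RtoC (2 * (PI / 2 - atan 0))) by (rewrite atan_0; f_equal; field).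
    apply Hd. unfold ball; simpl. unfold AbsRing_ball, abs, minus, plus, opp; simpl.
    assert (D := Rinv_0_lt_compat d (cond_pos d)).
    assert (D2 : (0 < / d * / d)%R) by (apply Rmult_lt_0_compat; assumption).
    assert (S : (/ d < sqrt x)%R).
    { rewrite <- (sqrt_square (/ d)) by lra. apply sqrt_lt_1; lra. }
    rewrite Ropp_0, Rplus_0_r, Rabs_pos_eq by (left; apply Rinv_0_lt_compat; lra).
    rewrite <- (Rinv_inv d). apply Rinv_lt_contravar; [apply Rmult_lt_0_compat; lra|exact S].
Qed.

(** * The reflection formula *)

Lemma rder_opp (f : R -> C) (t : R) (l : C) : rder f t l -> rder (fun x => - f x) t (- l).
Proof. apply (is_derive_opp (V := C_R_NormedModule)). Qed.

(* (e^(sw) - e^(w/2)) / (1 - e^w).  Subtracting e^(w/2), for which the beta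
   integral is known, cancels the pole at w = 0, so no residue is needed. *)
Definition beta_polar (s w : C) : C :=
  (RtoC (/ 2) * expm1_quot (RtoC (/ 2) * w) - s * expm1_quot (s * w)) / expm1_quot w.

Lemma hol2_beta_polar (s w : C) : (Rabs (Im w) < 2 * PI)%R -> hol2 (beta_polar s) w.
Proof.
  intros Hw.
  assert (K : forall c, hol2 (fun w => c * expm1_quot (c * w)) w).
  { intros c. apply hol2_mult; [apply hol2_const|].
    apply (hol2_comp expm1_quot (fun w => c * w)); [|apply hol2_expm1_quot].
    apply hol2_mult; [apply hol2_const|apply hol2_id]. }
  apply hol2_div; [apply hol2_minus; apply K|apply hol2_expm1_quot|].
  apply expm1_quot_neq_0, Hw.
Qed.

Lemma beta_polar_eq (s w : C) : w <> 0 -> (Rabs (Im w) < 2 * PI)%R ->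
  beta_polar s w = (Cexp (s * w) - Cexp (RtoC (/ 2) * w)) / (1 - Cexp w).
Proof.
  intros H0 Hw. assert (N := expm1_quot_neq_0 w Hw).
  assert (E : 1 - Cexp w = - (w * expm1_quot w)) by (rewrite expm1_quot_mult; ring).
  rewrite E. unfold beta_polar.
  replace (Cexp (s * w) - Cexp (RtoC (/ 2) * w)) with
    ((s * w) * expm1_quot (s * w) - (RtoC (/ 2) * w) * expm1_quot (RtoC (/ 2) * w))
    by (rewrite !expm1_quot_mult; ring).
  field. auto.
Qed.

Lemma Cexp_log_polar (x y : R) : (0 < x)%R -> Cexp (ln x, y) = polar x y.
Proof. intros Hx. unfold Cexp, polar, Re, Im. simpl. rewrite exp_ln by exact Hx. reflexivity. Qed.

Lemma Cexp_mult_log (s : C) (x y : R) : Cexp (s * (ln x, y)) = Cexp (s * (Ci * y)) * Rpowc x s.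
Proof.
  unfold Rpowc. rewrite <- Cexp_plus, <- Cmult_plus_distr_l. f_equal. f_equal.
  apply injective_projections; simpl; ring.
Qed.

Lemma Cmod_ge_minus (a b : C) : (Cmod a - Cmod b <= Cmod (a - b))%R.
Proof.
  assert (T := Cmod_triangle (a - b) b). replace (a - b + b) with a in T by ring. lra.
Qed.

(** For w = ln x + i y the modulus of e^w is x, so |1 - e^w| >= |1 - x|; the numerator is bounded
    term by term. *)
Lemma polar_beta_bound (s : C) (x y : R) : (0 < x)%R -> x <> 1%R -> (Rabs y <= PI)%R ->
  (Cmod (beta_polar s (ln x, y)) <=
   (Rpower x (Re s) * exp (Rabs (Im s) * PI) + Rpower x (/ 2)) / Rabs (1 - x))%R.
Proof.
  intros Hx Hx1 Hy. assert (HPI := PI_RGT_0).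
  assert (Hl : ln x <> 0%R).
  { intros E. apply Hx1. rewrite <- (exp_ln x Hx), E, exp_0. reflexivity. }
  assert (D : (0 < Rabs (1 - x))%R) by (apply Rabs_pos_lt; lra).
  assert (DC : (Rabs (1 - x) <= Cmod (1 - Cexp (ln x, y)))%R).
  { apply Rabs_le.
    assert (M : Cmod (Cexp (ln x, y)) = x) by (rewrite Cmod_Cexp; simpl; apply exp_ln, Hx).
    assert (A := Cmod_ge_minus 1 (Cexp (ln x, y))). assert (B := Cmod_ge_minus (Cexp (ln x, y)) 1).
    rewrite Cmod_minus_sym in B. rewrite M, Cmod_1 in *. lra. }
  rewrite beta_polar_eq.
  - rewrite Cmod_div.
    2: { apply Cmod_gt_0. lra. }
    apply Rmult_le_compat; [apply Cmod_ge_0|left; apply Rinv_0_lt_compat; lra| |apply Rinv_le_contravar; assumption].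
    unfold Cminus. eapply Rle_trans; [apply Cmod_triangle|]. rewrite Cmod_opp.
    apply Rplus_le_compat.
    + apply Cmod_polar_power, Hy.
    + rewrite Cmod_Cexp. unfold Rpower, Re. simpl. right. f_equal. ring.
  - intros E. injection E. intros _ E1. exact (Hl E1).
  - simpl. lra.
Qed.

(** The polar Cauchy statement for [beta_polar], regular for |theta| < 2 pi. On both edges 1 - e^w
    becomes 1 + x, and e^(i pi / 2) - e^(- i pi / 2) = 2 i is the coefficient of the subtracted
    kernel. *)
Lemma beta_keyhole (s : C) (a b : R) : (0 < a <= b)%R ->
  CRInt (fun x => (Cexp (s * (Ci * PI)) - Cexp (s * (Ci * (- PI)%R))) * beta_kernel s x
                  - (2 * Ci) * beta_kernel (RtoC (/ 2)) x) a b =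
  Ci * (CRInt (fun y => beta_polar s (ln b, y)) (- PI)%R PI - CRInt (fun y => beta_polar s (ln a, y)) (- PI)%R PI).
Proof.
  intros Hab. assert (HPI := PI_RGT_0).
  set (F := fun x y : R => beta_polar s (ln x, y)).
  assert (PH : forall x y, (0 < x)%R -> (- (2 * PI) < y < 2 * PI)%R ->
     polar_hol F (fun x y => RtoC (/ x) * C_derive (beta_polar s) (ln x, y)) x y).
  { intros x y Hx Hy.
    apply (polar_hol_hol2 (beta_polar s) (fun x y => (ln x, y)) (fun x _ => RtoC (/ x))).
    - apply hol2_beta_polar. simpl. apply Rabs_def1; lra.
    - apply polar_hol_log, Hx. }
  assert (K := polar_cauchy F (fun x y => RtoC (/ x) * C_derive (beta_polar s) (ln x, y)) 0 (b + 1) a b (2 * PI)).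
  etransitivity.
  2: { apply K; try lra. intros x y Hx Hy. apply PH; [lra|exact Hy]. }
  assert (Cf : forall y x, (y = PI \/ y = - PI)%R -> (a <= x <= b)%R -> continuous (fun x => F x y / x) x).
  { intros y x Hy Hx. apply cont_div; [|apply cont_RtoC, continuous_id|apply RtoC_neq_0; lra].
    destruct (PH x y) as [H1 _]; [lra|destruct Hy; subst; lra|]. apply (rder_continuous _ _ _ H1). }
  apply CRInt_unique.
  apply (is_RInt_ext (V := C_R_NormedModule) (fun x => F x PI / x - F x (- PI)%R / x)).
  2: { apply crint_minus; apply crint_CRInt; rewrite Rmin_left, Rmax_right by lra; intros x Hx; apply Cf; auto.
       }
  rewrite Rmin_left, Rmax_right by lra. intros x Hx. unfold F.
  assert (W : forall y, (y = PI \/ y = - PI)%R -> beta_polar s (ln x, y) =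
     (Cexp (s * (Ci * y)) * Rpowc x s - Cexp (RtoC (/ 2) * (Ci * y)) * Rpowc x (RtoC (/ 2))) / RtoC (1 + x)).
  { intros y Hy. rewrite beta_polar_eq.
    - rewrite Cexp_log_polar by lra. rewrite !Cexp_mult_log. f_equal. f_equal.
      rewrite RtoC_plus. destruct Hy; subst y; [rewrite polar_pi|rewrite polar_opp_pi]; ring.
    - intros E. injection E. intros E1 _. destruct Hy; subst y; lra.
    - simpl. destruct Hy; subst y; apply Rabs_def1; lra. }
  rewrite !W by auto.
  assert (E1 : Cexp (RtoC (/ 2) * (Ci * PI)) = Ci).
  { rewrite Cexp_components. unfold Re, Im. simpl.
    replace (/ 2 * (0 * PI - 1 * 0) - 0 * (0 * 0 + 1 * PI))%R with 0%R by ring.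
    replace (/ 2 * (0 * 0 + 1 * PI) + 0 * (0 * PI - 1 * 0))%R with (PI / 2)%R by field.
    rewrite exp_0, cos_PI2, sin_PI2. apply injective_projections; simpl; ring. }
  assert (E2 : Cexp (RtoC (/ 2) * (Ci * (- PI)%R)) = - Ci).
  { rewrite Cexp_components. unfold Re, Im. simpl.
    replace (/ 2 * (0 * - PI - 1 * 0) - 0 * (0 * 0 + 1 * - PI))%R with 0%R by ring.
    replace (/ 2 * (0 * 0 + 1 * - PI) + 0 * (0 * - PI - 1 * 0))%R with (- (PI / 2))%R by field.
    rewrite exp_0, cos_neg, sin_neg, cos_PI2, sin_PI2. apply injective_projections; simpl; ring. }
  rewrite E1, E2. unfold beta_kernel. rewrite !Rpowc_minus, Rpowc_1 by lra.
  assert (N1 : RtoC x <> 0) by (apply RtoC_neq_0; lra).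
  assert (N2 : RtoC (1 + x) <> 0) by (apply RtoC_neq_0; lra).
  match goal with |- ?u = ?v => change (@eq C u v) end.
  field. auto.
Qed.

Lemma filter_Rpower_at_right (a M : R) (eps : posreal) : (0 < a)%R -> (0 <= M)%R ->
  at_right 0 (fun x => M * Rpower x a < eps)%R.
Proof.
  intros Ha HM. assert (He : (0 < eps / (M + 1))%R) by (apply Rdiv_lt_0_compat; [apply eps|lra]).
  generalize (Rpower_small_at_right a (mkposreal _ He) Ha). unfold at_right, within.
  apply filter_imp.
  intros x Hx Hx0. specialize (Hx Hx0). simpl in Hx. apply Rlt_div_r in Hx; [|lra].
  generalize (Rpower_pos x a). nra.
Qed.

Lemma filter_Rpower_infty (a M : R) (eps : posreal) : (0 < a)%R -> (0 <= M)%R ->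
  infty (fun x => M * Rpower x (- a) < eps)%R.
Proof.
  intros Ha HM. destruct (filter_Rpower_at_right a M eps Ha HM) as [d Hd].
  exists (/ d)%R. intros x Hx. assert (D := Rinv_0_lt_compat d (cond_pos d)).
  assert (P : (0 < / x)%R) by (apply Rinv_0_lt_compat; lra).
  replace (Rpower x (- a)) with (Rpower (/ x) a) by (unfold Rpower; rewrite ln_Rinv by lra; f_equal; ring).
  apply Hd; [|exact P]. apply ball_Rabs. rewrite Rminus_0_r, Rabs_pos_eq by lra.
  rewrite <- (Rinv_inv d). apply Rinv_lt_contravar; [|exact Hx].
  apply Rmult_lt_0_compat; lra.
Qed.

Lemma beta_circle_bound (s : C) (x K : R) : (0 < x)%R ->
  (forall y, Rabs y <= PI -> Cmod (beta_polar s (ln x, y)) <= K)%R ->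
  (Cmod (CRInt (fun y => beta_polar s (ln x, y)) (- PI)%R PI) <= 2 * PI * K)%R.
Proof.
  intros Hx HK. assert (HPI := PI_RGT_0).
  replace (2 * PI * K)%R with ((PI - - PI) * K)%R by ring.
  apply (norm_crint_le (fun y => beta_polar s (ln x, y))); [lra| |].
  - intros t Ht. apply HK. apply Rabs_le. lra.
  - apply crint_CRInt. rewrite Rmin_left, Rmax_right by lra. intros t Ht.
    apply (continuous_comp (fun y : R => (ln x, y)) (beta_polar s)).
    + apply cont_pair; [apply continuous_const|apply continuous_id].
    + apply hol1_continuous, hol2_hol1, hol2_beta_polar. simpl. apply Rabs_def1; lra.
Qed.

(** The numerator grows like x^(Re s) and x^(1/2), both exponents being below 1, while |1 - x| >= x
    / 2 for x > 2. *)
Lemma beta_circle_infty (s : C) (eps : posreal) : (0 < Re s < 1)%R ->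
  infty (fun x => Cmod (CRInt (fun y => beta_polar s (ln x, y)) (- PI)%R PI) < eps)%R.
Proof.
  intros Hs. assert (HPI := PI_RGT_0). set (M := exp (Rabs (Im s) * PI)).
  assert (HM : (0 < M)%R) by apply exp_pos.
  assert (He : (0 < eps / 2)%R) by (generalize (cond_pos eps); lra).
  assert (A := filter_Rpower_infty (1 - Re s) (2 * PI * (2 * M)) (mkposreal _ He)).
  assert (B := filter_Rpower_infty (/ 2) (2 * PI * 2) (mkposreal _ He)).
  specialize (A ltac:(lra) ltac:(nra)). specialize (B ltac:(lra) ltac:(lra)).
  assert (Cc : infty (fun x => 2 < x)%R) by (exists 2%R; auto).
  generalize (filter_and _ _ Cc (filter_and _ _ A B)). apply filter_imp. simpl.
  intros x [Hx [HA HB]].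
  eapply Rle_lt_trans; [apply (beta_circle_bound s x ((2 * M) * Rpower x (- (1 - Re s)) + 2 * Rpower x (- / 2))); [lra|]|lra].
  intros y Hy. eapply Rle_trans; [apply polar_beta_bound; lra|]. fold M.
  rewrite Rabs_left by lra.
  replace (- (1 - Re s))%R with (Re s + - (1))%R by ring. rewrite Rpower_plus.
  replace (- / 2)%R with (/ 2 + - (1))%R by field.
  rewrite Rpower_plus, Rpower_Ropp, Rpower_1 by lra.
  apply Rle_trans with ((Rpower x (Re s) * M + Rpower x (/ 2)) * (2 * / x))%R; [|right; ring].
  apply Rmult_le_compat_l.
  - generalize (Rpower_pos x (Re s)) (Rpower_pos x (/ 2)). nra.
  - apply Rle_trans with (/ (x / 2))%R; [apply Rinv_le_contravar; lra|right; field; lra].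
Qed.

Lemma beta_circle_0 (s : C) (eps : posreal) : (0 < Re s < 1)%R ->
  at_right 0 (fun x => Cmod (CRInt (fun y => beta_polar s (ln x, y)) (- PI)%R PI) < eps)%R.
Proof.
  intros Hs. assert (HPI := PI_RGT_0). set (M := exp (Rabs (Im s) * PI)).
  assert (HM : (0 < M)%R) by apply exp_pos.
  assert (He : (0 < eps / 2)%R) by (generalize (cond_pos eps); lra).
  assert (A := filter_Rpower_at_right (Re s) (2 * PI * (2 * M)) (mkposreal _ He)).
  assert (B := filter_Rpower_at_right (/ 2) (2 * PI * 2) (mkposreal _ He)).
  specialize (A ltac:(lra) ltac:(nra)). specialize (B ltac:(lra) ltac:(lra)).
  assert (Cc : at_right 0 (fun x => 0 < x < / 2)%R).
  { apply at_right_0_between. lra. }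
  generalize (filter_and _ _ Cc (filter_and _ _ A B)). apply filter_imp. simpl.
  intros x [Hx [HA HB]].
  eapply Rle_lt_trans; [apply (beta_circle_bound s x ((2 * M) * Rpower x (Re s) + 2 * Rpower x (/ 2))); [lra|]|lra].
  intros y Hy. eapply Rle_trans; [apply polar_beta_bound; lra|]. fold M.
  rewrite Rabs_right by lra.
  apply Rle_trans with ((Rpower x (Re s) * M + Rpower x (/ 2)) * 2)%R; [|right; ring].
  apply Rmult_le_compat_l.
  - generalize (Rpower_pos x (Re s)) (Rpower_pos x (/ 2)). nra.
  - rewrite <- (Rinv_inv 2). apply Rinv_le_contravar; lra.
Qed.

(** In the keyhole identity both circles vanish as a -> 0 and b -> oo, so the combination of the two
    beta integrals is 0; the one at 1/2 equals pi. *)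
Lemma beta_value (s l : C) : (0 < Re s < 1)%R -> irint (beta_kernel s) (at_right 0) infty l ->
  (Cexp (s * (Ci * PI)) - Cexp (s * (Ci * (- PI)%R))) * l = 2 * Ci * PI.
Proof.
  intros Hs Hl. apply Ceq_minus. assert (PF := at_right_proper_filter 0).
  eapply (irint_eq_0 (fun x => 0 < x)%R); [constructor| |].
  - apply irint_minus; try typeclasses eauto; apply irint_scal; try typeclasses eauto; [exact Hl|exact beta_half].
  - intros eps. assert (He : (0 < eps / 2)%R) by (generalize (cond_pos eps); lra).
    assert (A := beta_circle_0 s (mkposreal _ He) Hs).
    assert (B := beta_circle_infty s (mkposreal _ He) Hs).
    assert (Q : filter_prod (at_right 0) infty (fun ab : R * R =>
        (Cmod (CRInt (fun y => beta_polar s (ln (fst ab), y)) (- PI)%R PI) < eps / 2)%R /\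
        (Cmod (CRInt (fun y => beta_polar s (ln (snd ab), y)) (- PI)%R PI) < eps / 2)%R)).
    { econstructor; [exact A|exact B|]. simpl. auto. }
    generalize (filter_and _ _ (left_end_prod _ _ left_zero) Q). apply filter_imp.
    intros [a b] [[Hab HD] [H1 H2]]. simpl in *. rewrite beta_keyhole.
    + rewrite Cmod_mult, Cmod_Ci, Rmult_1_l. eapply Rle_lt_trans; [apply Cmod_triangle|].
      rewrite Cmod_opp. lra.
    + split; [apply HD; lra|exact Hab].
Qed.

(* The Fubini step Gamma(s) Gamma(1-s) = B(s, 1-s): the function
   y -> int x^(s-1) e^(-(1+x)y) / (1+x) dx has derivative - Gamma(s) y^(-s) e^(-y),
   equals B(s, 1-s) at 0 and vanishes at infinity. *)
Definition beta_exp (s y : C) (x : R) : C := beta_kernel s x * Cexp (- (RtoC (1 + x) * y)).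

Lemma continuous_beta_exp (s y : C) (x : R) : (0 < x)%R -> continuous (beta_exp s y) x.
Proof.
  intros Hx. apply cont_mult; [apply continuous_beta_kernel, Hx|].
  apply cont_Cexp, cont_opp, cont_mult; [|apply cont_const]. apply cont_RtoC.
  apply (continuous_plus (V := R_NormedModule)); [apply continuous_const|apply continuous_id].
Qed.

Lemma Cmod_beta_exp (s y : C) (x : R) : (0 < Re s < 1)%R -> (0 < x)%R -> (0 <= Re y)%R ->
  (Cmod (beta_exp s y x) <= 2 * exp (- Re y) * dom (Re s) (1 - Re s - 0) x)%R.
Proof.
  intros Hs Hx Hy. unfold beta_exp. rewrite Cmod_mult, Cmod_Cexp, Cmod_beta_kernel by exact Hx.
  replace (2 * exp (- Re y) * dom (Re s) (1 - Re s - 0) x)%R with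
    ((2 * dom (Re s) (1 - Re s - 0) x) * exp (- Re y))%R by ring.
  apply Rmult_le_compat.
  - left. apply Rmult_lt_0_compat; apply Rpower_pos.
  - left. apply exp_pos.
  - apply beta_dom; lra.
  - apply exp_le. unfold Re in *. simpl. nra.
Qed.

Definition beta_laplace (s y : C) : C := CRInt_gen (beta_exp s y) (at_right 0) infty.

Lemma beta_laplace_irint (s y : C) : (0 < Re s < 1)%R -> (0 <= Re y)%R ->
  irint (beta_exp s y) (at_right 0) infty (beta_laplace s y).
Proof.
  intros Hs Hy. assert (PF := at_right_proper_filter 0).
  destruct (irint_dominated (fun x => 0 < x)%R (at_right 0) (Re s) (1 - Re s - 0) (2 * exp (- Re y)) (beta_exp s y)) as [l Hl];
    try lra; [constructor| | | |].
  - generalize (exp_pos (- Re y)). lra.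
  - intros x Hx. apply continuous_beta_exp, Hx.
  - intros x Hx. apply Cmod_beta_exp; assumption.
  - unfold beta_laplace. rewrite (CRInt_gen_unique _ _ _ _ Hl). exact Hl.
Qed.

Lemma rder_beta_laplace (s : C) (y : R) : (0 < Re s < 1)%R -> (0 < y)%R ->
  rder (fun y : R => beta_laplace s y) y (- (Gamma_integral s * (Rpowc y (- s) * exp_neg y))).
Proof.
  intros Hs Hy. assert (PF := at_right_proper_filter 0).
  eapply rder_eq.
  - apply (rder_comp_cder (beta_laplace s) (fun y : R => RtoC y) y
       (- (Gamma_integral s * (Rpowc y (- s) * exp_neg y))) 1).
    2: { apply rder_RtoC, (is_derive_id (K := R_AbsRing)). }
    (* Within distance y / 2 of y the remainder keeps the decay e^(-x y / 2). The power 1 of 1 + x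
       is what ((1 + x) |h|)^2 leaves after division by the 1 + x of the kernel. *)
    destruct (exp_decay_dom (Re s) 1 (y / 2)) as [K [HK HB]]; [lra|lra|].
    apply (cder_irint (fun x => 0 < x)%R (at_right 0) (Re s) 1 K (y / 2) (beta_exp s)
       (fun x => - exp_neg y * (Rpowc x (s - 1) * exp_neg (y * x)))); try lra.
    + constructor.
    + intros y' Hy'. apply beta_laplace_irint; [exact Hs|].
      assert (T := re_le_Cmod (y' - y)). simpl in T. apply Rabs_le_between in T. unfold Re in *.
      simpl in *. lra.
    + replace (- (Gamma_integral s * (Rpowc y (- s) * exp_neg y))) with
        (- exp_neg y * (Rpowc y (- s) * Gamma_integral s)) by ring.
      apply irint_scal; try typeclasses eauto.
      apply (mellin_dilate exp_neg 0 y s Hy); [apply exp_decay_exp_neg; auto|lra].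
    + intros y' x Hy' Hx. set (h := y' - y) in *. set (v := RtoC (1 + x)).
      assert (Nv : v <> 0) by (apply RtoC_neq_0; lra).
      assert (Ev : Cmod v = (1 + x)%R) by (apply Cmod_RtoC_pos; lra).
      assert (E0 : exp_neg y * exp_neg (y * x) = Cexp (- (v * y))).
      { unfold exp_neg, v. rewrite <- RtoC_mult, <- RtoC_mult, <- RtoC_opp, Cexp_RtoC, <- exp_plus.
        f_equal. f_equal. ring. }
      replace (beta_exp s y' x - beta_exp s y x - h * (- exp_neg y * (Rpowc x (s - 1) * exp_neg (y * x)))) with
        (beta_kernel s x * Cexp (- (v * y)) * (Cexp (- (v * h)) - 1 - - (v * h))).
      2: { unfold beta_exp, beta_kernel. fold v.
           replace (h * (- exp_neg y * (Rpowc x (s - 1) * exp_neg (y * x)))) with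
             (- (h * Rpowc x (s - 1) * (exp_neg y * exp_neg (y * x)))) by ring.
           rewrite E0. replace (- (v * y')) with (- (v * y) + - (v * h)) by (unfold h; ring).
           rewrite Cexp_plus. field. exact Nv. }
      rewrite !Cmod_mult, Cmod_beta_kernel by exact Hx.
      assert (T := Cmod_Cexp_taylor (- (v * h))). rewrite Cmod_opp, Cmod_mult, Ev in T.
      rewrite Cmod_Cexp.
      replace (Re (- (v * y))) with (- ((1 + x) * y))%R by (unfold v, Re; simpl; ring).
      assert (Hh := Cmod_ge_0 h). assert (P1 := Rpower_pos x (Re s - 1)).
      assert (P2 := Rpower_pos (1 + x) (0 - 1)).
      assert (P3 := exp_pos (- ((1 + x) * y))).
      eapply Rle_trans; [apply Rmult_le_compat_l; [|exact T]|].
      { left. apply Rmult_lt_0_compat; [apply Rmult_lt_0_compat|]; assumption. }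
      apply Rle_trans with (Cmod h ^ 2 * (Rpower x (Re s - 1) * (Rpower (1 + x) 1 * exp (- (y / 2 * x)))))%R.
      2: { rewrite (Rmult_assoc (Cmod h ^ 2)%R).
           apply Rmult_le_compat_l; [apply pow2_ge_0|apply HB, Hx]. }
      rewrite Rminus_0_l, Rpower_Ropp, !Rpower_1 by lra.
      replace (Rpower x (Re s - 1) * / (1 + x) * exp (- ((1 + x) * y)) * (((1 + x) * Cmod h) ^ 2 * exp ((1 + x) * Cmod h)))%R
        with (Cmod h ^ 2 * (Rpower x (Re s - 1) * ((1 + x) * (exp (- ((1 + x) * y)) * exp ((1 + x) * Cmod h)))))%R
        by (field; lra).
      apply Rmult_le_compat_l; [apply pow2_ge_0|]. apply Rmult_le_compat_l; [lra|].
      apply Rmult_le_compat_l; [lra|].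
      rewrite <- exp_plus. apply exp_le. nra.
  - ring.
Qed.

(** 1 - e^(-u) is at most both u and 1, and the smaller of these is at most u^e for 0 < e <= 1. *)
Lemma one_minus_exp_le (u e : R) : (0 < u)%R -> (0 < e <= 1)%R -> (0 <= 1 - exp (- u) <= Rpower u e)%R.
Proof.
  intros Hu He. split.
  - assert (exp (- u) <= exp 0)%R by (apply exp_le; lra). rewrite exp_0 in H. lra.
  - assert (A := exp_pos (- u)). assert (B := exp_ineq1_le (- u)).
    destruct (Rle_lt_dec u 1) as [H|H].
    + apply Rle_trans with u; [lra|].
      assert (L : (ln u <= 0)%R) by (rewrite <- ln_1; apply ln_le; lra).
      rewrite <- (Rpower_1 u) at 1 by exact Hu. unfold Rpower. apply exp_le. nra.
    + apply Rle_trans with 1%R; [lra|]. apply Rle_trans with (exp 0); [rewrite exp_0; lra|].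
      unfold Rpower. apply exp_le. assert (0 <= ln u)%R by (rewrite <- ln_1; apply ln_le; lra). nra.
Qed.

Lemma Gamma_beta (s l : C) : (0 < Re s < 1)%R -> irint (beta_kernel s) (at_right 0) infty l ->
  Gamma_integral s * Gamma_integral (1 - s) = l.
Proof.
  intros Hs Hl. assert (PF := at_right_proper_filter 0).
  assert (H1 : irint (fun y : R => Gamma_integral s * (Rpowc y (1 - s - 1) * exp_neg y)) (at_right 0) infty
     (Gamma_integral s * Gamma_integral (1 - s))).
  { apply irint_scal; try typeclasses eauto. apply Gamma_integral_irint. unfold Re in *. simpl.
    lra. }
  assert (H2 : irint (fun y : R => Gamma_integral s * (Rpowc y (1 - s - 1) * exp_neg y)) (at_right 0) infty (0 - - l)).
  { apply (irint_primitive (fun x => 0 < x)%R _ (fun y : R => - beta_laplace s y)).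
    - constructor.
    - intros y Hy. eapply rder_eq.
      + apply rder_opp. apply rder_beta_laplace; assumption.
      + replace (1 - s - 1) with (- s) by ring. ring.
    - intros y Hy. apply cont_mult; [apply cont_const|].
      apply cont_mult; [apply continuous_Rpowc, Hy|].
      apply (exp_decay_exp_neg (fun x => 0 < x)%R); auto.
    (* Half of the gap 1 - Re s: as y -> 0 the difference from l is bounded by a multiple of y^e,
       while the x-integral with the extra (1 + x)^e still converges at infinity. *)
    - set (e := ((1 - Re s) / 2)%R).
      assert (N : forall y : R, (0 < y)%R -> (Cmod (beta_laplace s y - l) <= 2 * Rpower y e * (/ Re s + / (1 - Re s - e)))%R).
      { intros y Hy.
        apply (irint_norm (fun x => 0 < x)%R (at_right 0) (Re s) (1 - Re s - e) (2 * Rpower y e)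
          (fun x => beta_exp s y x - beta_kernel s x)); try (unfold e; lra).
        - constructor.
        - generalize (Rpower_pos y e). lra.
        - intros x Hx. unfold beta_exp.
          replace (beta_kernel s x * Cexp (- (RtoC (1 + x) * y)) - beta_kernel s x) with
            (beta_kernel s x * (Cexp (- (RtoC (1 + x) * y)) - 1)) by ring.
          rewrite <- RtoC_mult, <- RtoC_opp, Cexp_RtoC, <- RtoC_minus, Cmod_mult, Cmod_R, Rabs_minus_sym.
          rewrite Cmod_beta_kernel by exact Hx.
          assert (Q : (0 < (1 + x) * y)%R) by (apply Rmult_lt_0_compat; lra).
          assert (B := one_minus_exp_le ((1 + x) * y) e Q).
          rewrite Rabs_pos_eq by (apply B; unfold e; lra).
          eapply Rle_trans; [apply Rmult_le_compat_l; [|apply B; unfold e; lra]|].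
          { left. apply Rmult_lt_0_compat; apply Rpower_pos. }
          rewrite <- Rpower_mult_distr by lra.
          replace (Rpower x (Re s - 1) * Rpower (1 + x) (0 - 1) * (Rpower (1 + x) e * Rpower y e))%R with
            ((Rpower x (Re s - 1) * Rpower (1 + x) (e - 1)) * Rpower y e)%R.
          2: { replace (e - 1)%R with ((0 - 1) + e)%R by ring. rewrite Rpower_plus. ring. }
          replace (2 * Rpower y e * dom (Re s) (1 - Re s - e) x)%R with ((2 * dom (Re s) (1 - Re s - e) x) * Rpower y e)%R by ring.
          apply Rmult_le_compat_r; [left; apply Rpower_pos|]. apply beta_dom; unfold e; lra.
        - apply irint_minus; try typeclasses eauto; [|exact Hl].
          apply beta_laplace_irint; [exact Hs|simpl; lra]. }
      assert (Z : filterlim (fun y : R => beta_laplace s y - l) (at_right 0) (locally (RtoC 0))).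
      { apply filterlim_C_0; [typeclasses eauto|]. intros eps.
        assert (P : (0 < / Re s + / (1 - Re s - e))%R).
        { apply Rplus_lt_0_compat; apply Rinv_0_lt_compat; unfold e; lra. }
        generalize (filter_Rpower_at_right e (2 * (/ Re s + / (1 - Re s - e))) eps).
        intros G. specialize (G ltac:(unfold e; lra) ltac:(lra)). revert G.
        unfold at_right, within. apply filter_imp.
        intros y G Hy. eapply Rle_lt_trans; [apply N, Hy|]. specialize (G Hy). lra. }
      apply (filterlim_ext (fun y : R => - (beta_laplace s y - l) + - l)).
      { intros y. ring. }
      assert (E : - 0 + - l = - l) by ring.
      set (m := - l) in E at 2. change (locally (- l)) with (locally m). rewrite <- E. clear m E.
      apply (filterlim_comp_2 (G := locally (- 0)) (H := locally (- l)) (fun y : R => - (beta_laplace s y - l)) (fun _ => - l) Cplus).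
      + refine (filterlim_comp _ _ _ (fun y : R => beta_laplace s y - l) Copp _ (locally (RtoC 0)) _ Z _).
        apply (filterlim_opp (V := C_NormedModule)).
      + apply filterlim_const.
      + apply (filterlim_plus (V := C_NormedModule)).
    - apply filterlim_C_0; [typeclasses eauto|]. intros eps.
      set (M := (/ Re s + / (1 - Re s - 0))%R).
      assert (P : (0 < M)%R).
      { apply Rplus_lt_0_compat; apply Rinv_0_lt_compat; lra. }
      assert (He : (0 < eps / (2 * M))%R) by (apply Rdiv_lt_0_compat; [apply eps|lra]).
      assert (A := exp_small_infty 1 (mkposreal _ He) Rlt_0_1). simpl in A.
      assert (B : infty (fun y => 0 < y)%R) by (exists 0%R; auto).
      generalize (filter_and _ _ A B). apply filter_imp. intros y [HA HB].
      rewrite Cmod_opp. rewrite Rmult_1_l in HA. apply Rlt_div_r in HA; [|lra].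
      apply Rle_lt_trans with (2 * exp (- y) * M)%R; [|lra].
      apply (irint_norm (fun x => 0 < x)%R (at_right 0) (Re s) (1 - Re s - 0) (2 * exp (- y)) (beta_exp s y)); try lra.
      + constructor.
      + generalize (exp_pos (- y)). lra.
      + intros x Hx. apply (Cmod_beta_exp s y x Hs Hx). simpl. lra.
      + apply beta_laplace_irint; [exact Hs|simpl; lra]. }
  rewrite (irint_unique _ _ _ _ _ H1 H2). ring.
Qed.

(** * Hankel integrals *)

(* 2 i sin (pi s) *)
Definition exp_diff (s : C) : C := Cexp (s * (Ci * PI)) - Cexp (s * (Ci * (- PI)%R)).

Lemma hol2_exp_diff s : hol2 exp_diff s.
Proof.
  apply hol2_minus; apply (hol2_comp Cexp); try apply hol2_Cexp;
    apply hol2_mult; try apply hol2_id; apply hol2_const.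
Qed.

Lemma Cexp_Ci_PI : Cexp (Ci * PI) = - (1).
Proof.
  rewrite Cexp_components. unfold Re, Im. simpl.
  replace (0 * PI - 1 * 0)%R with 0%R by ring. replace (0 * 0 + 1 * PI)%R with PI by ring.
  rewrite exp_0, cos_PI, sin_PI. apply injective_projections; simpl; ring.
Qed.

Lemma Cexp_Ci_opp_PI : Cexp (Ci * (- PI)%R) = - (1).
Proof.
  rewrite Cexp_components. unfold Re, Im. simpl.
  replace (0 * - PI - 1 * 0)%R with 0%R by ring. replace (0 * 0 + 1 * - PI)%R with (- PI)%R by ring.
  rewrite exp_0, cos_neg, sin_neg, cos_PI, sin_PI. apply injective_projections; simpl; ring.
Qed.

Lemma exp_diff_succ s : exp_diff (s + 1) = - exp_diff s.
Proof.
  unfold exp_diff. rewrite !Cmult_plus_distr_r, !Cmult_1_l, !Cexp_plus, Cexp_Ci_PI, Cexp_Ci_opp_PI.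
  ring.
Qed.

Lemma exp_diff_INR (n : nat) : exp_diff (INR n) = 0.
Proof.
  induction n as [|n IH].
  - unfold exp_diff. simpl. rewrite !Cmult_0_l, Cexp_0. ring.
  - rewrite RtoC_INR_S, exp_diff_succ, IH. ring.
Qed.

Lemma Re_minus (a b : C) : Re (a - b) = (Re a - Re b)%R.
Proof. unfold Re. simpl. ring. Qed.

Lemma Re_plus (a b : C) : Re (a + b) = (Re a + Re b)%R.
Proof. reflexivity. Qed.

Lemma Re_RtoC (x : R) : Re (RtoC x) = x.
Proof. reflexivity. Qed.

Lemma reflection_strip (s : C) : (0 < Re s < 1)%R ->
  Gamma s * Gamma (1 - s) * exp_diff s = 2 * Ci * PI.
Proof.
  intros Hs. destruct (beta_irint s Hs) as [l Hl].
  rewrite !Gamma_pos; [|rewrite Re_minus, Re_RtoC; lra|lra].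
  rewrite (Gamma_beta s l Hs Hl), Cmult_comm. apply beta_value; assumption.
Qed.

Lemma nonpole_pos (s : C) : (0 < Re s)%R -> nonpole s.
Proof.
  intros Hs n E. rewrite E, <- RtoC_opp, Re_RtoC in Hs. generalize (pos_INR n). lra.
Qed.

Lemma positive_integer_dec (s : C) : {positive_integer s} + {~ positive_integer s}.
Proof.
  destruct (Req_dec_T (Im s) 0) as [H0|H0].
  (* Since up (n - 1) = n for an integer n, this is the only integer that Re s can equal. *)
  - destruct (Z_le_gt_dec 1 (up (Re s - 1))) as [H1|H1].
    + destruct (Req_dec_T (Re s) (IZR (up (Re s - 1)))) as [H2|H2].
      * left. exists (Z.to_nat (up (Re s - 1))). split; [lia|].
        rewrite INR_IZR_INZ, Z2Nat.id, <- H2 by lia. destruct s; unfold Re, Im in *; simpl in *.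
        subst. reflexivity.
      * right. intros [n [Hn ->]]. apply H2. rewrite Re_RtoC. rewrite INR_IZR_INZ. f_equal.
        apply tech_up; lra.
    + right. intros [n [Hn ->]]. rewrite Re_RtoC in H1. destruct (archimed (INR n - 1)) as [A _].
      assert (1 <= INR n)%R by (apply (le_INR 1), Hn). assert (0 < IZR (up (INR n - 1)))%R by lra.
      apply lt_IZR in H2. lia.
  - right. intros [n [Hn ->]]. apply H0. reflexivity.
Qed.

(** Continuity from the open strip: a discrepancy at s would persist on a disc around s, and that
    disc meets the strip to the left of s. *)
Lemma reflection_line (s : C) : Re s = 1%R -> s <> 1 ->
  Gamma s * Gamma (1 - s) * exp_diff s = 2 * Ci * PI.
Proof.
  intros Hs H1. set (F := fun z => Gamma z * Gamma (1 - z) * exp_diff z).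
  assert (H : hol2 F s).
  { apply hol2_mult; [apply hol2_mult|apply hol2_exp_diff].
    - apply hol2_Gamma, nonpole_pos. lra.
    - apply (hol2_comp Gamma (fun z => 1 - z)).
      + apply hol2_minus; [apply hol2_const|apply hol2_id].
      + apply hol2_Gamma. intros n E. apply H1. assert (E2 := f_equal Re E).
        rewrite Re_minus, <- RtoC_opp, !Re_RtoC in E2. assert (E3 : INR n = 0%R) by lra.
        rewrite E3 in E. replace s with (1 - (1 - s)) by ring. rewrite E. ring. }
  destruct (Ceq_dec (F s) (2 * Ci * PI)) as [E|N]; [exact E|exfalso].
  assert (L := hol1_neq_0 (fun z => F z - 2 * Ci * PI) s
     ltac:(apply hol2_hol1, hol2_minus; [exact H|apply hol2_const]) (fun E => N (proj2 (Ceq_minus _ _) E))).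
  destruct (proj1 (locally_C_Cmod s _) L) as [d Hd].
  (* The first entry keeps s - t in the strip, the second keeps it in the disc. *)
  set (t := Rmin (/ 2) (d / 2)).
  assert (Ht : (0 < t < 1)%R).
  { split; [apply Rmin_pos; [lra|generalize (cond_pos d); lra]|].
    eapply Rle_lt_trans; [apply Rmin_l|lra]. }
  apply (Hd (s - RtoC t)).
  - replace (s - t - s) with (- RtoC t) by ring. rewrite Cmod_opp, Cmod_RtoC_pos by lra.
    eapply Rle_lt_trans; [apply Rmin_r|generalize (cond_pos d); lra].
  - assert (Hst : (0 < Re (s - RtoC t) < 1)%R) by (rewrite Re_minus, Re_RtoC; lra).
    cbv beta. unfold F. rewrite (reflection_strip _ Hst). ring.
Qed.

(** With s = s' + 1 the product is the same at s and at s': Gamma s gains the factor s', Gamma (1 -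
    s) loses the factor -s', and [exp_diff] changes sign. *)
Lemma reflection (s : C) : (0 < Re s)%R -> ~ positive_integer s ->
  Gamma s * Gamma (1 - s) * exp_diff s = 2 * Ci * PI.
Proof.
  assert (K : forall n s, (0 < Re s <= INR (S n))%R -> ~ positive_integer s ->
     Gamma s * Gamma (1 - s) * exp_diff s = 2 * Ci * PI).
  { clear s. induction n as [|n IH]; intros s Hs Hp.
    - simpl in Hs. destruct (proj2 Hs) as [H|H]; [apply reflection_strip; lra|].
      apply reflection_line; [exact H|]. intros ->. apply Hp. exists 1%nat.
      split; [lia|reflexivity].
    - destruct (Rle_lt_dec (Re s) 1) as [H|H].
      { apply IH; [|exact Hp]. split; [lra|]. rewrite S_INR. generalize (pos_INR n). lra. }
      set (s' := s - 1). assert (Es : s = s' + 1) by (unfold s'; ring).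
      assert (Rs : (0 < Re s')%R) by (unfold s'; rewrite Re_minus, Re_RtoC; lra).
      assert (N : s' <> 0) by (apply nonpole_neq_0, nonpole_pos, Rs).
      assert (R' : Gamma s' * Gamma (1 - s') * exp_diff s' = 2 * Ci * PI).
      { apply IH.
        - split; [exact Rs|]. unfold s'. rewrite Re_minus, Re_RtoC. rewrite (S_INR (S n)) in Hs.
          lra.
        - intros [m [Hm E]]. apply Hp. exists (S m). split; [lia|]. rewrite RtoC_INR_S, <- E.
          exact Es. }
      assert (G : Gamma (1 - s') = - s' * Gamma (1 - s)).
      { replace (1 - s') with ((1 - s) + 1) by (unfold s'; ring). rewrite Gamma_succ.
        - unfold s'. ring.
        - intros E. apply N. unfold s'. replace (s - 1) with (- (1 - s)) by ring. rewrite E. ring. }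
      rewrite Es at 1 3. rewrite Gamma_succ, exp_diff_succ by exact N. rewrite <- R', G. ring. }
  intros Hs Hp. destruct (archimed (Re s)) as [A _].
  apply (K (Z.to_nat (up (Re s)))); [|exact Hp]. split; [exact Hs|].
  rewrite S_INR, INR_IZR_INZ, Z2Nat.id; [lra|]. apply le_IZR. lra.
Qed.

(** Away from the positive integers the reflection formula exhibits Gamma s as a factor of a nonzero
    number. At the integers, where sin (pi s) vanishes, the recursion from Gamma 1 = 1 is used. *)
Lemma Gamma_neq_0 (s : C) : (0 < Re s)%R -> Gamma s <> 0.
Proof.
  intros Hs. destruct (positive_integer_dec s) as [[n [Hn ->]]|H].
  - destruct n as [|n]; [lia|]. clear Hs Hn. induction n as [|n IH].
    + simpl. rewrite Gamma_pos, Gamma_integral_1 by (simpl; lra). apply C1_nz.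
    + rewrite RtoC_INR_S, Gamma_succ; [|apply RtoC_neq_0, not_0_INR; lia].
      apply Cmult_neq_0; [|exact IH]. apply RtoC_neq_0, not_0_INR. lia.
  - intros E. assert (R := reflection s Hs H). rewrite E, !Cmult_0_l in R.
    symmetry in R. revert R. repeat apply Cmult_neq_0.
    + apply RtoC_neq_0. lra.
    + apply Ci_nz.
    + apply RtoC_neq_0, PI_neq0.
Qed.

(** Away from 0 powers of x are harmless, so the exponent can be chosen freely. Hence the truncated
    transform converges for all s. *)
Lemma exp_decay_point (r b b' : R) (g : R -> C) : (0 < r)%R ->
  exp_decay (fun x => r <= x)%R b g -> exp_decay (fun x => r <= x)%R b' g.
Proof.
  intros Hr H. destruct (Rle_lt_dec b b') as [Hb|Hb].
  { apply exp_decay_weaken with b; [intros; lra|exact Hb|exact H]. }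
  destruct H as [Hg [c [K [Hc [HK HB]]]]]. split; [exact Hg|].
  exists c, (K * Rpower r (b' - b))%R. split; [exact Hc|].
  split; [apply Rmult_le_pos; [exact HK|left; apply Rpower_pos]|].
  intros x Hx. eapply Rle_trans; [apply HB, Hx|]. rewrite Rmult_assoc.
  apply Rmult_le_compat_l; [exact HK|].
  unfold exp_bound. rewrite <- Rmult_assoc. apply Rmult_le_compat_r; [left; apply exp_pos|].
  replace (- b)%R with ((b' - b) + - b')%R by ring. rewrite Rpower_plus.
  apply Rmult_le_compat_r; [left; apply Rpower_pos|].
  unfold Rpower. apply exp_le. assert (ln r <= ln x)%R by (apply ln_le; lra). nra.
Qed.

Lemma exp_decay_sub (D D' : R -> Prop) (b : R) (g : R -> C) :
  (forall x, D' x -> D x) -> exp_decay D b g -> exp_decay D' b g.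
Proof.
  intros HD [Hg [c [K [Hc [HK HB]]]]]. split; [auto|]. exists c, K. auto.
Qed.

(** On the circle z^(s-1) dz = i z^s dy, and z^s = e^(s (ln r + i y)) brings the integral to the
    form [exp_int]. *)
Definition hankel_circle (r : R) (f : C -> C) (s : C) : C :=
  exp_int (fun y : R => (ln r, y)) (fun y => Ci * f (polar r y)) (- PI) PI s.

(** On the edges z = -x, and z^(s-1) dz contributes e^(i pi s) x^(s-1) dx or e^(- i pi s) x^(s-1)
    dx, the direction e^(i theta) of the edge included. The lower edge is run inwards and is
    subtracted, which produces [exp_diff]. *)
Lemma hankel_split (r b : R) (f : C -> C) (s : C) : (0 < r)%R ->
  exp_decay (fun x => r <= x)%R b (fun x : R => f (- x)) ->
  (forall y, (- PI <= y <= PI)%R -> continuous (fun y => f (polar r y)) y) ->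
  hankel_integral r s f = / (RtoC (2 * PI) * Ci) *
    (exp_diff s * mellin (at_point r) (fun x : R => f (- x)) s + hankel_circle r f s).
Proof.
  intros Hr Hg Hc. assert (HPI := PI_RGT_0).
  assert (PF : ProperFilter (at_point r)) by apply at_point_filter.
  set (g := fun x : R => f (- x)) in *.
  assert (HL := left_point r Hr).
  (* Over [r, oo) any exponent below Re s is available, so s is unrestricted. *)
  assert (M := mellin_irint _ _ (Re s - 1) g s HL (exp_decay_point r b _ g Hr Hg) ltac:(lra)).
  assert (E : forall (th x : R), (th = PI \/ th = - PI)%R -> (r <= x)%R ->
      Cexp (s * (Ci * th)) * (Rpowc x (s - 1) * g x) =
      Cexp ((s - 1) * (ln x, th)) * f (polar x th) * polar 1 th).
  { intros th x Hth Hx. rewrite Cexp_mult_log.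
    replace ((s - 1) * (Ci * th)) with (s * (Ci * th) - Ci * th) by ring. rewrite Cexp_minus.
    unfold g.
    destruct Hth; subst th; [rewrite !polar_pi, Cexp_Ci_PI|rewrite !polar_opp_pi, Cexp_Ci_opp_PI];
      field; intros E; injection E; lra. }
  unfold hankel_integral. f_equal.
  assert (I3 : CRInt_gen (fun x : R => Cexp ((s - 1) * (ln x, PI)) * f (polar x PI) * polar 1 PI) (at_point r) infty =
     Cexp (s * (Ci * PI)) * mellin (at_point r) g s).
  { apply CRInt_gen_unique; try typeclasses eauto.
    apply (irint_scal _ _ (Cexp (s * (Ci * PI)))) in M. revert M. apply irint_ext with (1 := HL).
    intros x Hx. apply E; auto. }
  assert (I1 : CRInt_gen (fun x : R => Cexp ((s - 1) * (ln x, (- PI)%R)) * f (polar x (- PI)%R) * polar 1 (- PI)%R) infty (at_point r) =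
     - (Cexp (s * (Ci * (- PI)%R)) * mellin (at_point r) g s)).
  { apply CRInt_gen_unique; try typeclasses eauto.
    apply (irint_scal _ _ (Cexp (s * (Ci * (- PI)%R)))) in M.
    apply (is_RInt_gen_swap (V := C_R_NormedModule)); try typeclasses eauto. revert M.
    apply irint_ext with (1 := HL).
    intros x Hx. apply E; auto. }
  assert (I2 : CRInt (fun y : R => Cexp ((s - 1) * (ln r, y)) * f (polar r y) * (Ci * polar r y)) (- PI)%R PI = hankel_circle r f s).
  { apply CRInt_unique. unfold hankel_circle.
    apply (is_RInt_ext (V := C_R_NormedModule) (fun y : R => Cexp (s * (ln r, y)) * (Ci * f (polar r y)))).
    - intros y _. rewrite <- (Cexp_log_polar r y Hr).
      replace (s * (ln r, y)) with ((s - 1) * (ln r, y) + (ln r, y)) by ring. rewrite Cexp_plus.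
      match goal with |- ?u = ?v => change (@eq C u v) end. ring.
    - apply exp_int_crint; [lra| |].
      + intros y _. apply cont_pair; [apply continuous_const|apply continuous_id].
      + intros y Hy. apply cont_mult; [apply cont_const|apply Hc, Hy]. }
  rewrite I1, I2, I3. unfold exp_diff. ring.
Qed.

Lemma hol2_hankel (r b : R) (f : C -> C) (s : C) : (0 < r)%R ->
  exp_decay (fun x => r <= x)%R b (fun x : R => f (- x)) ->
  (forall y, (- PI <= y <= PI)%R -> continuous (fun y => f (polar r y)) y) ->
  hol2 (fun s => hankel_integral r s f) s.
Proof.
  intros Hr Hg Hc. assert (HPI := PI_RGT_0).
  apply hol2_ext_loc with (fun s => / (RtoC (2 * PI) * Ci) *
    (exp_diff s * mellin (at_point r) (fun x : R => f (- x)) s + hankel_circle r f s)).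
  { apply filter_forall. intros z. symmetry. apply hankel_split with b; assumption. }
  apply hol2_mult; [apply hol2_const|]. apply hol2_plus.
  - apply hol2_mult; [apply hol2_exp_diff|].
    apply (hol2_mellin (fun x => r <= x)%R _ (Re s - 1)); [constructor; exact Hr| |lra].
    apply exp_decay_point with b; assumption.
  - change (hol2 (exp_int (fun y : R => (ln r, y)) (fun y => Ci * f (polar r y)) (- PI) PI) s).
    apply hol2_exp_int; [lra| |].
    + intros y _. apply cont_pair; [apply continuous_const|apply continuous_id].
    + intros y Hy. apply cont_mult; [apply cont_const|apply Hc, Hy].
Qed.

(** A growth of at most rho^(-b) near 0 makes the circle of radius e contribute O(e^(Re s - b)),
    which vanishes for Re s > b. R0 bounds the punctured disc without singularities in which the
    circle is moved. *)
Lemma hankel_collapse (r R0 x0 b K : R) (f : C -> C) (F' : R -> R -> C) (s : C) :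
  (0 < r < R0)%R -> (0 < x0)%R -> (0 <= K)%R ->
  (forall x y, (0 < x < R0)%R -> polar_hol (fun x y => f (polar x y)) F' x y) ->
  (forall x y, (0 < x < x0)%R -> (Rabs y <= PI)%R -> (Cmod (f (polar x y)) <= K * Rpower x (- b))%R) ->
  exp_decay (fun x => 0 < x)%R b (fun x : R => f (- x)) -> (b < Re s)%R ->
  hankel_integral r s f = exp_diff s / (RtoC (2 * PI) * Ci) * mellin (at_right 0) (fun x : R => f (- x)) s.
Proof.
  intros Hr Hx0 HK HF HB Hg Hs. assert (HPI := PI_RGT_0).
  assert (PF := at_right_proper_filter 0).
  assert (Hcr : forall y, continuous (fun y => f (polar r y)) y).
  { intros y. destruct (HF r y Hr) as [_ [H2 _]]. apply (rder_continuous _ _ _ H2). }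
  assert (Hgr : exp_decay (fun x => r <= x)%R b (fun x : R => f (- x))).
  { apply exp_decay_sub with (fun x => 0 < x)%R; [intros; lra|exact Hg]. }
  rewrite (hankel_split r b f s) by (auto; lra).
  set (g := fun x : R => f (- x)) in *. set (h := fun x => Rpowc x (s - 1) * g x).
  assert (M0 : irint h (at_right 0) infty (mellin (at_right 0) g s)).
  { apply (mellin_irint (fun x => 0 < x)%R _ b); [constructor|exact Hg|exact Hs]. }
  assert (Mr : irint h (at_point r) infty (mellin (at_point r) g s)).
  { apply (mellin_irint (fun x => r <= x)%R _ b); [constructor; lra|exact Hgr|exact Hs]. }
  assert (Hh : forall x, (0 < x)%R -> continuous h x).
  { intros x Hx. apply cont_mult; [apply continuous_Rpowc, Hx|]. apply Hg, Hx. }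
  set (F := fun x y : R => Cexp (s * (ln x, y)) * f (polar x y)).
  assert (PH : forall x y, (0 < x < R0)%R -> polar_hol F
     (fun x y => RtoC (/ x) * (s * Cexp (s * (ln x, y))) * f (polar x y) + Cexp (s * (ln x, y)) * F' x y) x y).
  { intros x y Hx.
    apply (polar_hol_mult (fun x y => Cexp (s * (ln x, y))) (fun x y => RtoC (/ x) * (s * Cexp (s * (ln x, y))))
       (fun x y => f (polar x y)) F'); [apply polar_hol_power; lra|apply HF, Hx]. }
  assert (CF : forall x y, (0 < x < R0)%R -> continuous (F x) y).
  { intros x y Hx. destruct (PH x y Hx) as [_ [H2 _]]. apply (rder_continuous _ _ _ H2). }
  assert (CE : CRInt (F r) (- PI)%R PI = / Ci * hankel_circle r f s).
  { apply CRInt_unique. unfold hankel_circle.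
    apply (is_RInt_ext (V := C_R_NormedModule) (fun y : R => / Ci * (Cexp (s * (ln r, y)) * (Ci * f (polar r y))))).
    - intros y _. unfold F. match goal with |- ?u = ?v => change (@eq C u v) end. field.
      apply Ci_nz.
    - apply crint_scal, exp_int_crint; [lra| |].
      + intros y _. apply cont_pair; [apply continuous_const|apply continuous_id].
      + intros y Hy. apply cont_mult; [apply cont_const|apply Hcr]. }
  (* The circle of radius r is exchanged for the circle of radius e together with the two edges over
     [e, r]. *)
  assert (KE : forall e, (0 < e < r)%R -> exp_diff s * CRInt h e r = hankel_circle r f s - Ci * CRInt (F e) (- PI)%R PI).
  { intros e He.
    assert (A := polar_cauchy F (fun x y => RtoC (/ x) * (s * Cexp (s * (ln x, y))) * f (polar x y) + Cexp (s * (ln x, y)) * F' x y)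
                   0 R0 e r (2 * PI)).
    rewrite CE in A. replace (Ci * (/ Ci * hankel_circle r f s - CRInt (F e) (- PI)%R PI)) with
      (hankel_circle r f s - Ci * CRInt (F e) (- PI)%R PI) in A by (field; apply Ci_nz).
    rewrite <- A; try lra; [|intros x y Hx _; apply PH, Hx].
    assert (EQ : forall x th, (0 < x)%R -> (th = PI \/ th = - PI)%R -> F x th / x = Cexp (s * (Ci * th)) * h x).
    { intros x th Hx Hth. unfold F, h, g. rewrite Cexp_mult_log, Rpowc_minus, Rpowc_1 by exact Hx.
      replace (polar x th) with (- RtoC x) by (destruct Hth; subst th; [rewrite polar_pi|rewrite polar_opp_pi]; reflexivity).
      field. apply RtoC_neq_0. lra. }
    assert (I : crint h e r (CRInt h e r)).
    { apply crint_CRInt. rewrite Rmin_left, Rmax_right by lra. intros x Hx. apply Hh. lra. }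
    assert (J : forall th, (th = PI \/ th = - PI)%R -> CRInt (fun x => F x th / x) e r = Cexp (s * (Ci * th)) * CRInt h e r).
    { intros th Hth. apply CRInt_unique.
      apply (is_RInt_ext (V := C_R_NormedModule) (fun x => Cexp (s * (Ci * th)) * h x)).
      - rewrite Rmin_left, Rmax_right by lra. intros x Hx. symmetry. apply EQ; [lra|exact Hth].
      - apply crint_scal, I. }
    rewrite !J by auto. unfold exp_diff. ring. }
  assert (S0 : filterlim (fun e => Ci * CRInt (F e) (- PI)%R PI) (at_right 0) (locally (RtoC 0))).
  { apply filterlim_C_0; [typeclasses eauto|]. intros eps.
    set (Q := (2 * PI * (exp (Rabs (Im s) * PI) * K))%R).
    assert (HQ : (0 <= Q)%R).
    { apply Rmult_le_pos; [lra|]. apply Rmult_le_pos; [left; apply exp_pos|exact HK]. }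
    assert (A := filter_Rpower_at_right (Re s - b) Q eps ltac:(lra) HQ).
    assert (B : at_right 0 (fun x => 0 < x < Rmin x0 R0)%R).
    { apply at_right_0_between, Rmin_pos; lra. }
    generalize (filter_and _ _ A B). apply filter_imp. intros e [HA He].
    assert (He1 : (e < x0)%R) by (eapply Rlt_le_trans; [apply He|apply Rmin_l]).
    assert (He2 : (e < R0)%R) by (eapply Rlt_le_trans; [apply He|apply Rmin_r]).
    rewrite Cmod_mult, Cmod_Ci, Rmult_1_l. eapply Rle_lt_trans; [|exact HA].
    apply Rle_trans with ((PI - - PI) * (exp (Rabs (Im s) * PI) * K * Rpower e (Re s - b)))%R; [|unfold Q; right; ring].
    apply (norm_crint_le (F e)); [lra| |].
    - intros y Hy. assert (Hy' : (Rabs y <= PI)%R) by (apply Rabs_le; lra). unfold F.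
      rewrite Cmod_mult.
      apply Rle_trans with ((Rpower e (Re s) * exp (Rabs (Im s) * PI)) * (K * Rpower e (- b)))%R.
      + apply Rmult_le_compat; try apply Cmod_ge_0; [apply Cmod_polar_power, Hy'|apply HB; [lra|exact Hy']].
      + unfold Rminus. rewrite Rpower_plus. right. ring.
    - apply crint_CRInt. intros y _. apply CF. lra. }
  (* Both sides are limits of [exp_diff s] times the integral of h from e to b', the second after
     splitting at r. *)
  assert (E : exp_diff s * mellin (at_right 0) g s = hankel_circle r f s + exp_diff s * mellin (at_point r) g s).
  { apply (filterlim_locally_unique (V := C_NormedModule) (F := filter_prod (at_right 0) infty)
       (fun ab => exp_diff s * CRInt h (fst ab) (snd ab))).
    - refine (filterlim_comp _ _ _ (fun ab => CRInt h (fst ab) (snd ab)) (fun z => exp_diff s * z) _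
          (locally (mellin (at_right 0) g s)) _ _ _).
      + apply (irint_filterlim (fun x => 0 < x)%R); [constructor|exact M0].
      + apply (cont_mult (T := C_UniformSpace)); [apply cont_const|apply continuous_id].
    - apply filterlim_ext_loc with (fun ab => (hankel_circle r f s + - (Ci * CRInt (F (fst ab)) (- PI)%R PI)) + exp_diff s * CRInt h r (snd ab)).
      + assert (B : filter_prod (at_right 0) infty (fun ab => (0 < fst ab < r)%R /\ (r < snd ab)%R)).
        { apply (Filter_prod _ _ _ (fun a => 0 < a < r)%R (fun b => r < b)%R).
          - apply at_right_0_between. lra.
          - exists r. auto.
          - auto. }
        revert B. apply filter_imp. intros [e b'] [He Hb']. simpl in *.
        assert (CH : CRInt h e b' = CRInt h e r + CRInt h r b').
        { apply CRInt_unique. apply (is_RInt_Chasles (V := C_R_NormedModule) _ e r b');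
            apply crint_CRInt; rewrite Rmin_left, Rmax_right by lra; intros x Hx; apply Hh; lra. }
        rewrite CH, Cmult_plus_distr_l, KE by exact He. reflexivity.
      + set (m := hankel_circle r f s + exp_diff s * mellin (at_point r) g s).
        replace m with ((hankel_circle r f s + - 0) + exp_diff s * mellin (at_point r) g s) by (unfold m; ring).
        clear m.
        assert (PFr : ProperFilter (at_point r)) by apply at_point_filter.
        apply (filterlim_comp_2 (G := locally (hankel_circle r f s + - 0)) (H := locally (exp_diff s * mellin (at_point r) g s))).
        * apply (filterlim_comp_2 (G := locally (hankel_circle r f s)) (H := locally (- 0))).
          -- apply filterlim_const.
          -- refine (filterlim_comp _ _ _ (fun ab : R * R => Ci * CRInt (F (fst ab)) (- PI)%R PI) Copp _ (locally (RtoC 0)) _ _ _).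
             ++ refine (filterlim_comp _ _ _ fst (fun e => Ci * CRInt (F e) (- PI)%R PI) _ (at_right 0) _ _ S0).
                apply filterlim_fst.
             ++ apply (filterlim_opp (V := C_NormedModule)).
          -- apply (filterlim_plus (V := C_NormedModule)).
        * refine (filterlim_comp _ _ _ (fun ab : R * R => CRInt h r (snd ab)) (fun z => exp_diff s * z) _
            (locally (mellin (at_point r) g s)) _ _ _).
          -- intros P HP.
             apply (irint_filterlim (fun x => r <= x)%R _ _ _ (left_point r (proj1 Hr)) Mr) in HP.
             unfold filtermap in *. destruct HP as [Q R1 HQ HR HH].
             apply (Filter_prod _ _ _ (fun _ => True) R1); [apply filter_true|exact HR|].
             intros x y _ Hy. apply (HH r y HQ Hy).
          -- apply (cont_mult (T := C_UniformSpace)); [apply cont_const|apply continuous_id].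
        * apply (filterlim_plus (V := C_NormedModule)). }
  rewrite Cplus_comm, <- E. unfold Cdiv. ring.
Qed.

(** * The logarithm of (e^z - 1)/z *)

(** A change of radius costs at most a local bound on the radial derivative times the distance, and
    on the ray-crossing line rho = x continuity in the angle is assumed. Applied to [log_branch],
    which is given by integrals along rays. *)
Lemma continuous_of_partials (F F' : R -> R -> C) (A B T1 T2 x y : R) :
  (A < x < B)%R -> (T1 < y < T2)%R ->
  (forall u t, (A < u < B)%R -> (T1 < t < T2)%R -> rder (fun u => F u t) u (F' u t)) ->
  (forall u t, (A < u < B)%R -> (T1 < t < T2)%R -> continuous (fun z : R * R => F' (fst z) (snd z)) (u, t)) ->
  continuous (F x) y -> continuous (fun z : R * R => F (fst z) (snd z)) (x, y).
Proof.
  intros Hx Hy HF HF' Hc. apply continuous_Cmod_eps. intros eps.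
  set (M := (Cmod (F' x y) + 1)%R).
  assert (HM : (0 < M)%R) by (unfold M; generalize (Cmod_ge_0 (F' x y)); lra).
  assert (He : (0 < eps / 2)%R) by (generalize (cond_pos eps); lra).
  assert (L1 := proj1 (continuous_Cmod_eps _ _) (HF' x y Hx Hy) (mkposreal 1 Rlt_0_1)).
  assert (L2 := proj1 (continuous_Cmod_eps _ _) Hc (mkposreal _ He)).
  assert (L3 := locally_rectangle A B T1 T2 x y Hx Hy).
  destruct (filter_and _ _ L1 L3) as [d1 D1]. destruct L2 as [d2 D2]. simpl in *.
  assert (Hp : (0 < Rmin (Rmin d1 d2) (eps / 2 / M))%R).
  { apply Rmin_pos; [apply Rmin_pos; [apply d1|apply d2]|apply Rdiv_lt_0_compat; assumption]. }
  exists (mkposreal _ Hp). intros [u t] [Bu Bt]. simpl in *.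
  assert (U1 : ball x d1 u) by (eapply ball_le; [|exact Bu]; eapply Rle_trans; [apply Rmin_l|apply Rmin_l]).
  assert (U2 : ball y d1 t) by (eapply ball_le; [|exact Bt]; eapply Rle_trans; [apply Rmin_l|apply Rmin_l]).
  assert (U3 : ball y d2 t) by (eapply ball_le; [|exact Bt]; eapply Rle_trans; [apply Rmin_l|apply Rmin_r]).
  assert (U4 : ball x (eps / 2 / M) u) by (eapply ball_le; [|exact Bu]; apply Rmin_r).
  specialize (D2 t U3).
  assert (Seg : forall v, (Rmin x u <= v <= Rmax x u)%R -> (Cmod (F' v t) <= M)%R /\ (A < v < B)%R /\ (T1 < t < T2)%R).
  { intros v Hv. assert (Bv : ball x d1 v).
    { unfold ball in *; simpl in *. unfold AbsRing_ball, abs, minus, plus, opp in *; simpl in *.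
      apply Rabs_def2 in U1.
      apply Rabs_def1; revert Hv; unfold Rmin, Rmax; destruct (Rle_dec x u); lra. }
    destruct (D1 (v, t) (conj Bv U2)) as [Z1 Z2]. simpl in *. split; [|exact Z2].
    assert (T := Cmod_triangle (F' v t - F' x y) (F' x y)).
    replace (F' v t - F' x y + F' x y) with (F' v t) in T by ring. unfold M. lra. }
  assert (Dif : (Cmod (F u t - F x t) <= M * Rabs (u - x))%R).
  { assert (I : crint (fun v => F' v t) x u (F u t - F x t)).
    { apply (is_RInt_derive (V := C_R_CompleteNormedModule) (fun v => F v t)).
      - intros v Hv. destruct (Seg v Hv) as [_ [S1 S2]]. apply HF; assumption.
      - intros v Hv. destruct (Seg v Hv) as [_ [S1 S2]].
        apply (continuous_comp (fun v => (v, t)) (fun z : R * R => F' (fst z) (snd z))).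
        + apply filterlim_locally. intros e. exists e. intros w Hw.
          split; [exact Hw|apply ball_center].
        + apply HF'; assumption. }
    destruct (Rle_lt_dec x u) as [H|H].
    - rewrite Rabs_pos_eq by lra. rewrite Rmult_comm.
      apply (norm_crint_le (fun v => F' v t)); [exact H| |exact I].
      intros v Hv. apply Seg. rewrite Rmin_left, Rmax_right by lra. exact Hv.
    - rewrite Rabs_left by lra. apply (is_RInt_swap (V := C_R_NormedModule)) in I.
      rewrite <- Cmod_opp. replace (- (u - x))%R with (x - u)%R by ring. rewrite Rmult_comm.
      apply (norm_crint_le (fun v => F' v t)); [lra| |exact I].
      intros v Hv. apply Seg. rewrite Rmin_right, Rmax_left by lra. exact Hv. }
  replace (F u t - F x y) with ((F u t - F x t) + (F x t - F x y)) by ring.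
  eapply Rle_lt_trans; [apply Cmod_triangle|].
  unfold ball in U4; simpl in U4. unfold AbsRing_ball, abs, minus, plus, opp in U4; simpl in U4.
  apply Rlt_div_r in U4; [|exact HM]. unfold Rminus in Dif. lra.
Qed.

Definition expm1_quot' (w : C) : C := exp_int (fun t => RtoC t) (fun t => t * 1) 0 1 w.

Lemma cder_expm1_quot w : cder expm1_quot w (expm1_quot' w).
Proof.
  apply (cder_exp_int (fun t => RtoC t) 0 1); [lra| |]; intros; [apply cont_RtoC, continuous_id|apply cont_const].
Qed.

Lemma hol2_expm1_quot' w : hol2 expm1_quot' w.
Proof.
  apply hol2_exp_int; [lra| |]; intros; [apply cont_RtoC, continuous_id|].
  apply cont_mult; [apply cont_RtoC, continuous_id|apply cont_const].
Qed.

(* the logarithmic derivative of (e^w - 1) / w *)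
Definition log_deriv (w : C) : C := expm1_quot' w / expm1_quot w.

Lemma hol2_log_deriv w : (Rabs (Im w) < 2 * PI)%R -> hol2 log_deriv w.
Proof.
  intros Hw.
  apply hol2_div; [apply hol2_expm1_quot'|apply hol2_expm1_quot|apply expm1_quot_neq_0, Hw].
Qed.

(** Differentiating w q(w) = e^w - 1 gives q + w q' = e^w. *)
Lemma log_deriv_eq w : (Rabs (Im w) < 2 * PI)%R -> w <> 0 ->
  log_deriv w = Cexp w / (Cexp w - 1) - / w.
Proof.
  intros Hw H0. assert (N := expm1_quot_neq_0 w Hw).
  assert (D : expm1_quot w + w * expm1_quot' w = Cexp w).
  { apply (cder_unique (fun w => Cexp w - 1) w).
    - apply cder_ext_loc with (fun w => w * expm1_quot w).
      + apply filter_forall. intros y. apply expm1_quot_mult.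
      + eapply cder_eq; [apply cder_mult; [apply cder_id|apply cder_expm1_quot]|]. cbv beta. ring.
    - eapply cder_eq; [apply cder_minus; [apply cder_Cexp|apply cder_const]|]. ring. }
  unfold log_deriv. rewrite <- expm1_quot_mult, <- D. field. auto.
Qed.

Lemma Im_RtoC_mult (t : R) (z : C) : Im (t * z) = (t * Im z)%R.
Proof. apply im_scal_l. Qed.

Lemma Rabs_mult_le_l (t y c : R) : (0 <= t <= 1)%R -> (Rabs y < c)%R -> (Rabs (t * y) < c)%R.
Proof.
  intros Ht Hy. rewrite Rabs_mult, (Rabs_pos_eq t) by lra. generalize (Rabs_pos y). nra.
Qed.

Lemma continuous_log_deriv_ray (z : C) (t : R) : (Rabs (Im (t * z)) < 2 * PI)%R ->
  continuous (fun t : R => z * log_deriv (t * z)) t.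
Proof.
  intros Ht. apply cont_mult; [apply cont_const|].
  apply (continuous_comp (fun t : R => t * z) log_deriv).
  - apply cont_mult; [apply cont_RtoC, continuous_id|apply cont_const].
  - apply hol1_continuous, hol2_hol1, hol2_log_deriv, Ht.
Qed.

(** At t = 0 the integrand of [log_branch] divides by 0. It agrees with the regular function
    [log_deriv] on the open interval, and the integral ignores the end points. *)
Lemma log_branch_crint (z : C) : (Rabs (Im z) < 2 * PI)%R ->
  crint (fun t : R => z * log_deriv (t * z)) 0 1 (log_branch z).
Proof.
  intros Hz.
  assert (I : crint (fun t : R => z * log_deriv (t * z)) 0 1 (CRInt (fun t : R => z * log_deriv (t * z)) 0 1)).
  { apply crint_CRInt. rewrite Rmin_left, Rmax_right by lra. intros t Ht.
    apply continuous_log_deriv_ray. rewrite Im_RtoC_mult. apply Rabs_mult_le_l; assumption. }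
  assert (E : log_branch z = CRInt (fun t : R => z * log_deriv (t * z)) 0 1); [|rewrite E; exact I].
  unfold log_branch. apply CRInt_unique.
  revert I. apply (is_RInt_ext (V := C_R_NormedModule)). rewrite Rmin_left, Rmax_right by lra.
  intros t Ht.
  destruct (Ceq_dec z 0) as [->|N]; [rewrite !Cmult_0_l; reflexivity|].
  rewrite log_deriv_eq; [reflexivity| |].
  - rewrite Im_RtoC_mult. apply Rabs_mult_le_l; [lra|assumption].
  - apply Cmult_neq_0; [apply RtoC_neq_0; lra|exact N].
Qed.

(** The first-order zero at the origin cancels the pole of e^(kz) / (e^(kz) - 1), so the integrand
    of I(s,k) stays bounded there. *)
Lemma log_branch_small : exists (d : posreal) (K : R), (0 <= K)%R /\
  forall z, (Cmod z < d)%R -> (Cmod (log_branch z) <= K * Cmod z)%R.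
Proof.
  assert (HPI := PI_RGT_0).
  assert (Z : (Rabs (Im 0) < 2 * PI)%R) by (simpl; rewrite Rabs_R0; lra).
  assert (Cc := hol1_continuous _ _ (hol2_hol1 _ _ (hol2_log_deriv 0 Z))).
  destruct (proj1 (locally_C_Cmod 0 _) (proj1 (continuous_Cmod_eps _ _) Cc (mkposreal 1 Rlt_0_1))) as [d Hd].
  simpl in Hd. set (K := (Cmod (log_deriv 0) + 1)%R).
  assert (HK : (0 <= K)%R) by (unfold K; generalize (Cmod_ge_0 (log_deriv 0)); lra).
  assert (Hp : (0 < Rmin d PI)%R) by (apply Rmin_pos; [apply d|lra]).
  exists (mkposreal _ Hp), K. split; [exact HK|]. simpl. intros z Hz.
  destruct (Rlt_Rmin _ _ _ Hz) as [H1 H2].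
  assert (I := log_branch_crint z). replace (K * Cmod z)%R with ((1 - 0) * (Cmod z * K))%R by ring.
  apply (norm_crint_le (fun t : R => z * log_deriv (t * z))); [lra| |apply I; generalize (Im_le_Cmod z); lra].
  intros t Ht. rewrite Cmod_mult. apply Rmult_le_compat_l; [apply Cmod_ge_0|].
  assert (B : (Cmod (t * z - 0) < d)%R).
  { replace (t * z - 0) with (t * z) by ring. rewrite Cmod_mult, Cmod_RtoC_pos by lra.
    generalize (Cmod_ge_0 z). nra. }
  specialize (Hd _ B). assert (T := Cmod_triangle (log_deriv (t * z) - log_deriv 0) (log_deriv 0)).
  replace (log_deriv (t * z) - log_deriv 0 + log_deriv 0) with (log_deriv (t * z)) in T by ring.
  unfold K. lra.
Qed.

(** With L(t) the integral up to t, e^(-L(t)) times the quotient at t z has derivative 0 along the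
    ray and equals 1 at t = 0. *)
Lemma Cexp_log_branch (z : C) : (Rabs (Im z) < 2 * PI)%R -> Cexp (log_branch z) = expm1_quot z.
Proof.
  intros Hz. set (h := fun t : R => z * log_deriv (t * z)).
  (* A ray prolonged beyond [0, 1] on both sides but still inside the strip makes the derivatives at
     t = 0 and t = 1 two-sided. *)
  assert (Hd : exists d, (1 < d)%R /\ (d * Rabs (Im z) < 2 * PI)%R).
  { exists (1 + (2 * PI - Rabs (Im z)) / (2 * (1 + Rabs (Im z))))%R. assert (A := Rabs_pos (Im z)).
    split.
    - assert (0 < (2 * PI - Rabs (Im z)) / (2 * (1 + Rabs (Im z))))%R by (apply Rdiv_lt_0_compat; lra).
      lra.
    - rewrite Rmult_plus_distr_r, Rmult_1_l.
      assert ((2 * PI - Rabs (Im z)) / (2 * (1 + Rabs (Im z))) * Rabs (Im z) <= (2 * PI - Rabs (Im z)) / 2)%R; [|lra].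
      apply Rle_trans with ((2 * PI - Rabs (Im z)) / 2 * (Rabs (Im z) / (1 + Rabs (Im z))))%R; [right; field; lra|].
      rewrite <- (Rmult_1_r ((2 * PI - Rabs (Im z)) / 2)) at 2. apply Rmult_le_compat_l; [lra|].
      apply Rle_div_l; lra. }
  destruct Hd as [d [Hd1 Hd2]].
  assert (HT : forall t, (- d <= t <= d)%R -> (Rabs (Im (t * z)) < 2 * PI)%R).
  { intros t Ht. rewrite Im_RtoC_mult, Rabs_mult. eapply Rle_lt_trans; [|exact Hd2].
    apply Rmult_le_compat_r; [apply Rabs_pos|]. apply Rabs_le. lra. }
  assert (D : forall t, (0 <= t <= 1)%R -> rder (fun t => CRInt h 0 t) t (h t)).
  { intros t Ht. apply (is_derive_RInt (V := C_R_NormedModule) h (fun t => CRInt h 0 t) 0 t).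
    - assert (Ht' : (- d < t < d)%R) by lra. generalize (locally_between _ _ _ Ht').
      apply filter_imp. intros y Hy.
      apply crint_CRInt. intros x Hx. apply continuous_log_deriv_ray, HT.
      revert Hx; unfold Rmin, Rmax; destruct (Rle_dec 0 y); lra.
    - apply continuous_log_deriv_ray, HT. lra. }
  assert (E : forall t, (0 <= t <= 1)%R -> rder (fun t : R => Cexp (- CRInt h 0 t) * expm1_quot (t * z)) t 0).
  { intros t Ht. assert (N : expm1_quot (t * z) <> 0) by (apply expm1_quot_neq_0, HT; lra).
    eapply rder_eq.
    - apply rder_mult.
      + apply (rder_comp_cder Cexp (fun t => - CRInt h 0 t)); [apply cder_Cexp|].
        apply rder_opp, D, Ht.
      + apply (rder_comp_cder expm1_quot (fun t : R => t * z)); [apply cder_expm1_quot|].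
        apply rder_mult; [apply rder_RtoC, (is_derive_id (K := R_AbsRing))|apply rder_const].
    - unfold h, log_deriv, one; simpl. field. exact N. }
  assert (I : crint (fun _ => 0) 0 1 (Cexp (- CRInt h 0 1) * expm1_quot (1 * z) - Cexp (- CRInt h 0 0) * expm1_quot (0 * z))).
  { apply (is_RInt_derive (V := C_R_CompleteNormedModule) (fun t : R => Cexp (- CRInt h 0 t) * expm1_quot (t * z)) (fun _ => RtoC 0));
      rewrite Rmin_left, Rmax_right by lra; intros t Ht; [apply E, Ht|apply cont_const]. }
  assert (I0 : crint (fun _ => 0) 0 1 0).
  { assert (I0 := crint_scal 0 _ _ _ _ I). rewrite Cmult_0_l in I0. revert I0.
    apply (is_RInt_ext (V := C_R_NormedModule)). intros x _. apply Cmult_0_l. }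
  assert (EQ := CRInt_unique _ _ _ _ I). rewrite (CRInt_unique _ _ _ _ I0) in EQ.
  assert (P0 : CRInt h 0 0 = RtoC 0) by (apply CRInt_unique; apply (is_RInt_point (V := C_R_NormedModule))).
  rewrite P0, Cmult_0_l, Cmult_1_l, expm1_quot_0, Copp_0, Cexp_0 in EQ.
  assert (P1 : CRInt h 0 1 = log_branch z) by (apply CRInt_unique, log_branch_crint, Hz).
  rewrite P1 in EQ.
  rewrite Cexp_opp in EQ. assert (N := Cexp_neq_0 (log_branch z)).
  symmetry. apply Ceq_minus. replace (expm1_quot z - Cexp (log_branch z)) with
    (Cexp (log_branch z) * (/ Cexp (log_branch z) * expm1_quot z - 1 * 1)) by (field; exact N).
  rewrite <- EQ. ring.
Qed.

Lemma exp_neg_lt_1 (x : R) : (0 < x)%R -> (0 < 1 - exp (- x))%R.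
Proof. intros Hx. assert (exp (- x) < exp 0)%R by (apply exp_increasing; lra). rewrite exp_0 in H.
lra. Qed.

(** The exponential determines the logarithm up to a multiple of 2 pi i; the imaginary part is 0
    because the logarithmic derivative is real along the negative axis. *)
Lemma log_branch_neg (x : R) : (0 < x)%R -> log_branch (- x) = ln ((1 - exp (- x)) / x).
Proof.
  intros Hx. assert (HPI := PI_RGT_0).
  assert (Hi : (Rabs (Im (- RtoC x)) < 2 * PI)%R) by (rewrite <- RtoC_opp, im_RtoC, Rabs_R0; lra).
  assert (P := exp_neg_lt_1 x Hx).
  assert (E := Cexp_log_branch (- x) Hi).
  assert (I0 : Im (log_branch (- x)) = 0%R).
  { assert (I := proj2 (proj1 (crint_pair _ _ _ _) (log_branch_crint _ Hi))).
    rewrite <- (is_RInt_unique _ _ _ _ I). apply is_RInt_unique.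
    apply (is_RInt_ext (fun _ => 0%R)).
    - rewrite Rmin_left, Rmax_right by lra. intros t Ht. rewrite log_deriv_eq.
      + rewrite <- RtoC_opp, <- RtoC_mult, Cexp_RtoC.
        assert (0 < t * x)%R by (apply Rmult_lt_0_compat; lra).
        assert (N1 : (t * - x <> 0)%R) by nra. assert (N2 := exp_neg_lt_1 (t * x) H).
        replace (- (t * x))%R with (t * - x)%R in N2 by ring.
        rewrite <- RtoC_minus, <- RtoC_div, <- RtoC_inv, <- RtoC_minus, <- RtoC_mult by lra.
        reflexivity.
      + rewrite Im_RtoC_mult. apply Rabs_mult_le_l; [lra|exact Hi].
      + apply Cmult_neq_0; [apply RtoC_neq_0; lra|]. rewrite <- RtoC_opp. apply RtoC_neq_0. lra.
    - evar_last; [apply (is_RInt_const (V := R_NormedModule))|]. unfold scal; simpl.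
      unfold mult; simpl. ring. }
  rewrite expm1_quot_eq in E by (rewrite <- RtoC_opp; apply RtoC_neq_0; lra).
  set (l := log_branch (- x)) in *. clearbody l.
  rewrite <- RtoC_opp, Cexp_RtoC, <- RtoC_minus, <- RtoC_div in E by lra.
  assert (E1 : (exp (Re l) * cos (Im l))%R = ((exp (- x) - 1) / - x)%R).
  { rewrite Cexp_components in E. exact (f_equal fst E). }
  rewrite I0, cos_0, Rmult_1_r in E1.
  replace ((exp (- x) - 1) / - x)%R with ((1 - exp (- x)) / x)%R in E1 by (field; lra).
  rewrite <- E1, ln_exp. apply injective_projections; [reflexivity|exact I0].
Qed.

Lemma polar_in_strip (u t : R) : (Rabs u < 2 * PI)%R -> (Rabs (Im (polar u t)) < 2 * PI)%R.
Proof.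
  intros Hu. eapply Rle_lt_trans; [apply Im_le_Cmod|].
  rewrite polar_Cexp, Cmod_mult, Cmod_Cexp, Cmod_R.
  replace (Re (Ci * t)) with 0%R by (unfold Re; simpl; ring). rewrite exp_0. lra.
Qed.

(** The substitution u = t rho moves the radius into the upper limit, so that the radial derivative
    is the integrand. *)
Lemma log_branch_polar (rho theta : R) : (0 < rho < 2 * PI)%R ->
  log_branch (polar rho theta) = CRInt (fun u => Cexp (Ci * theta) * log_deriv (polar u theta)) 0 rho.
Proof.
  intros Hr. symmetry. apply CRInt_unique.
  assert (Hs : (Rabs (Im (polar rho theta)) < 2 * PI)%R) by (apply polar_in_strip, Rabs_def1; lra).
  assert (I := log_branch_crint _ Hs).
  assert (J : crint (fun u => scal (/ rho)%R ((fun t : R => polar rho theta * log_deriv (t * polar rho theta)) (/ rho * u + 0)%R)) 0 rho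
     (log_branch (polar rho theta))).
  { apply (is_RInt_comp_lin (V := C_R_NormedModule) (fun t : R => polar rho theta * log_deriv (t * polar rho theta)) (/ rho) 0 0 rho).
    replace (/ rho * 0 + 0)%R with 0%R by ring.
    replace (/ rho * rho + 0)%R with 1%R by (field; lra). exact I. }
  revert J. apply (is_RInt_ext (V := C_R_NormedModule)). intros u _. rewrite scal_R_Cmult.
  replace (RtoC (/ rho * u + 0) * polar rho theta) with (polar u theta).
  - rewrite (polar_Cexp rho theta), RtoC_inv by lra.
    match goal with |- ?u = ?v => change (@eq C u v) end. field. apply RtoC_neq_0. lra.
  - rewrite !polar_Cexp, Rplus_0_r, RtoC_mult, RtoC_inv by lra. field. apply RtoC_neq_0. lra.
Qed.

Lemma rder_polar_radial (rho theta : R) : rder (fun x => polar x theta) rho (Cexp (Ci * theta)).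
Proof. apply (polar_hol_polar rho theta). Qed.

Lemma rder_polar_angular (rho theta : R) : rder (fun y => polar rho y) theta (Ci * polar rho theta).
Proof.
  destruct (polar_hol_polar rho theta) as [_ [H _]]. eapply rder_eq; [exact H|].
  rewrite polar_Cexp. ring.
Qed.

Lemma continuous_polar (rho theta : R) : continuous (fun z : R * R => polar (fst z) (snd z)) (rho, theta).
Proof. apply (polar_hol_polar rho theta). Qed.

Lemma rder_Cexp_angle (theta : R) : rder (fun y : R => Cexp (Ci * y)) theta (Ci * Cexp (Ci * theta)).
Proof.
  apply (rder_comp_cder Cexp (fun y : R => Ci * y) theta _ Ci); [apply cder_Cexp|].
  eapply rder_eq; [apply rder_scal, rder_RtoC, (is_derive_id (K := R_AbsRing))|].
  unfold one; simpl. ring.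
Qed.

Lemma continuous_Cexp_angle (rho theta : R) : continuous (fun z : R * R => Cexp (Ci * snd z)) (rho, theta).
Proof. apply (polar_hol_polar rho theta). Qed.

(** The radial derivative is the fundamental theorem of calculus. For the angular one, the
    t-derivative of e^(it) f(u e^(it)) is the u-derivative of i u e^(it) f(u e^(it)), so the
    integral over u leaves only boundary values. *)
Lemma polar_hol_log_branch (rho theta : R) : (0 < rho < 2 * PI)%R ->
  polar_hol (fun x y => log_branch (polar x y)) (fun x y : R => Cexp (Ci * y) * log_deriv (polar x y)) rho theta.
Proof.
  intros Hr. assert (HPI := PI_RGT_0).
  assert (Hol : forall u t, (- (2 * PI) < u < 2 * PI)%R -> hol2 log_deriv (polar u t)).
  { intros u t Hu. apply hol2_log_deriv, polar_in_strip, Rabs_def1; lra. }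
  set (P := fun x y : R => Cexp (Ci * y) * log_deriv (polar x y)).
  assert (CP : forall u t, (- (2 * PI) < u < 2 * PI)%R -> continuous (fun z : R * R => P (fst z) (snd z)) (u, t)).
  { intros u t Hu. apply cont_mult; [apply continuous_Cexp_angle|].
    apply (continuous_comp (fun z : R * R => polar (fst z) (snd z)) log_deriv); [apply continuous_polar|].
    apply hol1_continuous, hol2_hol1, Hol, Hu. }
  assert (CPu : forall u t, (- (2 * PI) < u < 2 * PI)%R -> continuous (fun u => P u t) u).
  { intros u t Hu. apply (continuous_comp (fun v => (v, t)) (fun z : R * R => P (fst z) (snd z))).
    - apply filterlim_locally. intros e. exists e. intros w Hw. split; [exact Hw|apply ball_center].
    - apply CP, Hu. }
  assert (Rad : forall x y, (0 < x < 2 * PI)%R -> rder (fun x => log_branch (polar x y)) x (P x y)).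
  { intros x y Hx. apply rder_ext_loc with (fun x => CRInt (fun u => P u y) 0 x).
    { generalize (locally_between _ _ _ Hx). apply filter_imp. intros z Hz. symmetry.
      apply log_branch_polar, Hz. }
    apply (is_derive_RInt (V := C_R_NormedModule) (fun u => P u y) (fun x => CRInt (fun u => P u y) 0 x) 0 x).
    - generalize (locally_between _ _ _ Hx). apply filter_imp. intros z Hz. apply crint_CRInt.
      rewrite Rmin_left, Rmax_right by lra. intros u Hu. apply CPu. lra.
    - apply CPu. lra. }
  assert (Ang : rder (fun y => log_branch (polar rho y)) theta (Ci * rho * P rho theta)).
  { apply rder_ext with (fun y => CRInt (fun u => P u y) 0 rho).
    { intros y. symmetry. apply log_branch_polar, Hr. }
    eapply rder_eq.
    - apply (rder_CRInt_closed P (fun u t => Ci * (polar u t * log_deriv (polar u t)))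
       (fun u t : R => Ci * (Cexp (Ci * t) * (log_deriv (polar u t) + polar u t * C_derive log_deriv (polar u t))))
       (- (2 * PI)) (2 * PI) (theta - 1) (theta + 1) 0 rho theta); try lra.
      + intros u t Hu Ht. eapply rder_eq.
        * apply (rder_mult (fun t : R => Cexp (Ci * t)) (fun t => log_deriv (polar u t))); [apply rder_Cexp_angle|].
          apply (rder_comp_cder log_deriv (fun t => polar u t)); [apply hol1_cder, hol2_hol1, Hol, Hu|apply rder_polar_angular].
        * ring.
      + intros u t Hu Ht. apply rder_scal. eapply rder_eq.
        * apply (rder_mult (fun u => polar u t) (fun u => log_deriv (polar u t))); [apply rder_polar_radial|].
          apply (rder_comp_cder log_deriv (fun u => polar u t)); [apply hol1_cder, hol2_hol1, Hol, Hu|apply rder_polar_radial].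
        * ring.
      + intros u t Hu Ht. apply cont_mult; [apply cont_const|].
        apply cont_mult; [apply continuous_Cexp_angle|].
        apply cont_plus; [|apply cont_mult; [apply continuous_polar|]].
        * apply (continuous_comp (fun z : R * R => polar (fst z) (snd z)) log_deriv); [apply continuous_polar|].
          apply hol1_continuous, hol2_hol1, Hol, Hu.
        * apply (continuous_comp (fun z : R * R => polar (fst z) (snd z)) (C_derive log_deriv)); [apply continuous_polar|].
          apply hol1_continuous, hol2_C_derive, Hol, Hu.
      + intros u t Hu Ht. apply CPu, Hu.
    - unfold P. rewrite (polar_Cexp 0), !Cmult_0_l, (polar_Cexp rho). ring. }
  split; [|split; [|split]].
  - apply Rad, Hr.
  - exact Ang.
  - apply (continuous_of_partials (fun x y => log_branch (polar x y)) P 0 (2 * PI) (theta - 1) (theta + 1)); try lra.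
    + intros; apply Rad; assumption.
    + intros; apply CP. lra.
    + apply (rder_continuous _ _ _ Ang).
  - apply CP. lra.
Qed.

(** * The two contour integrands on the negative axis and near the origin *)

Lemma mellin_ext (D : R -> Prop) Fa (b : R) (f g : R -> C) (s : C) :
  left_end D Fa -> (forall x, D x -> f x = g x) -> exp_decay D b f -> (b < Re s)%R ->
  mellin Fa f s = mellin Fa g s.
Proof.
  intros HL E Hf Hs. assert (PF := left_end_proper _ _ HL).
  symmetry. apply (CRInt_gen_unique Fa infty).
  assert (M := mellin_irint D Fa b f s HL Hf Hs). revert M. apply irint_ext with (1 := HL).
  intros x Hx. rewrite E by exact Hx. reflexivity.
Qed.

(* 1 / (e^x - 1) *)
Definition bose (x : R) : R := (exp (- x) / (1 - exp (- x)))%R.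

Lemma bose_pos (x : R) : (0 < x)%R -> (0 < bose x)%R.
Proof. intros Hx. apply Rdiv_lt_0_compat; [apply exp_pos|apply exp_neg_lt_1, Hx]. Qed.

(** Put u = e^(-x/2), so that the quotient is u^2 / ((1 - u) (1 + u)). From e^(x/2) >= 1 + x/2
    follows u <= (2/x) (1 - u), which removes the pole; the other u is the decay kept. *)
Lemma bose_le (x : R) : (0 < x)%R -> (bose x <= 2 / x * exp (- (x / 2)))%R.
Proof.
  intros Hx. unfold bose. assert (P := exp_neg_lt_1 x Hx). set (u := exp (- (x / 2))).
  assert (Hu : (0 < u)%R) by apply exp_pos.
  assert (E : exp (- x) = (u * u)%R) by (unfold u; rewrite <- exp_plus; f_equal; field).
  rewrite E in *.
  assert (B : (u * (1 + x / 2) <= 1)%R).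
  { assert (B := exp_ineq1_le (x / 2)). apply Rmult_le_reg_l with (exp (x / 2)); [apply exp_pos|].
    replace (exp (x / 2) * (u * (1 + x / 2)))%R with (1 + x / 2)%R; [lra|].
    rewrite <- Rmult_assoc. unfold u. rewrite <- exp_plus, Rplus_opp_r, exp_0. ring. }
  assert (Hu1 : (0 < 1 - u)%R) by nra.
  apply Rle_div_l; [lra|].
  replace (2 / x * u * (1 - u * u))%R with (u * ((2 / x * (1 - u)) * (1 + u)))%R by ring.
  apply Rmult_le_compat_l; [lra|].
  assert (u <= 2 / x * (1 - u))%R.
  { replace u with (2 / x * (u * (x / 2)))%R at 1 by (field; lra).
    apply Rmult_le_compat_l; [left; apply Rdiv_lt_0_compat; lra|]. lra. }
  nra.
Qed.

Lemma continuous_bose (c x : R) : (0 < c * x)%R -> continuous (fun x => bose (c * x)) x.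
Proof.
  intros Hx. apply (ex_derive_continuous (K := R_AbsRing) (V := R_NormedModule)). unfold bose.
  auto_derive.
  generalize (exp_neg_lt_1 (c * x) Hx). lra.
Qed.

Lemma exp_decay_bose (c : R) : (0 < c)%R -> exp_decay (fun x => 0 < x)%R 1 (fun x => RtoC (bose (c * x))).
Proof.
  intros Hc. split.
  - intros x Hx. apply cont_RtoC, continuous_bose, Rmult_lt_0_compat; assumption.
  - exists (c / 2)%R, (2 / c)%R. split; [lra|]. split; [left; apply Rdiv_lt_0_compat; lra|].
    intros x Hx. assert (Q : (0 < c * x)%R) by (apply Rmult_lt_0_compat; assumption).
    rewrite Cmod_RtoC_pos by (left; apply bose_pos, Q). eapply Rle_trans; [apply bose_le, Q|].
    unfold exp_bound. rewrite Rpower_Ropp, Rpower_1 by exact Hx.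
    replace (c / 2 * x)%R with (c * x / 2)%R by field. right. field. lra.
Qed.

Definition log_quot (x : R) : R := ln ((1 - exp (- x)) / x).

(** Two uses of e^v >= 1 + v give x e^(-x) <= 1 - e^(-x) <= x. *)
Lemma log_quot_bound (x : R) : (0 < x)%R -> (- x <= log_quot x <= 0)%R.
Proof.
  intros Hx. unfold log_quot. assert (P := exp_neg_lt_1 x Hx).
  assert (Q : (0 < (1 - exp (- x)) / x)%R) by (apply Rdiv_lt_0_compat; lra). split.
  - rewrite <- (ln_exp (- x)) at 1. apply ln_le; [apply exp_pos|].
    apply Rle_div_r; [exact Hx|]. assert (B := exp_ineq1_le x).
    apply Rmult_le_reg_l with (exp x); [apply exp_pos|].
    rewrite <- Rmult_assoc, Rmult_minus_distr_l, <- exp_plus, Rplus_opp_r, exp_0. lra.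
  - rewrite <- ln_1. apply ln_le; [exact Q|]. apply Rle_div_l; [exact Hx|].
    assert (B := exp_ineq1_le (- x)). lra.
Qed.

Lemma continuous_log_quot (x : R) : (0 < x)%R -> continuous log_quot x.
Proof.
  intros Hx. apply (ex_derive_continuous (K := R_AbsRing) (V := R_NormedModule)). unfold log_quot.
  auto_derive.
  assert (P := exp_neg_lt_1 x Hx). split; [lra|]. split; [|easy].
  apply Rmult_lt_0_compat; [lra|apply Rinv_0_lt_compat, Hx].
Qed.

(** The logarithm is O(x) and cancels the pole 1 / (c x), so the exponent is 0 instead of 1. Hence
    the transform (c) lives on all of Re s > 0. *)
Lemma exp_decay_bose_log_quot (c : R) : (0 < c)%R ->
  exp_decay (fun x => 0 < x)%R 0 (fun x => - RtoC (bose (c * x) * log_quot x)).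
Proof.
  intros Hc. split.
  - intros x Hx. apply cont_opp, cont_RtoC. apply (continuous_mult (K := R_AbsRing)).
    + apply continuous_bose, Rmult_lt_0_compat; assumption.
    + apply continuous_log_quot, Hx.
  - exists (c / 2)%R, (2 / c)%R. split; [lra|]. split; [left; apply Rdiv_lt_0_compat; lra|].
    intros x Hx. assert (Q : (0 < c * x)%R) by (apply Rmult_lt_0_compat; assumption).
    assert (B := bose_pos _ Q). assert (B2 := bose_le _ Q). assert (L := log_quot_bound x Hx).
    rewrite Cmod_opp, Cmod_R, Rabs_mult, (Rabs_pos_eq (bose _)), Rabs_left1 by lra.
    unfold exp_bound. rewrite Ropp_0, Rpower_O by exact Hx.
    apply Rle_trans with (2 / (c * x) * exp (- (c * x / 2)) * x)%R.
    + apply Rmult_le_compat; lra.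
    + replace (c / 2 * x)%R with (c * x / 2)%R by field. right. field. lra.
Qed.

Definition zeta_integrand (z : C) : C := Cexp z / (1 - Cexp z).

Definition contour_kernel (k : nat) (z : C) : C :=
  Cexp (RtoC (INR k) * z) / (Cexp (RtoC (INR k) * z) - 1).

Definition contour_integrand (k : nat) (z : C) : C := contour_kernel k z * log_branch z.

Lemma zeta_integrand_neg (x : R) : (0 < x)%R -> zeta_integrand (- x) = RtoC (bose (1 * x)).
Proof.
  intros Hx. unfold zeta_integrand, bose. assert (P := exp_neg_lt_1 x Hx).
  rewrite <- RtoC_opp, Cexp_RtoC, <- RtoC_minus, <- RtoC_div by lra. rewrite Rmult_1_l. reflexivity.
Qed.

Lemma contour_integrand_neg (k : nat) (x : R) : (0 < INR k)%R -> (0 < x)%R ->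
  contour_integrand k (- x) = - RtoC (bose (INR k * x) * log_quot x).
Proof.
  intros Hk Hx. unfold contour_integrand, contour_kernel, bose.
  assert (Q : (0 < INR k * x)%R) by (apply Rmult_lt_0_compat; assumption).
  assert (P := exp_neg_lt_1 _ Q). rewrite log_branch_neg by exact Hx. fold (log_quot x).
  rewrite <- RtoC_opp, <- RtoC_mult, Cexp_RtoC, <- RtoC_minus, <- RtoC_opp.
  replace (INR k * - x)%R with (- (INR k * x))%R by ring.
  rewrite <- RtoC_div, <- RtoC_mult by lra. f_equal. field. lra.
Qed.

Lemma Cexp_quot_small : exists (d : posreal) (K : R), (0 <= K)%R /\
  forall w : C, w <> 0 -> (Cmod w < d)%R -> (Cmod (Cexp w / (Cexp w - 1)) <= K * / Cmod w)%R.
Proof.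
  assert (HPI := PI_RGT_0).
  assert (Z : (Rabs (Im 0) < 2 * PI)%R) by (simpl; rewrite Rabs_R0; lra).
  assert (Cc : continuous (T := C_UniformSpace) (fun w => Cexp w / expm1_quot w) (RtoC 0)).
  { apply hol1_continuous, hol2_hol1, hol2_div; [apply hol2_Cexp|apply hol2_expm1_quot|apply expm1_quot_neq_0, Z].
    }
  destruct (proj1 (locally_C_Cmod 0 _) (proj1 (continuous_Cmod_eps _ _) Cc (mkposreal 1 Rlt_0_1))) as [d Hd].
  simpl in Hd. rewrite Cexp_0, expm1_quot_0 in Hd.
  (* The function w e^w / (e^w - 1) equals 1 at 0 and stays within 1 of that value on the disc,
     hence the constant 2. *)
  exists d, 2%R. split; [lra|]. intros w Hw Hwd.
  assert (B : (Cmod (w - 0) < d)%R) by (replace (w - 0) with w by ring; exact Hwd).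
  specialize (Hd w B). replace (Cexp w / (Cexp w - 1)) with ((Cexp w / expm1_quot w) * / w).
  2: { rewrite <- expm1_quot_mult. unfold Cdiv. rewrite (Cinv_mult w). ring. }
  rewrite Cmod_mult, Cmod_inv by exact Hw.
  apply Rmult_le_compat_r; [left; apply Rinv_0_lt_compat, (Cmod_neq_0_pos w Hw)|].
  assert (T := Cmod_triangle (Cexp w / expm1_quot w - 1 / 1) 1).
  set (q := Cexp w / expm1_quot w) in *. replace (q - 1 / 1 + 1) with q in T by field.
  rewrite Cmod_1 in T. lra.
Qed.

Lemma polar_neq_0 (x y : R) : (0 < x)%R -> polar x y <> 0.
Proof. intros Hx E. assert (M := Cmod_polar x y (Rlt_le _ _ Hx)). rewrite E, Cmod_0 in M. lra. Qed.

Lemma Cexp_polar_neq_1 (c x y : R) : (0 < c)%R -> (0 < x)%R -> (c * x < 2 * PI)%R -> Cexp (c * polar x y) - 1 <> 0.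
Proof.
  intros Hc Hx Hcx E. apply (polar_neq_0 x y Hx).
  assert (Z : RtoC c * polar x y = 0).
  { apply Cexp_eq_1; [|apply Ceq_minus, E]. eapply Rle_lt_trans; [apply Im_le_Cmod|].
    rewrite Cmod_mult, Cmod_polar, Cmod_RtoC_pos by lra. exact Hcx. }
  replace (polar x y) with (/ c * (RtoC c * polar x y)) by (field; apply RtoC_neq_0; lra).
  rewrite Z. ring.
Qed.

Lemma hol2_Cexp_scal (c z : C) : hol2 (fun z => Cexp (c * z)) z.
Proof.
  apply (hol2_comp Cexp (fun z => c * z)); [|apply hol2_Cexp].
  apply hol2_mult; [apply hol2_const|apply hol2_id].
Qed.

Lemma polar_hol_zeta_integrand (x y : R) : (0 < x < 2 * PI)%R ->
  polar_hol (fun x y => zeta_integrand (polar x y))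
    (fun x y : R => Cexp (Ci * y) * C_derive zeta_integrand (polar x y)) x y.
Proof.
  intros Hx.
  apply (polar_hol_hol2 zeta_integrand polar (fun _ y => Cexp (Ci * y))); [|apply polar_hol_polar].
  apply hol2_div; [apply hol2_Cexp|apply hol2_minus; [apply hol2_const|apply hol2_Cexp]|].
  intros E. apply (Cexp_polar_neq_1 1 x y); try lra. rewrite Cmult_1_l.
  replace (Cexp (polar x y) - 1) with (- (1 - Cexp (polar x y))) by ring. rewrite E. ring.
Qed.

Lemma polar_hol_contour_integrand (k : nat) (x y : R) : (0 < INR k)%R -> (1 <= k)%nat -> (0 < x < 2 * PI / INR k)%R ->
  polar_hol (fun x y => contour_integrand k (polar x y))
    (fun x y : R => (Cexp (Ci * y) * C_derive (contour_kernel k) (polar x y)) * log_branch (polar x y) +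
       contour_kernel k (polar x y) * (Cexp (Ci * y) * log_deriv (polar x y))) x y.
Proof.
  intros Hk Hk1 Hx. assert (HPI := PI_RGT_0).
  assert (K1 : (1 <= INR k)%R) by (apply (le_INR 1), Hk1).
  assert (Hkx : (INR k * x < 2 * PI)%R).
  { destruct Hx as [_ Hx]. apply Rlt_div_r in Hx; [|exact Hk]. lra. }
  apply (polar_hol_mult (fun x y => contour_kernel k (polar x y))
     (fun x y : R => Cexp (Ci * y) * C_derive (contour_kernel k) (polar x y)) (fun x y => log_branch (polar x y))
     (fun x y : R => Cexp (Ci * y) * log_deriv (polar x y))).
  - apply (polar_hol_hol2 (contour_kernel k) polar (fun _ y => Cexp (Ci * y))); [|apply polar_hol_polar].
    apply hol2_div; [apply hol2_Cexp_scal|apply hol2_minus; [apply hol2_Cexp_scal|apply hol2_const]|].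
    apply Cexp_polar_neq_1; try lra.
  (* As k >= 1, a radius below 2 pi / k is also below 2 pi, where the logarithm is regular. *)
  - apply polar_hol_log_branch. split; [lra|]. nra.
Qed.

Lemma zeta_integrand_small : exists d K, (0 < d)%R /\ (0 <= K)%R /\
  forall x y, (0 < x < d)%R -> (Cmod (zeta_integrand (polar x y)) <= K * Rpower x (- (1)))%R.
Proof.
  destruct Cexp_quot_small as [d [K [HK HB]]]. exists d, K. split; [apply d|]. split; [exact HK|].
  intros x y Hx. assert (M : Cmod (polar x y) = x) by (apply Cmod_polar; lra).
  rewrite Rpower_Ropp, Rpower_1 by lra. rewrite <- M at 2.
  replace (zeta_integrand (polar x y)) with (- (Cexp (polar x y) / (Cexp (polar x y) - 1))).
  - rewrite Cmod_opp. apply HB; [apply polar_neq_0; lra|lra].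
  - unfold zeta_integrand, Cdiv.
    replace (1 - Cexp (polar x y)) with (- (1) * (Cexp (polar x y) - 1)) by ring.
    rewrite Cinv_mult. replace (/ - (1)) with (- (1)) by (field; apply C1_nz). ring.
Qed.

Lemma contour_integrand_small (k : nat) : (0 < INR k)%R -> exists d K, (0 < d)%R /\ (0 <= K)%R /\
  forall x y, (0 < x < d)%R -> (Cmod (contour_integrand k (polar x y)) <= K * Rpower x (- 0))%R.
Proof.
  intros Hk. destruct Cexp_quot_small as [d1 [K1 [HK1 HB1]]].
  destruct log_branch_small as [d2 [K2 [HK2 HB2]]].
  assert (D1 : (0 < d1 / INR k)%R) by (apply Rdiv_lt_0_compat; [apply d1|exact Hk]).
  exists (Rmin (d1 / INR k) d2), (K1 * / INR k * K2)%R.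
  assert (P := Rinv_0_lt_compat _ Hk).
  split; [apply Rmin_pos; [exact D1|apply d2]|].
  split; [apply Rmult_le_pos; [apply Rmult_le_pos; lra|exact HK2]|].
  intros x y [Hx Hxd]. destruct (Rlt_Rmin _ _ _ Hxd) as [X1 X2].
  apply Rlt_div_r in X1; [|exact Hk].
  assert (M : Cmod (polar x y) = x) by (apply Cmod_polar; lra).
  rewrite Ropp_0, Rpower_O, Rmult_1_r by exact Hx. unfold contour_integrand. rewrite Cmod_mult.
  apply Rle_trans with ((K1 * / (INR k * x)) * (K2 * x))%R; [|right; field; lra].
  assert (Mk : Cmod (INR k * polar x y) = (INR k * x)%R) by (rewrite Cmod_mult, M, Cmod_RtoC_pos by lra; reflexivity).
  apply Rmult_le_compat; try apply Cmod_ge_0.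
  - rewrite <- Mk. apply HB1; [apply Cmult_neq_0; [apply RtoC_neq_0; lra|apply polar_neq_0, Hx]|].
    rewrite Mk. lra.
  - rewrite <- M at 2. apply HB2. lra.
Qed.

Lemma exp_decay_zeta_integrand : exp_decay (fun x => 0 < x)%R 1 (fun x : R => zeta_integrand (- x)).
Proof.
  apply exp_decay_ext with (fun x => RtoC (bose (1 * x))); [|apply exp_decay_bose; lra].
  intros x Hx. assert (Hx' : (0 < x < x + 1)%R) by lra. generalize (locally_between _ _ _ Hx').
  apply filter_imp.
  intros y Hy. symmetry. apply zeta_integrand_neg. lra.
Qed.

Lemma exp_decay_contour_integrand (k : nat) : (0 < INR k)%R ->
  exp_decay (fun x => 0 < x)%R 0 (fun x : R => contour_integrand k (- x)).
Proof.
  intros Hk. apply exp_decay_ext with (fun x => - RtoC (bose (INR k * x) * log_quot x));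
    [|apply exp_decay_bose_log_quot, Hk].
  intros x Hx. assert (Hx' : (0 < x < x + 1)%R) by lra. generalize (locally_between _ _ _ Hx').
  apply filter_imp.
  intros y Hy. symmetry. apply contour_integrand_neg; lra.
Qed.

Lemma continuous_polar_hol (F F' : R -> R -> C) (x y : R) : polar_hol F F' x y -> continuous (F x) y.
Proof. intros [_ [H _]]. apply (rder_continuous _ _ _ H). Qed.

Lemma hol2_zeta_hankel (s : C) : hol2 (fun s => hankel_integral 1 s zeta_integrand) s.
Proof.
  assert (H3 := PI2_3_2).
  apply hol2_hankel with 1%R; [lra| |].
  - apply exp_decay_sub with (2 := exp_decay_zeta_integrand). intros; lra.
  - intros y Hy. eapply (continuous_polar_hol (fun x y => zeta_integrand (polar x y))).
    apply polar_hol_zeta_integrand. unfold PI2 in *. lra.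
Qed.

Lemma zeta_hankel_collapse (s : C) : (1 < Re s)%R ->
  hankel_integral 1 s zeta_integrand =
  exp_diff s / (RtoC (2 * PI) * Ci) * mellin (at_right 0) (fun x => RtoC (bose (1 * x))) s.
Proof.
  intros Hs. assert (H3 := PI2_3_2). destruct zeta_integrand_small as [d [K [Hd [HK HB]]]].
  rewrite (hankel_collapse 1 (2 * PI) d 1 K zeta_integrand
    (fun x y : R => Cexp (Ci * y) * C_derive zeta_integrand (polar x y))); try assumption.
  - f_equal.
    apply (mellin_ext (fun x => 0 < x)%R _ 1); [constructor|apply zeta_integrand_neg|apply exp_decay_zeta_integrand|exact Hs].
  - unfold PI2 in *. lra.
  - intros x y Hx. apply polar_hol_zeta_integrand, Hx.
  - intros; apply HB; assumption.
  - apply exp_decay_zeta_integrand.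
Qed.

Lemma Icontour_eq (r : R) (s : C) (k : nat) : Icontour r s k = hankel_integral r s (contour_integrand k).
Proof. reflexivity. Qed.

Lemma hol2_Icontour (k : nat) (r : R) (s : C) : (1 <= k)%nat -> (0 < r < 2 * PI / INR k)%R ->
  hol2 (fun s => Icontour r s k) s.
Proof.
  intros Hk Hr. assert (Hk0 : (0 < INR k)%R) by (apply lt_0_INR; lia).
  apply hol2_ext_loc with (fun s => hankel_integral r s (contour_integrand k)).
  { apply filter_forall. intros y. symmetry. apply Icontour_eq. }
  apply hol2_hankel with 0%R; [lra| |].
  - apply exp_decay_sub with (2 := exp_decay_contour_integrand k Hk0). intros; lra.
  - intros y Hy. eapply (continuous_polar_hol (fun x y => contour_integrand k (polar x y))).
    apply polar_hol_contour_integrand; assumption.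
Qed.

Lemma Icontour_collapse (k : nat) (r : R) (s : C) : (1 <= k)%nat -> (0 < r < 2 * PI / INR k)%R -> (0 < Re s)%R ->
  Icontour r s k = exp_diff s / (RtoC (2 * PI) * Ci) *
    mellin (at_right 0) (fun x => - RtoC (bose (INR k * x) * log_quot x)) s.
Proof.
  intros Hk Hr Hs. assert (Hk0 : (0 < INR k)%R) by (apply lt_0_INR; lia).
  destruct (contour_integrand_small k Hk0) as [d [K [Hd [HK HB]]]]. rewrite Icontour_eq.
  rewrite (hankel_collapse r (2 * PI / INR k) d 0 K (contour_integrand k)
    (fun x y : R => (Cexp (Ci * y) * C_derive (contour_kernel k) (polar x y)) * log_branch (polar x y) +
       contour_kernel k (polar x y) * (Cexp (Ci * y) * log_deriv (polar x y)))); try assumption.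
  - f_equal.
    apply (mellin_ext (fun x => 0 < x)%R _ 0); [constructor| |apply exp_decay_contour_integrand, Hk0|exact Hs].
    intros x Hx. apply contour_integrand_neg; assumption.
  - intros x y Hx. apply polar_hol_contour_integrand; assumption.
  - intros; apply HB; assumption.
  - apply exp_decay_contour_integrand, Hk0.
Qed.

(** * Dirichlet series as Mellin transforms *)

Definition cseries (a : nat -> C) (l : C) : Prop := is_series (K := C_AbsRing) (V := C_NormedModule) a l.

Definition csum (a : nat -> C) (n : nat) : C := sum_n (G := C_NormedModule) a n.

Lemma csum_O a : csum a 0 = a 0%nat.
Proof. apply sum_O. Qed.

Lemma csum_S a n : csum a (S n) = csum a n + a (S n).
Proof. apply (sum_Sn (G := C_NormedModule)). Qed.

Lemma Re_csum a n : Re (csum a n) = sum_n (fun j => Re (a j)) n.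
Proof.
  induction n as [|n IH]; [rewrite csum_O, sum_O; reflexivity|].
  rewrite csum_S, sum_Sn, <- IH. reflexivity.
Qed.

Lemma Im_csum a n : Im (csum a n) = sum_n (fun j => Im (a j)) n.
Proof.
  induction n as [|n IH]; [rewrite csum_O, sum_O; reflexivity|].
  rewrite csum_S, sum_Sn, <- IH. reflexivity.
Qed.

Lemma CSeries_unique (a : nat -> C) (l : C) : cseries a l -> CSeries a = l.
Proof.
  intros H. unfold CSeries.
  assert (H1 : is_series (fun n => Re (a n)) (Re l)).
  { apply (filterlim_ext (fun n => Re (csum a n))); [intros n; apply Re_csum|].
    apply (filterlim_comp _ _ _ (csum a) Re _ (locally l)); [exact H|]. apply continuous_fst. }
  assert (H2 : is_series (fun n => Im (a n)) (Im l)).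
  { apply (filterlim_ext (fun n => Im (csum a n))); [intros n; apply Im_csum|].
    apply (filterlim_comp _ _ _ (csum a) Im _ (locally l)); [exact H|]. apply continuous_snd. }
  rewrite (is_series_unique _ _ H1), (is_series_unique _ _ H2). destruct l; reflexivity.
Qed.

(** The index is shifted: [a n] belongs to the frequency n + 1, since the Dirichlet series start at
    1. *)
Definition exp_term (a : nat -> R) (x : R) (n : nat) : R := (a n * exp (- (INR (S n) * x)))%R.

Lemma sum_n_nonneg (u : nat -> R) (n : nat) : (forall j, 0 <= u j)%R -> (0 <= sum_n u n)%R.
Proof.
  intros H. induction n as [|n IH]; [rewrite sum_O; apply H|].
  rewrite sum_Sn. unfold plus; simpl. specialize (H (S n)). lra.
Qed.

Lemma sum_n_mono (u : nat -> R) (m n : nat) : (forall j, 0 <= u j)%R -> (m <= n)%nat -> (sum_n u m <= sum_n u n)%R.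
Proof.
  intros H Hmn. induction Hmn as [|n Hmn IH]; [lra|].
  rewrite sum_Sn. unfold plus; simpl. specialize (H (S n)). lra.
Qed.

Lemma sum_n_le_series (u : nat -> R) (l : R) (n : nat) : (forall j, 0 <= u j)%R -> is_series u l -> (sum_n u n <= l)%R.
Proof.
  intros H Hl. apply (is_lim_seq_le_loc (fun _ => sum_n u n) (fun m => sum_n u m) (sum_n u n) l).
  - exists n. intros m Hm. apply sum_n_mono; assumption.
  - apply is_lim_seq_const.
  - exact Hl.
Qed.

Lemma INR_S_pos (n : nat) : (0 < INR (S n))%R.
Proof. apply lt_0_INR. lia. Qed.

(* u^e e^(-u/2) <= K with u = (n+1) x: half of the exponential decay pays for
   the factor ((n+1)/(N+1))^e >= 1 in the terms n > N. *)
Lemma exp_series_tail (a : nat -> R) (f : R -> R) (e x : R) : (forall n, 0 <= a n)%R ->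
  (forall x, 0 < x -> is_series (exp_term a x) (f x))%R -> (0 < e)%R -> (0 < x)%R ->
  forall K, (forall u, 0 < u -> Rpower (1 + u) e * exp (- (1 / 2 * u)) <= K)%R ->
  forall N, (0 <= f x - sum_n (exp_term a x) N <= K * Rpower (INR (S N) * x) (- e) * f (x / 2))%R.
Proof.
  intros Ha HF He Hx K HK N.
  assert (P : forall y j, (0 <= exp_term a y j)%R).
  { intros y j. apply Rmult_le_pos; [apply Ha|left; apply exp_pos]. }
  split; [generalize (sum_n_le_series _ _ N (P x) (HF x Hx)); lra|].
  set (c := (K * Rpower (INR (S N) * x) (- e))%R).
  assert (HN := INR_S_pos N).
  assert (HNx : (0 < INR (S N) * x)%R) by (apply Rmult_lt_0_compat; assumption).
  assert (K0 : (0 <= K)%R).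
  { eapply Rle_trans; [|apply (HK 1%R); lra]. left.
    apply Rmult_lt_0_compat; [apply Rpower_pos|apply exp_pos]. }
  assert (Hc : (0 <= c)%R) by (apply Rmult_le_pos; [exact K0|left; apply Rpower_pos]).
  assert (T : forall j, (N < j)%nat -> (exp_term a x j <= c * exp_term a (x / 2) j)%R).
  { intros j Hj. unfold exp_term. set (u := (INR (S j) * x)%R).
    assert (Hu : (INR (S N) * x <= u)%R).
    { apply Rmult_le_compat_r; [lra|]. apply le_INR. lia. }
    replace (c * (a j * exp (- (INR (S j) * (x / 2)))))%R with (a j * (c * exp (- (u / 2))))%R.
    2: { replace (INR (S j) * (x / 2))%R with (u / 2)%R by (unfold u; field). ring. }
    apply Rmult_le_compat_l; [apply Ha|].
    replace (- u)%R with (- (u / 2) + - (u / 2))%R by field. rewrite exp_plus.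
    apply Rmult_le_compat_r; [left; apply exp_pos|].
    unfold c. rewrite Rpower_Ropp. apply Rle_div_r; [apply Rlt_gt, Rpower_pos|].
    assert (A : (Rpower (INR (S N) * x) e <= Rpower (1 + u) e)%R) by (apply Rle_Rpower_l; lra).
    eapply Rle_trans; [|apply (HK u); lra].
    replace (1 / 2 * u)%R with (u / 2)%R by field. rewrite Rmult_comm.
    apply Rmult_le_compat_r; [left; apply exp_pos|exact A]. }
  assert (D : forall m, (sum_n (exp_term a x) m - sum_n (exp_term a x) N <= c * sum_n (exp_term a (x / 2)) m)%R).
  { intros m. destruct (le_lt_dec m N) as [Hm|Hm].
    - assert (sum_n (exp_term a x) m <= sum_n (exp_term a x) N)%R.
      { apply sum_n_mono; [apply P|exact Hm]. }
      assert (0 <= c * sum_n (exp_term a (x / 2)) m)%R by (apply Rmult_le_pos; [exact Hc|apply sum_n_nonneg, P]).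
      lra.
    - induction Hm as [|m Hm IH].
      + rewrite !sum_Sn. unfold plus; simpl. specialize (T (S N) ltac:(lia)).
        assert (0 <= c * sum_n (exp_term a (x / 2)) N)%R by (apply Rmult_le_pos; [exact Hc|apply sum_n_nonneg, P]).
        lra.
      + rewrite !sum_Sn. unfold plus; simpl. specialize (T (S m) ltac:(lia)). lra. }
  assert (Hx2 : (0 < x / 2)%R) by lra.
  apply (is_lim_seq_le (fun m => sum_n (exp_term a x) m - sum_n (exp_term a x) N)%R (fun m => c * sum_n (exp_term a (x / 2)) m)%R
     (f x - sum_n (exp_term a x) N)%R (c * f (x / 2))%R D).
  - apply (is_lim_seq_minus' _ _ (f x)); [apply (HF x Hx)|apply is_lim_seq_const].
  - apply (is_lim_seq_scal_l _ c (f (x / 2)%R)). apply (HF _ Hx2).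
Qed.

Lemma mellin_exp_term (s : C) (c : R) : (0 < c)%R -> (0 < Re s)%R ->
  irint (fun x => Rpowc x (s - 1) * RtoC (exp (- (c * x)))) (at_right 0) infty (Rpowc c (- s) * Gamma s).
Proof.
  intros Hc Hs. rewrite Gamma_pos by exact Hs.
  apply (mellin_dilate exp_neg 0 c s Hc); [apply exp_decay_exp_neg; auto|exact Hs].
Qed.

(** The exchange of sum and integral is quantitative: each partial sum has a known transform, and
    the tail after N is at most a constant times (N + 1)^(-e) x^(-e) f(x / 2), whose transform is
    O((N + 1)^(-e)). *)
Lemma dirichlet_mellin (a : nat -> R) (f : R -> R) (b : R) (s : C) :
  (forall n, 0 <= a n)%R -> (forall x, 0 < x -> is_series (exp_term a x) (f x))%R ->
  exp_decay (fun x => 0 < x)%R b (fun x => RtoC (f x)) -> (0 <= b)%R -> (b < Re s)%R ->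
  cseries (fun n => RtoC (a n) * Rpowc (INR (S n)) (- s))
    (mellin (at_right 0) (fun x => RtoC (f x)) s / Gamma s).
Proof.
  intros Ha HF Hdec Hb0 Hb. assert (PF := at_right_proper_filter 0).
  assert (HG : Gamma s <> 0) by (apply Gamma_neq_0; lra).
  set (u := fun n => RtoC (a n) * Rpowc (INR (S n)) (- s)).
  set (M := mellin (at_right 0) (fun x => RtoC (f x)) s).
  assert (IS := mellin_irint _ _ b _ s left_zero Hdec Hb). fold M in IS.
  assert (IN : forall N, irint (fun x => Rpowc x (s - 1) * RtoC (sum_n (exp_term a x) N)) (at_right 0) infty (csum u N * Gamma s)).
  { assert (I1 : forall n, irint (fun x => Rpowc x (s - 1) * RtoC (exp_term a x n)) (at_right 0) infty (u n * Gamma s)).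
    { intros n. assert (I := mellin_exp_term s (INR (S n)) (INR_S_pos n) ltac:(lra)).
      apply (irint_scal _ _ (RtoC (a n))) in I. unfold u. rewrite <- Cmult_assoc. revert I.
      apply (irint_ext (fun x => 0 < x)%R); [constructor|]. intros x Hx. unfold exp_term.
      rewrite RtoC_mult. ring. }
    induction N as [|N IH].
    - rewrite csum_O. generalize (I1 0%nat). apply (irint_ext (fun x => 0 < x)%R); [constructor|].
      intros x Hx. rewrite sum_O. reflexivity.
    - rewrite csum_S, Cmult_plus_distr_r. generalize (irint_plus _ _ _ _ _ _ IH (I1 (S N))).
      apply (irint_ext (fun x => 0 < x)%R); [constructor|].
      intros x Hx. rewrite sum_Sn. unfold plus; simpl. rewrite RtoC_plus. ring. }
  (* Half of the gap: the tail estimate raises the exponent from b to b + e, which is still below Re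
     s. Evaluating f at x / 2 halves the rate and gives the factor 2^b. *)
  set (e := ((Re s - b) / 2)%R). assert (He : (0 < e)%R) by (unfold e; lra).
  destruct (exp_decay_poly e (1 / 2)) as [K [HK HKB]]; [lra|].
  destruct Hdec as [_ [c [K1 [Hc [HK1 HB]]]]].
  destruct (mellin_norm (fun x => 0 < x)%R (at_right 0) (b + e) (c / 2) s) as [Q [HQ HQB]]; [constructor|lra|unfold e; lra|].
  assert (Hbound : forall N, (Cmod (M - csum u N * Gamma s) <= K * K1 * Rpower 2 b * Q * Rpower (INR (S N)) (- e))%R).
  { intros N. replace (K * K1 * Rpower 2 b * Q * Rpower (INR (S N)) (- e))%R with
      ((K * Rpower (INR (S N)) (- e) * (K1 * Rpower 2 b)) * Q)%R by ring.
    apply (HQB (fun x => RtoC (f x - sum_n (exp_term a x) N))).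
    - assert (A := Rpower_pos (INR (S N)) (- e)). assert (A2 := Rpower_pos 2 b).
      apply Rmult_le_pos; apply Rmult_le_pos; lra.
    - intros x Hx. assert (T := exp_series_tail a f e x Ha HF He Hx K HKB N).
      rewrite Cmod_RtoC_pos by apply T. eapply Rle_trans; [apply T|].
      rewrite <- Rpower_mult_distr by (try exact Hx; apply INR_S_pos).
      assert (Hx2 : (0 < x / 2)%R) by lra. assert (B := HB _ Hx2).
      assert (S2 : (f (x / 2) <= K1 * exp_bound b c (x / 2))%R).
      { eapply Rle_trans; [apply Rle_abs|]. rewrite <- Cmod_R. exact B. }
      assert (A := Rpower_pos (INR (S N)) (- e)). assert (A2 := Rpower_pos x (- e)).
      apply Rle_trans with (K * (Rpower (INR (S N)) (- e) * Rpower x (- e)) * (K1 * exp_bound b c (x / 2)))%R.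
      + apply Rmult_le_compat_l; [|exact S2]. apply Rmult_le_pos; [lra|]. apply Rmult_le_pos; lra.
      + right. unfold exp_bound. unfold Rdiv at 1. rewrite <- Rpower_mult_distr by lra.
        replace (- (b + e))%R with (- b + - e)%R by ring. rewrite Rpower_plus.
        replace (Rpower (/ 2) (- b)) with (Rpower 2 b).
        2: { unfold Rpower. rewrite ln_Rinv by lra. f_equal. ring. }
        replace (c * (x / 2))%R with (c / 2 * x)%R by field. ring.
    - generalize (irint_minus _ _ _ _ _ _ IS (IN N)).
      apply (irint_ext (fun x => 0 < x)%R); [constructor|].
      intros x Hx. rewrite RtoC_minus. ring. }
  assert (L : filterlim (fun N => M - csum u N * Gamma s) eventually (locally (RtoC 0))).
  { apply filterlim_C_0; [typeclasses eauto|]. intros eps.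
    assert (H0 : (0 <= K * K1 * Rpower 2 b * Q)%R).
    { assert (A2 := Rpower_pos 2 b). repeat apply Rmult_le_pos; lra. }
    destruct (filter_Rpower_infty e (K * K1 * Rpower 2 b * Q) eps He H0) as [X HX].
    destruct (archimed (Rmax X 0)) as [Z _].
    exists (Z.to_nat (up (Rmax X 0))). intros N HN.
    eapply Rle_lt_trans; [apply Hbound|]. apply HX. apply le_INR in HN. rewrite S_INR.
    assert (Z0 : (0 <= Rmax X 0)%R) by apply Rmax_r.
    assert (Z1 : (X <= Rmax X 0)%R) by apply Rmax_l.
    rewrite INR_IZR_INZ, Z2Nat.id in HN; [lra|]. apply le_IZR. lra. }
  apply (filterlim_ext (fun N => (M + - (M - csum u N * Gamma s)) * / Gamma s)).
  { intros N. unfold csum. field. exact HG. }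
  replace (M / Gamma s) with ((M + - 0) * / Gamma s) by (unfold Cdiv; ring).
  refine (filterlim_comp _ _ _ (fun N => M - csum u N * Gamma s) (fun z => (M + - z) * / Gamma s) _ (locally (RtoC 0)) _ L _).
  change (continuous (T := C_UniformSpace) (fun z : C => (M + - z) * / Gamma s) (RtoC 0)).
  apply (cont_mult (T := C_UniformSpace)); [|apply cont_const].
  apply (cont_plus (T := C_UniformSpace)); [apply cont_const|].
  apply (cont_opp (T := C_UniformSpace)), continuous_id.
Qed.

Lemma exp_term_pow (a : nat -> R) (x : R) (n : nat) : exp_term a x n = (a n * exp (- x) ^ S n)%R.
Proof.
  unfold exp_term. f_equal. rewrite <- (Rpower_pow _ _ (exp_pos (- x))). unfold Rpower.
  rewrite ln_exp. f_equal. ring.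
Qed.

Lemma bose_series (x : R) : (0 < x)%R -> is_series (exp_term (fun _ => 1%R) x) (bose (1 * x)).
Proof.
  intros Hx. rewrite Rmult_1_l. assert (P := exp_neg_lt_1 x Hx). assert (E := exp_pos (- x)).
  assert (G : is_series (fun n => exp (- x) ^ n)%R (/ (1 - exp (- x)))%R).
  { apply is_series_geom. rewrite Rabs_pos_eq; lra. }
  apply (is_series_scal_l (K := R_AbsRing) (exp (- x))) in G. unfold bose, Rdiv.
  revert G. apply is_series_ext. intros n. rewrite exp_term_pow, Rmult_1_l. reflexivity.
Qed.

Lemma zeta_series (s : C) : (1 < Re s)%R ->
  cseries (fun n => Rpowc (INR (S n)) (- s)) (mellin (at_right 0) (fun x => RtoC (bose (1 * x))) s / Gamma s).
Proof.
  intros Hs.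
  apply (is_series_ext (K := C_AbsRing) (V := C_NormedModule) (fun n => RtoC 1 * Rpowc (INR (S n)) (- s))).
  - intros n. apply Cmult_1_l.
  - apply (dirichlet_mellin (fun _ => 1%R) (fun x => bose (1 * x)) 1 s); try lra.
    + intros; lra.
    + intros x Hx. apply bose_series, Hx.
    + apply exp_decay_bose. lra.
Qed.

Lemma zeta_mellin (s : C) : (1 < Re s)%R ->
  zeta s = mellin (at_right 0) (fun x => RtoC (bose (1 * x))) s / Gamma s.
Proof.
  intros Hs. unfold zeta. destruct (Rlt_dec 1 (Re s)) as [_|H]; [|lra].
  apply CSeries_unique, zeta_series, Hs.
Qed.

(** The reflection formula trades Gamma(1 - s) for 1 / Gamma(s), a form without poles at the
    positive integers. *)
Lemma Gamma_reflect_div (s m : C) : (0 < Re s)%R -> ~ positive_integer s ->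
  Gamma (1 - s) * (exp_diff s / (RtoC (2 * PI) * Ci) * m) = m / Gamma s.
Proof.
  intros Hs Hp. assert (G := Gamma_neq_0 s Hs). assert (R := reflection s Hs Hp).
  assert (N1 : RtoC (2 * PI) <> 0) by (apply RtoC_neq_0; generalize PI_RGT_0; lra).
  replace (2 * Ci * PI) with (RtoC (2 * PI) * Ci) in R by (rewrite RtoC_mult; ring).
  replace (Gamma (1 - s) * (exp_diff s / (RtoC (2 * PI) * Ci) * m)) with
    ((Gamma s * Gamma (1 - s) * exp_diff s) / (RtoC (2 * PI) * Ci) * (m / Gamma s)).
  - rewrite R. field. repeat split; try assumption; apply Ci_nz.
  - field. repeat split; try assumption; apply Ci_nz.
Qed.

(** The two cases of [zeta] meet only along Re s = 1. Their agreement on the strip 1 < Re s < 2 is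
    what makes [zeta] differentiable on that line, apart from the pole. *)
Lemma zeta_left (s : C) : (Re s < 2)%R -> s <> 1 ->
  zeta s = Gamma (1 - s) * hankel_integral 1 s zeta_integrand.
Proof.
  intros Hs H1. destruct (Rlt_dec 1 (Re s)) as [H|H].
  - rewrite zeta_mellin, zeta_hankel_collapse, Gamma_reflect_div; try assumption; try reflexivity; try lra.
    intros [n [Hn ->]]. rewrite Re_RtoC in *.
    assert (n < 2)%nat by (apply INR_lt; simpl; lra). assert (n = 1%nat) by lia. subst n. apply H1.
    reflexivity.
  - unfold zeta. destruct (Rlt_dec 1 (Re s)) as [H'|_]; [contradiction|]. reflexivity.
Qed.

(** * The power series whose coefficients are the A_n(k) *)

Lemma CV_radius_ge_1 (a : nat -> R) (x : R) : (forall n, Rabs (a n) <= 1)%R -> (Rabs x < 1)%R ->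
  Rbar_lt (Rabs x) (CV_radius a).
Proof.
  intros Ha Hx. apply Rbar_lt_le_trans with (Finite 1%R); [exact Hx|].
  apply (proj1 (CV_radius_bounded a)). exists 1%R. intros n. rewrite pow1, Rmult_1_r. apply Ha.
Qed.

(** The geometric series is integrated termwise; [PS_Int] of the constant 1 is the sequence 0, 1,
    1/2, 1/3, ... *)
Lemma log_is_pseries (x : R) : (Rabs x < 1)%R -> is_pseries (PS_Int (fun _ => 1%R)) x (- ln (1 - x))%R.
Proof.
  intros Hx.
  assert (B : forall n : nat, (Rabs ((fun _ => 1%R) n) <= 1)%R) by (intros n; rewrite Rabs_R1; lra).
  assert (H := is_pseries_RInt (fun _ => 1%R) x (CV_radius_ge_1 _ x B Hx)).
  assert (Hx' := Rabs_def2 _ _ Hx).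
  replace (- ln (1 - x))%R with (RInt (PSeries (fun _ => 1%R)) 0 x); [exact H|].
  apply is_RInt_unique. apply (is_RInt_ext (fun t => / (1 - t))%R).
  - intros t Ht. assert (At : (Rabs t < 1)%R).
    { apply Rabs_def1; revert Ht; unfold Rmin, Rmax; destruct (Rle_dec 0 x); lra. }
    symmetry. apply is_series_unique.
    generalize (is_series_geom t At). apply is_series_ext. intros n. symmetry. apply Rmult_1_l.
  - replace (- ln (1 - x))%R with (- ln (1 - x) - - ln (1 - 0))%R by (rewrite Rminus_0_r, ln_1; ring).
    apply (is_RInt_derive (V := R_CompleteNormedModule) (fun t => - ln (1 - t))%R).
    + intros t Ht. assert (t < 1)%R by (revert Ht; unfold Rmin, Rmax; destruct (Rle_dec 0 x); lra).
      auto_derive; [lra|]. field. lra.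
    + intros t Ht. assert (t < 1)%R by (revert Ht; unfold Rmin, Rmax; destruct (Rle_dec 0 x); lra).
      apply (ex_derive_continuous (K := R_AbsRing) (V := R_NormedModule)). auto_derive. lra.
Qed.

Definition geom_coef (k n : nat) : R := if Nat.eqb (n mod k) 0 then 1%R else 0%R.

Lemma geom_coef_bound k n : (0 <= geom_coef k n <= 1)%R.
Proof. unfold geom_coef. destruct (Nat.eqb (n mod k) 0); lra. Qed.

(** Multiplication by 1 - x^k telescopes: the coefficients at n and n - k agree for n >= k, and only
    the constant term 1 survives. *)
Lemma geom_is_pseries (k : nat) (x : R) : (1 <= k)%nat -> (Rabs x < 1)%R ->
  is_pseries (geom_coef k) x (/ (1 - x ^ k))%R.
Proof.
  intros Hk Hx.
  assert (B : forall n, (Rabs (geom_coef k n) <= 1)%R).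
  { intros n. assert (B := geom_coef_bound k n). rewrite Rabs_pos_eq; lra. }
  assert (E : ex_pseries (geom_coef k) x) by (apply CV_radius_inside, CV_radius_ge_1; assumption).
  assert (E' := ex_pseries_incr_n (K := R_AbsRing) (V := R_NormedModule) _ k _ E).
  assert (Hxk : (x ^ k <> 1)%R).
  { intros Q. assert (Rabs (x ^ k) < 1)%R; [|rewrite Q, Rabs_R1 in H; lra].
    rewrite <- RPow_abs. destruct k as [|k]; [lia|]. simpl.
    assert (Rabs x ^ k <= 1)%R.
    { rewrite <- (pow1 k). apply pow_incr. split; [apply Rabs_pos|lra]. }
    assert (0 <= Rabs x ^ k)%R by (apply pow_le, Rabs_pos). generalize (Rabs_pos x). nra. }
  assert (S : (PSeries (geom_coef k) x - x ^ k * PSeries (geom_coef k) x = 1)%R).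
  { rewrite <- PSeries_incr_n, <- PSeries_minus by assumption.
    rewrite PSeries_decr_1 by (apply ex_pseries_minus; assumption).
    replace (PSeries _ x) with 0%R.
    - unfold PS_minus, PS_plus, PS_opp. rewrite PS_incr_n_simplify.
      destruct (Compare_dec.le_lt_dec k 0); [lia|]. unfold geom_coef.
      rewrite Nat.Div0.mod_0_l. simpl. unfold plus, opp, zero; simpl. ring.
    - symmetry. rewrite <- (PSeries_const_0 x). apply PSeries_ext. intros n.
      unfold PS_decr_1, PS_minus, PS_plus, PS_opp. rewrite PS_incr_n_simplify. unfold geom_coef.
      destruct (Compare_dec.le_lt_dec k (S n)) as [H|H].
      + replace (S n mod k)%nat with ((S n - k) mod k)%nat.
        * unfold plus, opp; simpl. ring.
        * rewrite <- (Nat.Div0.mod_add (S n - k) 1 k). f_equal. lia.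
      + rewrite Nat.mod_small by exact H. simpl. unfold plus, opp, zero; simpl. ring. }
  replace (/ (1 - x ^ k))%R with (PSeries (geom_coef k) x); [apply PSeries_correct, E|].
  apply Rmult_eq_reg_l with (1 - x ^ k)%R; [|lra]. rewrite Rinv_r by lra. lra.
Qed.

(** The Cauchy product of the two expansions, a form in which the coefficients are visibly
    nonnegative, as the tail estimate for exponential series demands. *)
Definition A_conv (k : nat) : nat -> R := PS_mult (PS_Int (fun _ => 1%R)) (geom_coef k).

Lemma PS_Int_1_bound (n : nat) : (0 <= PS_Int (fun _ => 1%R) n <= 1)%R.
Proof.
  destruct n as [|n]; unfold PS_Int; [lra|].
  assert (1 <= INR (S n))%R by (rewrite S_INR; generalize (pos_INR n); lra).
  split; [apply Rdiv_le_0_compat; lra|apply Rle_div_l; lra].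
Qed.

Lemma A_is_pseries (k : nat) (x : R) : (1 <= k)%nat -> (Rabs x < 1)%R ->
  is_pseries (A_conv k) x (- ln (1 - x) / (1 - x ^ k))%R.
Proof.
  intros Hk Hx. apply is_pseries_mult.
  - apply log_is_pseries, Hx.
  - apply geom_is_pseries; assumption.
  - apply CV_radius_ge_1; [|exact Hx]. intros n. assert (B := PS_Int_1_bound n).
    rewrite Rabs_pos_eq; lra.
  - apply CV_radius_ge_1; [|exact Hx]. intros n. assert (B := geom_coef_bound k n).
    rewrite Rabs_pos_eq; lra.
Qed.

Lemma CV_radius_ex_pseries (a : nat -> R) (x : R) : ex_pseries a x -> Rbar_le (Rabs x) (CV_radius a).
Proof.
  intros H. apply Rbar_not_lt_le. intros L. apply (CV_disk_outside a x L).
  assert (Z := ex_series_lim_0 _ H). revert Z. apply is_lim_seq_ext. intros n.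
  unfold scal; simpl. unfold mult; simpl. rewrite pow_n_pow. ring.
Qed.

Lemma A_coef_conv (k n : nat) : (1 <= k)%nat -> A_coef k n = A_conv k n.
Proof.
  intros Hk. unfold A_coef.
  rewrite (Derive_n_ext_loc _ (PSeries (A_conv k))).
  - rewrite Derive_n_coef; [field; apply INR_fact_neq_0|].
    (* Convergence at the point 1/2 makes the radius of convergence positive, so the derivatives at
       0 read off the coefficients. *)
    assert (H : (Rabs (/ 2) < 1)%R) by (rewrite Rabs_pos_eq; lra).
    apply Rbar_lt_le_trans with (Rabs (/ 2)); [simpl; rewrite Rabs_pos_eq; lra|].
    apply CV_radius_ex_pseries. eexists. apply A_is_pseries; assumption.
  - exists (mkposreal 1 Rlt_0_1). intros y Hy. symmetry.
    apply is_pseries_unique, A_is_pseries; [exact Hk|].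
    apply (proj1 (ball_Rabs 0 1 y)) in Hy. rewrite Rminus_0_r in Hy. exact Hy.
Qed.

Lemma A_conv_nonneg k n : (0 <= A_conv k n)%R.
Proof.
  apply cond_pos_sum. intros j. apply Rmult_le_pos; [apply PS_Int_1_bound|apply geom_coef_bound].
Qed.

Lemma pseries_exp_term (a : nat -> R) (x l : R) : (0 < x)%R -> a 0%nat = 0%R ->
  is_pseries a (exp (- x)) l -> is_series (exp_term (fun n => a (S n)) x) l.
Proof.
  intros Hx Ha H.
  apply (is_series_ext (fun n => a (S n) * exp (- x) ^ S n)%R).
  { intros n. symmetry. apply (exp_term_pow (fun n => a (S n))). }
  assert (H' : is_series (fun n => a n * exp (- x) ^ n)%R l).
  { revert H. apply is_series_ext. intros n. unfold scal; simpl. unfold mult; simpl.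
    rewrite pow_n_pow. apply Rmult_comm. }
  apply (is_series_incr_1 (fun n => a n * exp (- x) ^ n)%R).
  assert (E : plus l (a 0%nat * exp (- x) ^ 0)%R = l) by (rewrite Ha; unfold plus; simpl; ring).
  exact (eq_ind_r (fun v => is_series (fun n => a n * exp (- x) ^ n)%R v) H' E).
Qed.

Lemma exp_neg_in_disk (x : R) : (0 < x)%R -> (Rabs (exp (- x)) < 1)%R.
Proof. intros Hx. generalize (exp_neg_lt_1 x Hx) (exp_pos (- x)). intros. rewrite Rabs_pos_eq; lra.
Qed.

Definition neg_log (x : R) : R := (- ln (1 - exp (- x)))%R.

Lemma neg_log_eq (x : R) : (0 < x)%R -> neg_log x = (- log_quot x - ln x)%R.
Proof.
  intros Hx. unfold neg_log, log_quot. assert (P := exp_neg_lt_1 x Hx). rewrite ln_div by lra. ring.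
Qed.

(** With v = 1 / (e^x - 1) one has - ln (1 - e^(-x)) = ln (1 + v) <= v, so the decay of [bose] is
    inherited. *)
Lemma exp_decay_neg_log : exp_decay (fun x => 0 < x)%R 1 (fun x => RtoC (neg_log x)).
Proof.
  destruct (exp_decay_bose 1 Rlt_0_1) as [_ [c [K [Hc [HK HB]]]]]. split.
  - intros x Hx. apply cont_RtoC.
    apply (ex_derive_continuous (K := R_AbsRing) (V := R_NormedModule)).
    unfold neg_log. auto_derive. generalize (exp_neg_lt_1 x Hx). lra.
  - exists c, K. split; [exact Hc|]. split; [exact HK|]. intros x Hx.
    eapply Rle_trans; [|apply HB, Hx].
    assert (P := exp_neg_lt_1 x Hx). assert (E := exp_pos (- x)).
    rewrite Rmult_1_l, (Cmod_RtoC_pos (bose x)) by (left; apply bose_pos, Hx).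
    assert (L : (ln (1 - exp (- x)) <= 0)%R) by (rewrite <- ln_1; apply ln_le; lra).
    unfold neg_log. rewrite Cmod_RtoC_pos by lra. rewrite <- ln_Rinv by exact P.
    rewrite <- (ln_exp (bose x)). apply ln_le; [apply Rinv_0_lt_compat, P|].
    eapply Rle_trans; [|apply exp_ineq1_le]. unfold bose. right. field. lra.
Qed.

(** The coefficients 1/n of the logarithm turn n^(-s) into n^(-s-1). *)
Lemma zeta_succ_mellin (s : C) : (1 < Re s)%R ->
  zeta (s + 1) = mellin (at_right 0) (fun x => RtoC (neg_log x)) s / Gamma s.
Proof.
  intros Hs. unfold zeta. destruct (Rlt_dec 1 (Re (s + 1))) as [_|H].
  2: { rewrite Re_plus, Re_RtoC in H. lra. }
  apply CSeries_unique.
  apply (is_series_ext (K := C_AbsRing) (V := C_NormedModule)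
    (fun n => RtoC (PS_Int (fun _ => 1%R) (S n)) * Rpowc (INR (S n)) (- s))).
  - intros n. replace (- (s + 1)) with (- s - 1) by ring.
    rewrite Rpowc_minus, Rpowc_1 by apply INR_S_pos.
    unfold PS_Int. rewrite RtoC_div by (apply Rgt_not_eq, INR_S_pos).
    match goal with |- ?u = ?v => change (@eq C u v) end. field.
    apply RtoC_neq_0, Rgt_not_eq, INR_S_pos.
  - apply (dirichlet_mellin (fun n => PS_Int (fun _ => 1%R) (S n)) neg_log 1 s); try lra.
    + intros n. apply PS_Int_1_bound.
    + intros x Hx. apply pseries_exp_term; [exact Hx|reflexivity|].
      apply log_is_pseries, exp_neg_in_disk, Hx.
    + apply exp_decay_neg_log.
Qed.

Definition A_gen (k : nat) (x : R) : R := (neg_log x / (1 - exp (- (INR k * x))))%R.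

Lemma A_gen_eq (k : nat) (x : R) : (0 < INR k)%R -> (0 < x)%R ->
  A_gen k x = (neg_log x - bose (INR k * x) * log_quot x - ln x * bose (INR k * x))%R.
Proof.
  intros Hk Hx. assert (Q : (0 < INR k * x)%R) by (apply Rmult_lt_0_compat; assumption).
  assert (P := exp_neg_lt_1 _ Q).
  replace (neg_log x - bose (INR k * x) * log_quot x - ln x * bose (INR k * x))%R with
    (neg_log x + bose (INR k * x) * (- log_quot x - ln x))%R by ring.
  rewrite <- neg_log_eq by exact Hx. unfold A_gen, bose. field. lra.
Qed.

Lemma exp_decay_pos (b b' : R) (g : R -> C) : (b <= b')%R ->
  exp_decay (fun x => 0 < x)%R b g -> exp_decay (fun x => 0 < x)%R b' g.
Proof. apply exp_decay_weaken. auto. Qed.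

Lemma exp_decay_ln_bose (k : nat) (b : R) : (0 < INR k)%R -> (1 < b)%R ->
  exp_decay (fun x => 0 < x)%R b (fun x => ln x * RtoC (bose (INR k * x))).
Proof.
  intros Hk Hb. apply exp_decay_ln with 1%R; [auto|exact Hb|apply exp_decay_bose, Hk].
Qed.

Lemma exp_decay_A_gen (k : nat) (b : R) : (0 < INR k)%R -> (1 < b)%R ->
  exp_decay (fun x => 0 < x)%R b (fun x => RtoC (A_gen k x)).
Proof.
  intros Hk Hb.
  apply exp_decay_ext with (fun x => RtoC (neg_log x) + - RtoC (bose (INR k * x) * log_quot x) +
     - (1) * (ln x * RtoC (bose (INR k * x)))).
  - intros x Hx. assert (Hx' : (0 < x < x + 1)%R) by lra. generalize (locally_between _ _ _ Hx').
    apply filter_imp.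
    intros y Hy. rewrite A_gen_eq by lra. rewrite !RtoC_minus, !RtoC_mult. ring.
  - apply exp_decay_plus; [auto|apply exp_decay_plus; [auto| |]|].
    + apply exp_decay_pos with 1%R; [lra|apply exp_decay_neg_log].
    + apply exp_decay_pos with 0%R; [lra|apply exp_decay_bose_log_quot, Hk].
    + apply exp_decay_mult with 1%R; [intros; apply cont_const|lra| |apply exp_decay_ln_bose; assumption].
      intros. rewrite Cmod_opp, Cmod_1. lra.
Qed.

Lemma A_series (k : nat) (s : C) : (1 <= k)%nat -> (1 < Re s)%R ->
  cseries (fun n => RtoC (A_coef k (S n)) * Rpowc (INR (S n)) (- s))
    (mellin (at_right 0) (fun x => RtoC (A_gen k x)) s / Gamma s).
Proof.
  intros Hk Hs. assert (Hk0 : (0 < INR k)%R) by (apply lt_0_INR; lia).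
  apply (dirichlet_mellin (fun n => A_coef k (S n)) (A_gen k) ((1 + Re s) / 2) s); try lra.
  - intros n. rewrite A_coef_conv by exact Hk. apply A_conv_nonneg.
  - intros x Hx. apply (is_series_ext (exp_term (fun n => A_conv k (S n)) x)).
    { intros n. unfold exp_term. rewrite A_coef_conv by exact Hk. reflexivity. }
    apply pseries_exp_term; [exact Hx|unfold A_conv, PS_mult; simpl; ring|].
    assert (H := A_is_pseries k (exp (- x)) Hk (exp_neg_in_disk x Hx)).
    unfold A_gen, neg_log.
    replace (exp (- (INR k * x))) with (exp (- x) ^ k)%R; [exact H|].
    rewrite <- (Rpower_pow _ _ (exp_pos (- x))). unfold Rpower. rewrite ln_exp. f_equal. ring.
  - apply exp_decay_A_gen; lra.
Qed.

Lemma mellin_A_gen (k : nat) (s : C) : (1 <= k)%nat -> (1 < Re s)%R ->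
  mellin (at_right 0) (fun x => RtoC (A_gen k x)) s =
  mellin (at_right 0) (fun x => RtoC (neg_log x)) s
  + mellin (at_right 0) (fun x => - RtoC (bose (INR k * x) * log_quot x)) s
  - mellin (at_right 0) (fun x => ln x * RtoC (bose (INR k * x))) s.
Proof.
  intros Hk Hs. assert (Hk0 : (0 < INR k)%R) by (apply lt_0_INR; lia).
  assert (PF := at_right_proper_filter 0).
  apply (CRInt_gen_unique (at_right 0) infty).
  assert (I1 := mellin_irint _ _ 1 _ s left_zero exp_decay_neg_log Hs).
  assert (I2 := mellin_irint _ _ 0 _ s left_zero (exp_decay_bose_log_quot (INR k) Hk0) ltac:(lra)).
  assert (I3 := mellin_irint _ _ ((1 + Re s) / 2) _ s left_zero (exp_decay_ln_bose k ((1 + Re s) / 2) Hk0 ltac:(lra)) ltac:(lra)).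
  generalize (irint_minus _ _ _ _ _ _ (irint_plus _ _ _ _ _ _ I1 I2) I3).
  apply irint_ext with (1 := left_zero). intros x Hx. rewrite A_gen_eq by assumption.
  rewrite !RtoC_minus, !RtoC_mult. ring.
Qed.

(** * The continuation *)

Definition zeta_mellin_int (s : C) : C := mellin (at_right 0) (fun x => RtoC (bose (1 * x))) s.

Definition contour_mellin (k : nat) (s : C) : C :=
  mellin (at_right 0) (fun x => - RtoC (bose (INR k * x) * log_quot x)) s.

Lemma hol2_affine_comp (f : C -> C) (a s : C) : hol2 f (a - s) -> hol2 (fun z => f (a - z)) s.
Proof.
  intros H. apply (hol2_comp f (fun z => a - z)); [|exact H].
  apply hol2_minus; [apply hol2_const|apply hol2_id].
Qed.

Lemma hol2_zeta (s : C) : s <> 1 -> hol2 zeta s.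
Proof.
  intros H1. destruct (Rlt_dec 1 (Re s)) as [H|H].
  - apply hol2_ext_loc with (fun z => zeta_mellin_int z / Gamma z).
    + generalize (locally_Re_gt 1 s H). apply filter_imp. intros z Hz. symmetry.
      apply zeta_mellin, Hz.
    + apply hol2_div; [|apply hol2_Gamma_pos; lra|apply Gamma_neq_0; lra].
      apply (hol2_mellin (fun x => 0 < x)%R _ 1); [constructor|apply exp_decay_bose; lra|exact H].
  - apply hol2_ext_loc with (fun z => Gamma (1 - z) * hankel_integral 1 z zeta_integrand).
    (* The contour formula is used on Re z < 2, so that points with Re s = 1 have a full
       neighbourhood in which it holds. *)
    + assert (H2 : (Re s < 2)%R) by lra.
      generalize (filter_and _ _ (locally_Re_lt 2 s H2) (locally_neq 1 s H1)). apply filter_imp.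
      intros z [Hz Hz1]. symmetry. apply zeta_left; assumption.
    + apply hol2_mult; [|apply hol2_zeta_hankel]. apply hol2_affine_comp, hol2_Gamma.
      intros n E. apply H1. assert (E2 := f_equal Re E).
      rewrite Re_minus, <- RtoC_opp, !Re_RtoC in E2.
      assert (E3 : INR n = 0%R) by (generalize (pos_INR n); lra).
      rewrite E3 in E. replace s with (1 - (1 - s)) by ring. rewrite E. ring.
Qed.

(** The quotient on Re s > 0 supplies the values by continuity at the positive integers: it is
    regular there, and off these points it equals Gamma(1 - s) I(s,k). *)
Definition contour_G (k : nat) (r : R) (s : C) : C :=
  if Rlt_dec 0 (Re s) then contour_mellin k s / Gamma s else Gamma (1 - s) * Icontour r s k.

Section Contour.
Variables (k : nat) (r : R).
Hypothesis Hk : (1 <= k)%nat.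
Hypothesis Hr : (0 < r < 2 * PI / INR k)%R.

(** The collapsed contour carries the factor 2 i sin (pi s), which vanishes at integers, times a
    transform that converges for Re s > 0. *)
Lemma Icontour_positive_integer (s : C) : positive_integer s -> Icontour r s k = 0.
Proof.
  intros [n [Hn ->]].
  rewrite Icontour_collapse; [|exact Hk|exact Hr|rewrite Re_RtoC; apply lt_0_INR; lia].
  rewrite exp_diff_INR. unfold Cdiv. ring.
Qed.

Lemma contour_G_eq (s : C) : ~ positive_integer s -> contour_G k r s = Gamma (1 - s) * Icontour r s k.
Proof.
  intros Hs. unfold contour_G. destruct (Rlt_dec 0 (Re s)) as [H|H]; [|reflexivity].
  rewrite Icontour_collapse by assumption. symmetry. apply Gamma_reflect_div; assumption.
Qed.

Lemma hol2_contour_G (s : C) : hol2 (contour_G k r) s.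
Proof.
  assert (Hk0 : (0 < INR k)%R) by (apply lt_0_INR; lia).
  destruct (Rlt_dec 0 (Re s)) as [H|H].
  - apply hol2_ext_loc with (fun z => contour_mellin k z / Gamma z).
    + generalize (locally_Re_gt 0 s H). apply filter_imp. intros z Hz.
      unfold contour_G. destruct (Rlt_dec 0 (Re z)); [reflexivity|contradiction].
    + apply hol2_div; [|apply hol2_Gamma_pos; lra|apply Gamma_neq_0; lra].
      apply (hol2_mellin (fun x => 0 < x)%R _ 0); [constructor|apply exp_decay_bose_log_quot, Hk0|exact H].
  - apply hol2_ext_loc with (fun z => Gamma (1 - z) * Icontour r z k).
    (* The half-plane Re z < 1 contains no positive integer, so the contour formula holds on both
       sides of the line Re z = 0. *)
    + assert (H1 : (Re s < 1)%R) by lra. generalize (locally_Re_lt 1 s H1). apply filter_imp.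
      intros z Hz. symmetry. apply contour_G_eq. intros [n [Hn ->]]. rewrite Re_RtoC in Hz.
      apply (le_INR 1) in Hn. simpl in Hn. lra.
    + apply hol2_mult; [|apply hol2_Icontour; assumption]. apply hol2_affine_comp, hol2_Gamma_pos.
      rewrite Re_minus, Re_RtoC. lra.
Qed.

Lemma cder_Rpowc_opp (c : R) (s : C) : cder (fun z => Rpowc c (- z)) s (- (ln c * Rpowc c (- s))).
Proof.
  unfold Rpowc. eapply cder_eq.
  - apply (cder_comp Cexp (fun z => - z * ln c)); [apply cder_Cexp|].
    apply cder_mult; [apply cder_opp, cder_id|apply cder_const].
  - cbv beta. ring.
Qed.

(** One transform is differentiated twice over: under the integral sign, which yields ln x, and as
    the product k^(-s) Gamma(s) zeta(s). Uniqueness of the derivative equates the results, and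
    dividing by Gamma(s) creates the digamma function. *)
Lemma mellin_ln_bose (s : C) : (1 < Re s)%R ->
  mellin (at_right 0) (fun x => ln x * RtoC (bose (INR k * x))) s / Gamma s =
  / Rpowc (INR k) s * (digamma s * zeta s + C_derive zeta s - zeta s * RtoC (ln (INR k))).
Proof.
  intros Hs. assert (Hk0 : (0 < INR k)%R) by (apply lt_0_INR; lia).
  assert (G0 : Gamma s <> 0) by (apply Gamma_neq_0; lra).
  assert (D1 := cder_mellin _ _ 1 _ s left_zero (exp_decay_bose (INR k) Hk0) Hs).
  assert (D2 : cder (mellin (at_right 0) (fun x => RtoC (bose (INR k * x)))) s
     (- (ln (INR k) * Rpowc (INR k) (- s)) * (Gamma s * zeta s) +
      Rpowc (INR k) (- s) * (C_derive Gamma s * zeta s + Gamma s * C_derive zeta s))).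
  { apply cder_ext_loc with (fun z => Rpowc (INR k) (- z) * (Gamma z * zeta z)).
    - generalize (locally_Re_gt 1 s Hs). apply filter_imp. intros z Hz.
      rewrite zeta_mellin by exact Hz.
      replace (Gamma z * (mellin (at_right 0) (fun x => RtoC (bose (1 * x))) z / Gamma z)) with
        (mellin (at_right 0) (fun x => RtoC (bose (1 * x))) z) by (field; apply Gamma_neq_0; lra).
      assert (PF := at_right_proper_filter 0).
      symmetry. apply (CRInt_gen_unique (at_right 0) infty).
      generalize (mellin_dilate _ 1 (INR k) z Hk0 (exp_decay_bose 1 Rlt_0_1) Hz).
      apply irint_ext with (1 := left_zero). intros x Hx. rewrite Rmult_1_l. reflexivity.
    - apply (cder_mult (fun z => Rpowc (INR k) (- z)) (fun z => Gamma z * zeta z)); [apply cder_Rpowc_opp|].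
      apply cder_mult; apply hol1_cder, hol2_hol1.
      + apply hol2_Gamma_pos. lra.
      + apply hol2_zeta. intros E. rewrite E, Re_RtoC in Hs. lra. }
  rewrite (cder_unique _ _ _ _ D1 D2), Rpowc_opp. unfold digamma. field.
  split; first [exact G0|apply Rpowc_neq_0].
Qed.

Lemma rhs_series (s : C) : (1 < Re s)%R ->
  cseries (fun n => RtoC (A_coef k (S n)) * Rpowc (INR (S n)) (- s)) (rhs k (contour_G k r) s).
Proof.
  intros Hs. assert (G0 : Gamma s <> 0) by (apply Gamma_neq_0; lra).
  assert (E : rhs k (contour_G k r) s = mellin (at_right 0) (fun x => RtoC (A_gen k x)) s / Gamma s).
  { unfold rhs. rewrite <- mellin_ln_bose, zeta_succ_mellin, mellin_A_gen by assumption.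
    unfold contour_G. destruct (Rlt_dec 0 (Re s)) as [_|H]; [|lra]. unfold contour_mellin. field.
    exact G0. }
  rewrite E. apply A_series; assumption.
Qed.

End Contour.

(** * Meromorphy of the right-hand side *)

Lemma locally'_of_locally (s : C) (P : C -> Prop) : locally s P -> locally' s P.
Proof. unfold locally', within. apply filter_imp. auto. Qed.

Lemma hol1_pow (s0 : C) (n : nat) (s : C) : hol1 (fun z => Cpow (z - s0) n) s.
Proof.
  induction n as [|n IH].
  - apply hol2_hol1, (hol2_const 1).
  - apply hol1_ext_loc with (fun z => (z - s0) * Cpow (z - s0) n).
    + apply filter_forall. intros z. reflexivity.
    + apply hol1_mult; [|exact IH]. apply hol2_hol1, hol2_minus; [apply hol2_id|apply hol2_const].
Qed.

Lemma meromorphic_at_hol1 (F : C -> C) (s : C) : hol1 F s -> meromorphic_at F s.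
Proof.
  intros H. exists 0%nat, F. split; [exact H|]. apply locally'_of_locally, filter_forall.
  intros z. simpl. ring.
Qed.

Lemma meromorphic_at_ext (F G : C -> C) (s : C) :
  locally' s (fun z => F z = G z) -> meromorphic_at F s -> meromorphic_at G s.
Proof.
  intros E [n [h [H1 H2]]]. exists n, h. split; [exact H1|].
  generalize (filter_and (F := locally' s) _ _ E H2). apply filter_imp. intros z [A B].
  rewrite <- A. exact B.
Qed.

Lemma meromorphic_at_plus (F G : C -> C) (s : C) :
  meromorphic_at F s -> meromorphic_at G s -> meromorphic_at (fun z => F z + G z) s.
Proof.
  intros [n [h [H1 H2]]] [m [g [G1 G2]]].
  exists (n + m)%nat, (fun z => Cpow (z - s) m * h z + Cpow (z - s) n * g z). split.
  - apply (hol1_plus (fun z => Cpow (z - s) m * h z) (fun z => Cpow (z - s) n * g z)).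
    + apply (hol1_mult (fun z => Cpow (z - s) m) h); [apply hol1_pow|exact H1].
    + apply (hol1_mult (fun z => Cpow (z - s) n) g); [apply hol1_pow|exact G1].
  - generalize (filter_and (F := locally' s) _ _ H2 G2). apply filter_imp. intros z [A B].
    rewrite A, B, Cpow_add_r. ring.
Qed.

Lemma meromorphic_at_mult (F G : C -> C) (s : C) :
  meromorphic_at F s -> meromorphic_at G s -> meromorphic_at (fun z => F z * G z) s.
Proof.
  intros [n [h [H1 H2]]] [m [g [G1 G2]]]. exists (n + m)%nat, (fun z => h z * g z). split.
  - apply (hol1_mult h g); assumption.
  - generalize (filter_and (F := locally' s) _ _ H2 G2). apply filter_imp. intros z [A B].
    rewrite A, B, Cpow_add_r. ring.
Qed.

Lemma meromorphic_at_opp (F : C -> C) (s : C) : meromorphic_at F s -> meromorphic_at (fun z => - F z) s.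
Proof.
  intros H. apply meromorphic_at_ext with (fun z => - (1) * F z).
  - apply locally'_of_locally, filter_forall. intros z. ring.
  - apply meromorphic_at_mult; [|exact H]. apply meromorphic_at_hol1, hol2_hol1, hol2_const.
Qed.

Lemma meromorphic_at_minus (F G : C -> C) (s : C) :
  meromorphic_at F s -> meromorphic_at G s -> meromorphic_at (fun z => F z - G z) s.
Proof. intros HF HG. apply meromorphic_at_plus; [exact HF|apply meromorphic_at_opp, HG]. Qed.

Lemma meromorphic_at_translate (F : C -> C) (a s : C) :
  meromorphic_at F (s + a) -> meromorphic_at (fun z => F (z + a)) s.
Proof.
  intros [n [h [H1 H2]]]. exists n, (fun z => h (z + a)).
  assert (T : forall z, cder (fun w => w + a) z 1).
  { intros z. eapply cder_eq; [apply cder_plus; [apply cder_id|apply cder_const]|]. ring. }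
  assert (K := cder_continuous _ _ _ (T s)). split.
  - apply K in H1. revert H1. unfold filtermap. apply filter_imp. intros z [l Hl].
    exists (1 * l). apply (cder_comp h (fun w => w + a)); [exact Hl|apply T].
  - unfold locally', within in *. apply K in H2. revert H2. unfold filtermap. apply filter_imp.
    intros z Hz Hzs.
    rewrite Hz; [replace (z + a - (s + a)) with (z - s) by ring; reflexivity|]. intros E. apply Hzs.
    assert (E1 : forall w : C, w + a - a = w) by (intros w; ring).
    rewrite <- (E1 s), <- E, (E1 z). reflexivity.
Qed.

Lemma meromorphic_at_Cinv (s : C) : meromorphic_at Cinv s.
Proof.
  destruct (Ceq_dec s 0) as [->|H].
  - exists 1%nat, (fun _ => 1). split; [apply hol2_hol1, hol2_const|].
    unfold locally', within. apply filter_forall. intros z Hz. simpl. field. exact Hz.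
  - apply meromorphic_at_hol1, hol2_hol1, hol2_inv; [apply hol2_id|exact H].
Qed.

(* (s - 1) zeta(s) near s = 1 *)
Definition zeta_residual (s : C) : C := - Gamma (2 - s) * hankel_integral 1 s zeta_integrand.

Lemma hol2_zeta_residual : hol2 zeta_residual 1.
Proof.
  apply hol2_mult; [|apply hol2_zeta_hankel]. apply hol2_opp, hol2_affine_comp, hol2_Gamma_pos.
  rewrite Re_minus, !Re_RtoC. lra.
Qed.

(** Gamma(2 - s) = (1 - s) Gamma(1 - s) absorbs the pole of Gamma(1 - s) at s = 1. *)
Lemma zeta_residual_eq (s : C) : (Re s < 2)%R -> s <> 1 -> zeta_residual s = (s - 1) * zeta s.
Proof.
  intros Hs H1. rewrite zeta_left by assumption. unfold zeta_residual.
  replace (2 - s) with ((1 - s) + 1) by ring. rewrite Gamma_succ; [ring|].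
  intros E. apply H1. replace s with (1 - (1 - s)) by ring. rewrite E. ring.
Qed.

Lemma locally_1_zeta_residual : locally (RtoC 1) (fun z : C => (Re z < 2)%R /\ (z <> 1 -> zeta_residual z = (z - 1) * zeta z)).
Proof.
  assert (H : (Re 1 < 2)%R) by (rewrite Re_RtoC; lra).
  generalize (locally_Re_lt 2 1 H). apply filter_imp. intros z Hz. split; [exact Hz|].
  intros Hz1. apply zeta_residual_eq; assumption.
Qed.

Lemma meromorphic_at_zeta (s : C) : meromorphic_at zeta s.
Proof.
  destruct (Ceq_dec s 1) as [->|H]; [|apply meromorphic_at_hol1, hol2_hol1, hol2_zeta, H].
  exists 1%nat, zeta_residual. split; [apply hol2_hol1, hol2_zeta_residual|].
  unfold locally', within. generalize locally_1_zeta_residual. apply filter_imp.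
  intros z [_ Hz] Hz1. rewrite (Hz Hz1). simpl. ring.
Qed.

Lemma meromorphic_at_zeta' (s : C) : meromorphic_at (C_derive zeta) s.
Proof.
  destruct (Ceq_dec s 1) as [->|H]; [|apply meromorphic_at_hol1, hol2_C_derive, hol2_zeta, H].
  (* For R(z) = (z - 1) zeta(z) one has R' = zeta + (z - 1) zeta', so (z - 1) R' - R = (z - 1)^2
     zeta'. *)
  exists 2%nat, (fun z => (z - 1) * C_derive zeta_residual z - zeta_residual z). split.
  - apply hol1_plus.
    + apply hol1_mult; [|apply hol2_C_derive, hol2_zeta_residual].
      apply hol2_hol1, hol2_minus; [apply hol2_id|apply hol2_const].
    + apply hol2_hol1, hol2_opp, hol2_zeta_residual.
  - unfold locally', within.
    generalize (filter_and _ _ locally_1_zeta_residual (hol2_hol1 _ _ hol2_zeta_residual)).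
    apply filter_imp. intros z [[Hz2 Hz] [l Hl]] Hz1.
    assert (D : cder zeta_residual z (zeta z + (z - 1) * C_derive zeta z)).
    { apply cder_ext_loc with (fun w => (w - 1) * zeta w).
      - generalize (filter_and _ _ (locally_Re_lt 2 z Hz2) (locally_neq 1 z Hz1)). apply filter_imp.
        intros w [W1 W2]. symmetry. apply zeta_residual_eq; assumption.
      - eapply cder_eq.
        + apply cder_mult; [apply cder_minus; [apply cder_id|apply cder_const]|].
          apply hol1_cder, hol2_hol1, hol2_zeta, Hz1.
        + cbv beta. ring. }
    rewrite (is_C_derive_unique _ _ _ D), (Hz Hz1). simpl. ring.
Qed.

Lemma Gamma_nonpole_neq_0 (s : C) : nonpole s -> Gamma s <> 0.
Proof.
  assert (K : forall n s, (0 < Re s + INR n)%R -> nonpole s -> Gamma s <> 0).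
  { clear s. induction n as [|n IH]; intros s Hn Hs.
    - apply Gamma_neq_0. simpl in Hn. lra.
    - assert (S1 : Gamma (s + 1) <> 0).
      { apply IH; [|apply nonpole_succ, Hs]. rewrite S_INR in Hn. rewrite Re_plus, Re_RtoC. lra. }
      rewrite Gamma_succ in S1 by (apply nonpole_neq_0, Hs).
      intros E. apply S1. rewrite E. ring. }
  intros Hs. apply (K (Z.to_nat (up (- Re s)))); [apply up_neg_spec|exact Hs].
Qed.

(** Only finitely many of the points -n lie in a half-plane Re z > -N around s; each of them is
    avoided near s, or is s itself and is excluded from the punctured neighbourhood. *)
Lemma locally'_nonpole (s : C) : locally' s nonpole.
Proof.
  assert (K : forall N, locally' s (fun z => forall n, (n < N)%nat -> z <> - RtoC (INR n))).
  { induction N as [|N IH].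
    - apply locally'_of_locally, filter_forall. intros z n Hn. lia.
    - assert (A : locally' s (fun z => z <> - RtoC (INR N))).
      { destruct (Ceq_dec s (- RtoC (INR N))) as [->|H].
        - unfold locally', within. apply filter_forall. auto.
        - apply locally'_of_locally, locally_neq, H. }
      generalize (filter_and (F := locally' s) _ _ IH A). apply filter_imp.
      intros z [Z1 Z2] n Hn. destruct (Nat.eq_dec n N) as [->|Hne]; [exact Z2|]. apply Z1. lia. }
  set (N := Z.to_nat (up (- Re s))). assert (HN := up_neg_spec (Re s)). fold N in HN.
  assert (L : locally' s (fun z => - INR N < Re z)%R) by (apply locally'_of_locally, locally_Re_gt; lra).
  generalize (filter_and (F := locally' s) _ _ (K N) L). apply filter_imp.
  intros z [Z1 Z2] n E. destruct (le_lt_dec N n) as [H|H]; [|exact (Z1 n H E)].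
  rewrite E, <- RtoC_opp, Re_RtoC in Z2. apply le_INR in H. lra.
Qed.

Lemma digamma_succ (s : C) : nonpole s -> digamma s = digamma (s + 1) - / s.
Proof.
  intros Hs. assert (N := nonpole_neq_0 s Hs). assert (G := Gamma_nonpole_neq_0 s Hs).
  assert (D1 : cder (fun z => Gamma (z + 1)) s (1 * C_derive Gamma (s + 1))).
  { apply (cder_comp Gamma (fun z => z + 1)).
    - apply hol1_cder, hol2_hol1, hol2_Gamma, nonpole_succ, Hs.
    - eapply cder_eq; [apply cder_plus; [apply cder_id|apply cder_const]|]. ring. }
  assert (D2 : cder (fun z => Gamma (z + 1)) s (Gamma s + s * C_derive Gamma s)).
  { apply cder_ext_loc with (fun z => z * Gamma z).
    - generalize (locally_neq 0 s N). apply filter_imp. intros z Hz. symmetry. apply Gamma_succ, Hz.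
    - eapply cder_eq; [apply cder_mult; [apply cder_id|apply hol1_cder, hol2_hol1, hol2_Gamma, Hs]|].
      cbv beta. ring. }
  assert (E := cder_unique _ _ _ _ D1 D2). rewrite Cmult_1_l in E.
  unfold digamma. rewrite E, Gamma_succ by exact N. field. auto.
Qed.

(** The recursion moves one unit to the left at a time, at the cost of the term -1/z; it holds off
    the poles of Gamma, hence on a punctured neighbourhood of any point. *)
Lemma meromorphic_at_digamma (s : C) : meromorphic_at digamma s.
Proof.
  assert (K : forall n s, (0 < Re s + INR n)%R -> meromorphic_at digamma s).
  { clear s. induction n as [|n IH]; intros s Hn.
    - simpl in Hn. assert (Hs : (0 < Re s)%R) by lra. apply meromorphic_at_hol1.
      apply hol1_mult; [apply hol2_C_derive, hol2_Gamma_pos, Hs|].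
      apply hol1_inv; [apply hol2_hol1, hol2_Gamma_pos, Hs|apply Gamma_neq_0, Hs].
    - apply meromorphic_at_ext with (fun z => digamma (z + 1) - / z).
      + generalize (locally'_nonpole s). apply filter_imp. intros z Hz. symmetry.
        apply digamma_succ, Hz.
      + apply meromorphic_at_minus; [|apply meromorphic_at_Cinv].
        apply (meromorphic_at_translate digamma). apply IH.
        rewrite S_INR in Hn. rewrite Re_plus, Re_RtoC. lra. }
  apply (K (Z.to_nat (up (- Re s)))), up_neg_spec.
Qed.

Lemma meromorphic_rhs (k : nat) (G : C -> C) : (forall s, hol1 G s) -> meromorphic (rhs k G).
Proof.
  intros HG s.
  assert (Hp : meromorphic_at (fun z => / Rpowc (INR k) z) s).
  { apply meromorphic_at_hol1, hol1_inv; [|apply Rpowc_neq_0].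
    unfold Rpowc. apply hol2_hol1, (hol2_comp Cexp (fun z => z * ln (INR k))); [|apply hol2_Cexp].
    apply hol2_mult; [apply hol2_id|apply hol2_const]. }
  apply (meromorphic_at_minus (fun z => G z + zeta (z + 1))
    (fun z => / Rpowc (INR k) z * (digamma z * zeta z + C_derive zeta z - zeta z * RtoC (ln (INR k))))).
  - apply meromorphic_at_plus; [apply meromorphic_at_hol1, HG|].
    apply (meromorphic_at_translate zeta), meromorphic_at_zeta.
  - apply meromorphic_at_mult; [exact Hp|]. apply meromorphic_at_minus.
    + apply meromorphic_at_plus; [|apply meromorphic_at_zeta'].
      apply meromorphic_at_mult; [apply meromorphic_at_digamma|apply meromorphic_at_zeta].
    + apply meromorphic_at_mult; [apply meromorphic_at_zeta|].
      apply meromorphic_at_hol1, hol2_hol1, hol2_const.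
Qed.

Theorem theorem2 :
  forall (k : nat) (r : R),
    (1 <= k)%nat ->
    (0 < r < 2 * PI / INR k)%R ->
    (forall s : C, positive_integer s -> Icontour r s k = 0) /\
    exists G : C -> C,
      (forall s : C, ~ positive_integer s -> G s = Gamma (1 - s) * Icontour r s k) /\
      (forall s : C, positive_integer s ->
         filterlim G (locally' s) (locally (G s))) /\
      (forall s : C, (1 < Re s)%R ->
         is_series (K := C_AbsRing) (V := C_NormedModule)
           (fun n : nat => RtoC (A_coef k (S n)) * Rpowc (INR (S n)) (- s))
           (rhs k G s)) /\
      meromorphic (rhs k G).
Proof.
  intros k r Hk Hr. split; [intros s; apply Icontour_positive_integer; assumption|].
  exists (contour_G k r). split; [|split; [|split]].
  - intros s. apply contour_G_eq; assumption.
  - intros s _.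
    apply (filterlim_filter_le_1 (F := locally s)); [intros P; apply locally'_of_locally|].
    apply hol1_continuous, hol2_hol1, hol2_contour_G; assumption.
  - intros s. apply rhs_series; assumption.
  - apply meromorphic_rhs. intros s. apply hol2_hol1, hol2_contour_G; assumption.
Qed.
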